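(* Consider the family of vector fields on $\mathbb T^2$ $$\dot\theta=\cos\theta+\ell\omega+(1+u\omega)\cos\tau,\qquad \dot\tau=\omega,$$ with parameters $(\ell,u)\in\mathbb R^2$ and $\omega>0$, let $\rho$ be its rotation number and let $L_r(\omega)\subset\mathbb R^2_{\ell,u}$ be its phase-lock area with rotation number $r$. Put $Z_m=(2m-1,2m+1)$ for $m\in\mathbb Z_{\ge1}$ and $Z_0=(-\infty,1)$. 1) For every $r\in\mathbb Z$ the phase-lock area $L_r(\omega)$ converges, as $\omega\to0^+$, to the closure of the union $$L_r^0:=\bigcup_{k,\,k+r\in\mathbb Z_{\ge0}}\Lambda_{k,r},\qquad \Lambda_{k,r}:=\{(\ell,u)\in\mathbb R^2:\ u+\ell\in Z_{k+r},\ u-\ell\in Z_k\}.$$ Here each $\Lambda_{k,r}$ is: a square if $k,k+r\ge1$; a half-strip if exactly one of the numbers $k$, $k+r$ is zero; the sector $\{u+\ell<1,\ u-\ell<1\}$ with vertex $(\ell,u)=(0,1)$ if $k=r=0$. 2) For every $r\in\mathbb Z$, the vertices of the limit domain $L_r^0$ that lie in the line $\{\ell=r\}$ are exactly the limits, as $\omega\to0^+$, of constrictions of the phase-lock area $L_r(\omega)$.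
   Context: $\mathbb T^2=\mathbb R^2_{\theta,\tau}/2\pi\mathbb Z^2$. The family arises from the RSJ model of the overdamped Josephson junction $\frac{d\theta}{d\tau}=\frac1\omega(\cos\theta+B+A\cos\tau)$ through the rescaled parameters $\ell=B/\omega$, $u=(A-1)/\omega$. Rotation number: $\rho=\lim_{\tau\to+\infty}\theta(\tau)/\tau$, where $\theta(\tau)$ is any $\mathbb R$-valued solution of $\frac{d\theta}{d\tau}=\frac1\omega(\cos\theta+\ell\omega+(1+u\omega)\cos\tau)$ (the limit exists and does not depend on the solution). The phase-lock area $L_r(\omega)$ is the set of $(\ell,u)\in\mathbb R^2$ with rotation number equal to $r$ (provided that this set has nonempty interior). Convergence of subsets $M_\omega=L_r(\omega)$ of the parameter plane to a limit set means: for every bounded domain $D$, the intersections of $M_\omega$ and of its complement with the closure $\overline D$ converge in the Hausdorff sense to the intersections of $\overline D$ with the limit set and with its complement, respectively. Constrictions: the boundary of $L_r(\omega)$ in the $(B,A)$-plane consists of two graphs $L_{r,\alpha}=\{B=G_{r,\alpha}(A)\}$, $\alpha\in\{0,\pi\}$, of analytic functions, where $L_{r,\alpha}$ consists of those parameters with rotation number $r$ for which the Poincaré map (time $2\pi/\omega$ flow map) $S^1_\theta\times\{0\}\to S^1_\theta\times\{0\}$ fixes the point $(\alpha,0)$. A constriction of $L_r(\omega)$ is a point of $L_{r,0}\cap L_{r,\pi}$ with $A\ne0$, regarded in the coordinates $(\ell,u)$. Vertices of $L_r^0$ are vertices of the polygonal regions $\Lambda_{k,r}$ of which it is the union.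
   Formalization: Convergence is tested only on bounded domains D whose closure does not merely touch the limit set (or, for complements, its complement) from outside; for every D it fails, e.g. for the adjacent squares Λ_{1,0}, Λ_{1,1} with small bumps, since L_0(ω) and L_1(ω) are disjoint. *)

(* Defs.v *)
From HB Require Import structures.
From mathcomp Require Import all_boot all_order all_algebra.
From mathcomp Require Import all_classical all_reals all_analysis.

Set Implicit Arguments.
Unset Strict Implicit.
Unset Printing Implicit Defensive.

Import Order.TTheory GRing.Theory Num.Theory.
Import numFieldNormedType.Exports.

Local Open Scope classical_set_scope.
Local Open Scope ring_scope.

(* Conventions.  A parameter is a pair p = (l, u), so p.1 = l and p.2 = u.  A
   point of the torus T^2 = R^2 / 2 pi Z^2 is represented by a lift (theta, tau)
   in R^2.  The topology and the balls on R * R are those of the max norm, which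
   is equivalent to the Euclidean one. *)

(* The field is 2 pi Z^2-periodic in q, hence it descends to the torus. *)
Definition josephson_field {R : realType} (w : R) (p q : R * R) : R * R :=
  (cos q.1 + p.1 * w + (1 + p.2 * w) * cos q.2, w).

(* Lifts to R^2 of the integral curves (parametrised by the time t). *)
Definition trajectory {R : realType} (w : R) (p : R * R) (g : R -> R * R) : Prop :=
  forall t : R,
    is_derive t (1 : R) (fun s => (g s).1) (josephson_field w p (g t)).1 /\
    is_derive t (1 : R) (fun s => (g s).2) (josephson_field w p (g t)).2.

(* d theta / d tau = (1 / w) (cos theta + l w + (1 + u w) cos tau) *)
Definition tau_solution {R : realType} (w : R) (p : R * R) (theta : R -> R) : Prop :=
  forall tau : R,
    is_derive tau (1 : R) theta (w^-1 * (josephson_field w p (theta tau, tau)).1).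

(* The existence clause only rules out a vacuous quantification over solutions. *)
Definition has_rotation_number {R : realType} (w : R) (p : R * R) (rho : R) : Prop :=
  (exists theta : R -> R, tau_solution w p theta) /\
  (forall theta : R -> R, tau_solution w p theta ->
     theta tau / tau @[tau --> +oo] --> rho).

Definition rotation_level {R : realType} (r w : R) : set (R * R) :=
  [set p | has_rotation_number w p r].

(* A level set with empty interior gives no phase-lock area. *)
Definition phase_lock_area {R : realType} (r w : R) : set (R * R) :=
  [set p | rotation_level r w p /\ (rotation_level r w)° !=set0].

Definition same_torus_point {R : realType} (q q' : R * R) : Prop :=
  exists m n : int, q.1 - q'.1 = 2 * pi * m%:~R /\ q.2 - q'.2 = 2 * pi * n%:~R.

(* The Poincare map of the cross-section {tau = 0 mod 2 pi} is the flow map of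
   time 2 pi / w. *)
Definition poincare_fixes {R : realType} (w : R) (p : R * R) (alpha : R) : Prop :=
  exists g : R -> R * R,
    [/\ trajectory w p g, g 0 = (alpha, 0)
      & same_torus_point (g (2 * pi / w)) (alpha, 0)].

Definition boundary_curve {R : realType} (r w alpha : R) : set (R * R) :=
  [set p | phase_lock_area r w p /\ poincare_fixes w p alpha].

(* In the coordinates (l, u), the amplitude is A = 1 + u w. *)
Definition constriction {R : realType} (r w : R) : set (R * R) :=
  [set p | [/\ boundary_curve r w 0 p, boundary_curve r w pi p
             & 1 + p.2 * w != 0]].

(* Two empty sets are at distance zero, and an empty set is at infinite distance
   from a nonempty one. *)
Definition hausdorff_cvg {R : realType} (M : R -> set (R * R)) (N : set (R * R)) :
    Prop :=
  forall e : R, 0 < e -> \forall w \near (0 : R)^'+,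
    (forall p, M w p -> exists2 q, N q & ball p e q) /\
    (forall q, N q -> exists2 p, M w p & ball q e p).

Definition bounded_domain {R : realType} (D : set (R * R)) : Prop :=
  [/\ open D, connected D, D !=set0 & bounded_set D].

(* The closure of D does not merely touch N from the outside: every point of N
   (or of its boundary) in closure D is approached by interior points of N lying
   in D.  If closure D meets closed N in a single boundary point of N, then an
   arbitrarily small displacement of N can make this intersection empty, so such
   a D cannot be used to test Hausdorff convergence of intersections. *)
Definition nontangent {R : realType} (D N : set (R * R)) : Prop :=
  closure D `&` closure N `<=` closure (D `&` N°).

Definition cvg_on {R : realType} (D : set (R * R))
    (M : R -> set (R * R)) (N : set (R * R)) : Prop :=
  nontangent D N ->
  hausdorff_cvg (fun w => M w `&` closure D) (N `&` closure D).

Definition region_cvg {R : realType} (M : R -> set (R * R)) (N : set (R * R)) :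
    Prop :=
  forall D : set (R * R), bounded_domain D ->
    cvg_on D M N /\ cvg_on D (fun w => ~` M w) (~` N).

(* Only used for m >= 0. *)
Definition Zint {R : realType} (m : int) : set R :=
  if m == 0 then [set x | x < 1]
  else [set x | 2 * m%:~R - 1 < x < 2 * m%:~R + 1].

Definition Lambda {R : realType} (k r : int) : set (R * R) :=
  [set p | Zint (k + r) (p.2 + p.1) /\ Zint k (p.2 - p.1)].

Definition limit_domain {R : realType} (r : int) : set (R * R) :=
  \bigcup_(k in [set k : int | 0 <= k /\ 0 <= k + r]) Lambda k r.

Definition orthogonal_frame {R : realType} (v w : R * R) : Prop :=
  [/\ v != 0, w != 0 & v.1 * w.1 + v.2 * w.2 = 0].

Definition is_square {R : realType} (S : set (R * R)) : Prop :=
  exists c v w : R * R,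
    [/\ orthogonal_frame v w,
        v.1 ^+ 2 + v.2 ^+ 2 = w.1 ^+ 2 + w.2 ^+ 2
      & S = [set p | exists a b : R,
               [/\ -1 < a < 1, -1 < b < 1 & p = c + a *: v + b *: w]]].

Definition is_half_strip {R : realType} (S : set (R * R)) : Prop :=
  exists c v w : R * R,
    orthogonal_frame v w /\
    S = [set p | exists a b : R,
           [/\ -1 < a < 1, 0 < b & p = c + a *: v + b *: w]].

Definition is_sector {R : realType} (c : R * R) (S : set (R * R)) : Prop :=
  exists v w : R * R,
    v.1 * w.2 != v.2 * w.1 /\
    S = [set p | exists a b : R, [/\ 0 < a, 0 < b & p = c + a *: v + b *: w]].

(* The vertices of a (possibly unbounded) convex polygonal region are the
   extreme points of its closure. *)
Definition polygon_vertex {R : realType} (S : set (R * R)) : set (R * R) :=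
  [set p | closure S p /\
     forall (x y : R * R) (t : R), closure S x -> closure S y -> 0 < t < 1 ->
       p = t *: x + (1 - t) *: y -> x = p /\ y = p].

Definition limit_domain_vertex {R : realType} (r : int) : set (R * R) :=
  [set p | exists k : int,
     [/\ 0 <= k, 0 <= k + r & polygon_vertex (Lambda k r) p]].

Definition constriction_limit {R : realType} (r : R) : set (R * R) :=
  [set p | exists c : R -> R * R,
     (\forall w \near (0 : R)^'+, constriction r w (c w)) /\
     c w @[w --> 0^'+] --> p].

Definition constriction_seq_limit {R : realType} (r : R) : set (R * R) :=
  [set p | exists (w : nat -> R) (c : nat -> R * R),
     [/\ forall n, 0 < w n, w n @[n --> \oo] --> (0 : R),
         forall n, constriction r (w n) (c n) & c n @[n --> \oo] --> p]].

(* Main.v *)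
(* In the time tau the equation is slow-fast, with slow curves theta = pi + tau and
   theta = pi - tau that cross at tau = 0 (and, symmetrically, at tau = pi). Near
   a crossing the equation is a Riccati equation whose linearisation is Hermite's,
   with a polynomial solution exactly when u + l (resp. u - l) is an odd positive
   integer 2n + 1. A continuous argument of the corresponding solution vector, which
   exists by a Turan inequality for Hermite polynomials, is a barrier for the true
   solution and tells on which side of the repelling slow curve it leaves.
   Two symmetries reduce the sign of (return map - 2 pi r) at theta = 0 and pi to a
   comparison of two values at tau = pi / 2, hence to the position of u + l and
   u - l with respect to the odd integers. Opposite signs at 0 and pi force the
   rotation number to be r, on the domains Lambda; as these domains are dense,
   monotonicity of the rotation number in l settles the complement. At a constriction
   both signs vanish, which excludes every limit except the points where u + l and
   u - l are both odd and l = r; conversely, around such a point the zero sets of the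
   two strictly monotone functions cross by the intermediate value theorem. *)
Require Import Defs.
From HB Require Import structures.
From mathcomp Require Import all_boot all_order all_algebra.
From mathcomp Require Import all_classical all_reals all_analysis.
From mathcomp Require Import ring lra zify.
Set Implicit Arguments.
Unset Strict Implicit.
Unset Printing Implicit Defensive.
Import Order.TTheory GRing.Theory Num.Theory.
Import numFieldNormedType.Exports.
Local Open Scope classical_set_scope.
Local Open Scope ring_scope.

(** * Differential inequalities *)

Section Calculus.
Context {R : realType}.
Implicit Types (f g d : R -> R) (a b t x y L : R).

(** The tangent of the half angle solves the Riccati equation but has poles, and the number of poles
    passed is precisely what decides the index of the zone; hence barriers are built for the angle
    itself, as continuous arguments that keep this count. The Lipschitz constant of the equation is
    [w^-1], so an asymptotic expansion with an error multiplied by [w^-1] would be useless. The two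
    variables in which the Hermite vector is expressed are chosen so that all terms of order [w^-1]
    cancel identically, or leave a remainder of known sign; what is left is compared with
    [u + l - (2 n + 1)] up to errors of order [t] and [w]. A barrier is needed only up to a small
    time fixed independently of [w]: the solution is then off the slow curve by a fixed amount, and
    the field, of size [w^-1], carries it away. All estimates hold jointly for parameters near a
    point and [w] near 0. This uniformity serves limits of moving constrictions, and compactness
    extends it to segments and to the closure of a bounded domain. *)

Lemma is_derive_continuous f x df : is_derive x (1 : R) f df -> {for x, continuous f}.
Proof. by move=> [df1 _]; apply/differentiable_continuous/derivable1_diffP. Qed.

Lemma is_derive_within_continuous f df a b :
  (forall t, a <= t <= b -> is_derive t (1 : R) f (df t)) ->
  {within `[a, b], continuous f}.
Proof.
move=> H; apply: derivable_within_continuous => t; rewrite in_itv /= => tab.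
by have [] := H t tab.
Qed.

Lemma is_derive_MVT f df a b : a < b ->
  (forall t, a <= t <= b -> is_derive t (1 : R) f (df t)) ->
  exists2 c, a < c < b & f b - f a = df c * (b - a).
Proof.
move=> ab H; have [c cab E] := @MVT R f df a b ab
    (fun t (tab : t \in `]a, b[) => H t ltac:(by rewrite !ltW ?(itvP tab)))
    (is_derive_within_continuous H).
by exists c => //; rewrite (itvP cab).
Qed.

Lemma derive_le0_le f df a b : a <= b ->
  (forall t, a <= t <= b -> is_derive t (1 : R) f (df t)) ->
  (forall t, a < t < b -> df t <= 0) -> f b <= f a.
Proof.
rewrite le_eqVlt => /predU1P[-> //|ab] H df0.
have [c cab E] := is_derive_MVT ab H.
by rewrite -subr_le0 E mulr_le0_ge0 ?df0// subr_ge0 ltW.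
Qed.

Lemma derive_ge0_le f df a b : a <= b ->
  (forall t, a <= t <= b -> is_derive t (1 : R) f (df t)) ->
  (forall t, a < t < b -> 0 <= df t) -> f a <= f b.
Proof.
rewrite le_eqVlt => /predU1P[-> //|ab] H df0.
have [c cab E] := is_derive_MVT ab H.
by rewrite -subr_ge0 E mulr_ge0 ?df0// subr_ge0 ltW.
Qed.

(** After the last time with [d <= 0], the function [expR (- L * t) * d t] is nonincreasing, so [d]
    cannot become positive. Asking for the inequality only where [0 < d] lets a comparison use a
    Lipschitz bound with a known sign. *)
Lemma diff_ineq_le0 L a b d (d' : R -> R) : a <= b ->
  (forall t, a <= t <= b -> is_derive t (1 : R) d (d' t)) ->
  d a <= 0 -> (forall t, a <= t <= b -> 0 < d t -> d' t <= L * d t) -> d b <= 0.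
Proof.
move=> ab H da Hd; rewrite leNgt; apply/negP => db.
pose A := [set t | a <= t <= b /\ d t <= 0].
have Aa : A a by rewrite /A /= lexx ab.
have supA : has_sup A by split; [exists a|exists b => t [/andP[]]].
have at0 : a <= sup A by apply: ub_le_sup; [exact: supA.2|].
have t0b : sup A <= b by apply: ge_sup; [exists a|move=> t [/andP[]]].
have dt0 : d (sup A) <= 0.
  rewrite leNgt; apply/negP => dt0.
  have cd : {for sup A, continuous d}.
    by apply: is_derive_continuous; apply: H; rewrite at0 t0b.
  have /nbhs_ballP[e /= e0 He] : \forall t \near sup A, 0 < d t.
    exact: (cvgr_gt (d (sup A)) cd _ dt0).
  have [t At tt0] := sup_adherent e0 supA.
  have : 0 < d t.
    apply: He; rewrite /ball /= ger0_norm ?subr_ge0; first by rewrite ltrBlDl -ltrBlDr.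
    by apply: ub_le_sup; [exact: supA.2|].
  by rewrite ltNge At.2.
have {t0b} t0b : sup A < b.
  by rewrite lt_neqAle t0b andbT; apply/eqP => E; move: dt0; rewrite E leNgt db.
have dpos t : sup A < t <= b -> 0 < d t.
  move=> /andP[t1 t2]; rewrite ltNge; apply/negP => dt.
  have : t <= sup A.
    by apply: ub_le_sup; [exact: supA.2|split => //; rewrite t2 (le_trans at0 (ltW t1))].
  by rewrite leNgt t1.
have HE t : sup A <= t <= b -> is_derive t (1 : R) (fun t => expR (- L * t) * d t)
   (expR (- L * t) * (d' t - L * d t)).
  move=> /andP[t1 t2]; have ? := H t ltac:(by rewrite t2 (le_trans at0 t1)).
  by apply: trigger_derive; rewrite /GRing.scale /=; ring.
have := derive_le0_le (ltW t0b) HE.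
suff h : forall t, sup A < t < b -> expR (- L * t) * (d' t - L * d t) <= 0.
  move=> /(_ h); apply/negP; rewrite -ltNge.
  apply: (@le_lt_trans _ _ 0); first by rewrite pmulr_rle0 ?expR_gt0.
  by rewrite mulr_gt0 ?expR_gt0.
move=> t /andP[t1 t2]; rewrite pmulr_rle0 ?expR_gt0// subr_le0 Hd//.
  by rewrite (ltW t2) (le_trans at0 (ltW t1)).
by rewrite dpos// t1 ltW.
Qed.

End Calculus.

Section Primitive.
Context {R : realType}.
Implicit Types (f g P Q : R -> R) (a b t x y : R).

Lemma near_dist t e : 0 < e -> \forall s \near t, `|t - s| < e.
Proof. by move=> e0; apply/nbhs_ballP; exists e. Qed.

Lemma primitive_uniq f P Q a b : (forall t, a < t < b -> is_derive t (1 : R) P (f t)) ->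
  (forall t, a < t < b -> is_derive t (1 : R) Q (f t)) ->
  forall x y, a < x < b -> a < y < b -> P x = Q x -> P y = Q y.
Proof.
move=> HP HQ.
suff H x y : a < x < b -> a < y < b -> x <= y -> P y - P x = Q y - Q x.
  move=> x y ax ay PQx; have [xy|/ltW yx] := leP x y.
    by have := H _ _ ax ay xy; rewrite PQx => /addIr.
  by have := H _ _ ay ax yx; rewrite PQx => /addrI/oppr_inj.
move=> /andP[x1 x2] /andP[y1 y2] xy.
have D t : x <= t <= y -> is_derive t (1 : R) (fun t => P t - Q t) 0.
  move=> /andP[xt ty].
  have tab : a < t < b by rewrite (lt_le_trans x1 xt) (le_lt_trans ty y2).
  have := HP t tab; have := HQ t tab => ? ?.
  by apply: trigger_derive; rewrite subrr.
have h1 := derive_le0_le xy D (fun _ _ => lexx 0).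
have h2 := derive_ge0_le xy D (fun _ _ => lexx 0).
by apply/eqP; rewrite -subr_eq0; apply/eqP; lra.
Qed.

(** The fundamental theorem of calculus is applied on [[- n.+1, n.+1]] for every [n]. Normalised to
    vanish at 0, these primitives agree where they overlap and are glued along the integer part of
    [|t|]. *)
Lemma continuous_primitive f : continuous f ->
  exists2 P, P 0 = 0 & forall t, is_derive t (1 : R) P (f t).
Proof.
move=> cf.
pose I (n : nat) t := (\int[lebesgue_measure]_(s in [set` `[- n.+1%:R, t]]) f s)%R.
have DI (n : nat) t : - n.+1%:R < t < n.+1%:R ->
    is_derive t (1 : R) (I n) (f t).
  move=> /andP[t1 t2].
  have [] := @continuous_FTC1_closed R f (- n.+1%:R) t n.+1%:R t2 _ t1 (cf t).
    apply: continuous_compact_integrable; first exact: segment_compact.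
    exact: continuous_subspaceT.
  by rewrite derive1E => h1 h2; split.
pose J n t := I n t - I n 0.
have DJ (n : nat) t : - n.+1%:R < t < n.+1%:R -> is_derive t (1 : R) (J n) (f t).
  by move=> /DI ?; apply: trigger_derive; rewrite subr0.
have JE (n m : nat) t : `|t| < n.+1%:R -> `|t| < m.+1%:R -> J n t = J m t.
  wlog nm : n m / (n <= m)%N => [hw tn tm|].
    by have [nm|/ltnW nm] := leqP n m; [exact: hw|rewrite (hw m n)].
  move=> tn tm; apply: (@primitive_uniq f (J n) (J m) (- n.+1%:R) n.+1%:R (DJ n) _ 0 t).
  - move=> s /andP[s1 s2]; apply: DJ.
    have h : n.+1%:R <= m.+1%:R :> R by rewrite ler_nat.
    by apply/andP; split; lra.
  - by rewrite oppr_lt0 !ltr0n.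
  - by rewrite -ltr_norml.
  - by rewrite /J !subrr.
exists (fun t => J (Num.trunc `|t|) t); first by rewrite /J subrr.
move=> t; have tT (s : R) : `|s| < (Num.trunc `|s|).+1%:R.
  by have /andP[] := truncn_itv (normr_ge0 s).
pose N := (Num.trunc `|t|).
apply: (@near_eq_is_derive _ _ _ (J N)); last first.
  by apply: DJ; rewrite -ltr_norml; exact: tT.
have e0 : 0 < N.+1%:R - `|t| by rewrite subr_gt0 tT.
apply: filterS (near_dist t e0) => s st; apply: JE; last exact: tT.
by have := ler_normD (s - t) t; rewrite subrK distrC; lra.
Qed.

End Primitive.

(** * Existence and order of solutions *)

Section Growth.
Context {R : realType}.
Implicit Types (f g : R -> R) (a b t x y L M K : R).

Lemma le_geometric_le0 x K : (forall n : nat, x <= K / 2 ^+ n) -> x <= 0.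
Proof.
move=> H; rewrite leNgt; apply/negP => x0.
have K0 : 0 <= K / x by rewrite divr_ge0 ?ltW//; have := H 0; rewrite divr1; lra.
have /andP[_ h] := truncn_itv K0.
set n := (Num.trunc (K / x)).+1 in h.
have n0 : 0 < 2 ^+ n :> R by rewrite exprn_gt0.
have h2 : n%:R < 2 ^+ n :> R by rewrite -natrX ltr_nat ltn_expl.
have := H n; rewrite ler_pdivlMr// leNgt => /negP; apply.
by rewrite mulrC -ltr_pdivrMr// (lt_trans h).
Qed.

(** Against the weight [expR (2 * L * t)] one integration gains a factor 1/2. Picard iteration thus
    contracts on the whole line at once, without a subdivision into short intervals. *)
Lemma growth_le (D D' : R -> R) L K t : 0 < L -> 0 <= K -> D 0 = 0 -> 0 <= t ->
  (forall s, 0 <= s <= t -> is_derive s (1 : R) D (D' s)) ->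
  (forall s, 0 <= s <= t -> D' s <= L * (K * expR (2 * L * s))) ->
  D t <= K / 2 * expR (2 * L * t).
Proof.
move=> L0 K0 D0 t0 HD HB.
have H s : 0 <= s <= t ->
    is_derive s (1 : R) (fun s => D s - K / 2 * expR (2 * L * s))
      (D' s - L * (K * expR (2 * L * s))).
  move=> st; have ? := HD s st; apply: trigger_derive.
  by rewrite /GRing.scale /=; field.
have := derive_le0_le t0 H.
rewrite D0 mulr0 expR0 => h; have {}h : D t - K / 2 * expR (2 * L * t) <= 0 - K / 2 * 1.
  by apply: h => s /andP[s0 st]; rewrite subr_le0 HB// !ltW.
by lra.
Qed.

Lemma growth_norm_le (D D' : R -> R) L K : 0 < L -> 0 <= K -> D 0 = 0 ->
  (forall s, is_derive s (1 : R) D (D' s)) ->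
  (forall s, `|D' s| <= L * (K * expR (2 * L * `|s|))) ->
  forall t, `|D t| <= K / 2 * expR (2 * L * `|t|).
Proof.
move=> L0 K0.
have pos E (E' : R -> R) t : E 0 = 0 ->
    (forall s, is_derive s (1 : R) E (E' s)) ->
    (forall s, `|E' s| <= L * (K * expR (2 * L * `|s|))) -> 0 <= t ->
    `|E t| <= K / 2 * expR (2 * L * t).
  move=> E0 HE HB t0; rewrite ler_norml; apply/andP; split; last first.
    apply: (@growth_le E E') => // s /andP[s0 _].
    by rewrite (le_trans (ler_norm _))// -{2}(ger0_norm s0) HB.
  rewrite lerNl; apply: (@growth_le (fun t => - E t) (fun t => - E' t)) => //.
  - by rewrite E0 oppr0.
  - move=> s /andP[s0 _].
    by rewrite (le_trans (ler_norm _))// normrN -{2}(ger0_norm s0) HB.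
move=> D0 HD HB t; have [t0|/ltW t0] := leP 0 t; first by rewrite (ger0_norm t0); exact: (pos D D').
rewrite (ler0_norm t0); have := @pos (fun s => D (- s)) (fun s => - D' (- s)) (- t).
rewrite opprK; apply; rewrite ?oppr0 ?oppr_ge0//.
- move=> s; have h := HD (- s).
  by apply: trigger_derive; rewrite mulrN1.
- by move=> s; rewrite normrN -(normrN s) HB.
Qed.

End Growth.

Section Picard.
Context {R : realType}.
Implicit Types (f g : R -> R) (a b t x y L M K : R).
Lemma is_derive_addl a f t df : is_derive t (1 : R) f df ->
  is_derive t (1 : R) (fun t => a + f t) df.
Proof. by move=> h; rewrite -[df]add0r; apply: is_deriveD. Qed.

Lemma ode_exists (F : R -> R -> R) L M a : 0 < L ->
  (forall u : R -> R, continuous u -> continuous (fun t => F t (u t))) ->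
  (forall t x, `|F t x| <= M) ->
  (forall t x y, `|F t x - F t y| <= L * `|x - y|) ->
  exists u : R -> R, u 0 = a /\ forall t, is_derive t (1 : R) u (F t (u t)).
Proof.
move=> L0 cF bF lF.
have M0 : 0 <= M by exact: le_trans (bF 0 0).
(* Guarding the specification by continuity makes the choice of a primitive total, so the iterates
   can be defined before they are known to be continuous. *)
have [f|Pr HPr] := @choice _ _ (fun f P : R -> R => continuous f ->
    P 0 = 0 /\ forall t, is_derive t (1 : R) P (f t)).
  have [cf|ncf] := pselect (continuous f); last by exists f.
  by have [P P0 HP] := continuous_primitive cf; exists P.
pose v := fix v (n : nat) : R -> R :=
  if n is m.+1 then fun t => a + Pr (fun s => F s (v m s)) t else cst a.
have cv n : continuous (v n).
  elim: n => [|n IH] t; first exact: cst_continuous.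
  have [_ /(_ t) h] := HPr _ (cF _ IH).
  exact: is_derive_continuous (is_derive_addl a h).
have dv n t : is_derive t (1 : R) (v n.+1) (F t (v n t)).
  have [_ /(_ t) h] := HPr _ (cF _ (cv n)).
  exact: is_derive_addl.
have v0 n : v n 0 = a by case: n => [//|n] /=; have [-> _] := HPr _ (cF _ (cv n)); rewrite addr0.
pose B := M / L.
have B0 : 0 <= B by rewrite divr_ge0// ltW.
pose e t := expR (2 * L * `|t|).
have e1 t : 1 <= e t by rewrite -expR0 ler_expR !mulr_ge0// ltW.
have p2 n : 0 < 2 ^+ n :> R by rewrite exprn_gt0.
have step n t : `|v n.+1 t - v n t| <= B / 2 ^+ n / 2 * e t.
  elim: n t => [|n IH].
    rewrite expr0 divr1; apply: (@growth_norm_le R (fun t => v 1 t - v 0 t) (fun t => F t a)) => //.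
    - by rewrite !v0 subrr.
    - by move=> s; have ? := dv 0 s; apply: trigger_derive; rewrite subr0.
    - move=> s; apply: (le_trans (bF _ _)); rewrite /B mulrA mulrCA divff ?gt_eqF// mulr1.
      by rewrite ler_peMr// e1.
  apply: (@growth_norm_le R (fun t => v n.+2 t - v n.+1 t)
     (fun t => F t (v n.+1 t) - F t (v n t))) => //.
  - by rewrite divr_ge0// ltW.
  - by rewrite !v0 subrr.
  - move=> s; apply: (le_trans (lF _ _ _)); rewrite ler_pM2l//.
    by rewrite exprSr invfM mulrA IH.
pose r n t := B / 2 ^+ n * e t.
have rS n t : r n.+1 t = r n t / 2 by rewrite /r exprSr invfM; ring.
have r0 n t : 0 <= r n t.
  by rewrite mulr_ge0// ?expR_ge0// divr_ge0// ltW.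
have stepr n t : `|v n.+1 t - v n t| <= r n.+1 t.
  by rewrite rS /r mulrAC step.
have mono t k n : v n t - r n t <= v (n + k)%N t - r (n + k)%N t /\
    v (n + k)%N t + r (n + k)%N t <= v n t + r n t.
  elim: k => [|k [IH1 IH2]]; first by rewrite addn0.
  rewrite addnS; have := stepr (n + k)%N t; rewrite ler_norml.
  by have := rS (n + k)%N t => E /andP[h1 h2]; split; lra.
(* Hence [v n - r n] increases and [v n + r n] decreases in [n], which makes the
   limit of the Picard iterates a supremum. *)
have sandwich t n m : v m t - r m t <= v n t + r n t.
  have := mono t m n; have := mono t n m; rewrite addnC.
  by have := r0 (n + m)%N t; lra.
pose u t := sup (range (fun n => v n t - r n t)).
have ur t n : `|u t - v n t| <= r n t.
  rewrite ler_distl; apply/andP; split.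
    apply: ub_le_sup; last by exists n.
    by exists (v 0 t + r 0 t) => _ [m _ <-]; exact: sandwich.
  by apply: ge_sup; [exists (v 0 t - r 0 t), 0%N|move=> _ [m _ <-]; exact: sandwich].
(* All iterates share the Lipschitz constant [M], and a pointwise limit inherits it: the continuity
   of [u] needs no uniform convergence. *)
have lip n s t : `|v n s - v n t| <= M * `|s - t|.
  wlog st : s t / s <= t => [hw|].
    have [/hw//|/ltW/hw] := leP s t.
    by rewrite distrC (distrC t).
  case: n => [|n]; first by rewrite subrr normr0 mulr_ge0.
  move: st; rewrite le_eqVlt => /predU1P[->|st].
    by rewrite !subrr normr0 mulr0.
  have [c _ E] := @is_derive_MVT _ _ _ _ _ st (fun t _ => dv n t).
  by rewrite distrC E normrM (distrC s) ler_wpM2r.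
have ulip s t : `|u s - u t| <= M * `|s - t|.
  rewrite -subr_le0; apply: (@le_geometric_le0 R _ (B * (e s + e t))) => n.
  have := ur s n; have := ur t n; have := lip n s t.
  have := ler_distD (v n s) (u s) (u t); have := ler_distD (v n t) (v n s) (u t).
  rewrite (distrC (v n t)).
  rewrite [B * _ / _](_ : _ = r n s + r n t); last by rewrite /r; ring.
  by lra.
have cu : continuous u.
  move=> t; apply/cvgrPdist_lt => eps eps0.
  have d0 : 0 < eps / (M + 1) by rewrite divr_gt0// ltr_wpDl.
  apply: filterS (near_dist t d0) => s; rewrite ltr_pdivlMr ?ltr_wpDl// => h.
  apply: (le_lt_trans (ulip t s)); apply: le_lt_trans h.
  by rewrite mulrC ler_wpM2l// lerDl.
have [P0 HP] := HPr _ (cF _ cu).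
set w := fun t => a + Pr (fun s => F s (u s)) t.
have dw t : is_derive t (1 : R) w (F t (u t)).
  by have ? := HP t; exact: is_derive_addl.
have uw t : u t = w t.
  apply/eqP; rewrite -subr_eq0 -normr_le0.
  apply: (@le_geometric_le0 R _ (B * e t)) => n.
  have h : `|v n.+1 t - w t| <= B / 2 ^+ n / 2 * e t.
    apply: (@growth_norm_le R (fun t => v n.+1 t - w t)
      (fun t => F t (v n t) - F t (u t))) => //.
    - by rewrite divr_ge0// ltW.
    - by rewrite v0 /w P0 addr0 subrr.
    - move=> s; apply: (le_trans (lF _ _ _)); rewrite ler_pM2l//.
      by rewrite distrC ur.
  have := ur t n.+1; rewrite rS.
  have := ler_distD (v n.+1 t) (u t) (w t); move: h; rewrite /r.
  by rewrite (_ : B * e t / 2 ^+ n = B / 2 ^+ n * e t); [lra|ring].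
exists u; split; first by rewrite uw /w P0 addr0.
by move=> t; rewrite (_ : u = w) ?uw//; [have := dw t; rewrite uw|apply/funext].
Qed.

End Picard.

Section OrderOfSolutions.
Context {R : realType}.
Implicit Types (F : R -> R -> R) (x y : R -> R) (a b s t L : R).

(** The main comparison tool: [x] is a super-solution and [y] a sub-solution. Weak inequalities
    suffice because [F] is Lipschitz in its second argument. *)
Lemma ode_le F L a b x y (x' y' : R -> R) : a <= b ->
  (forall t p q, `|F t p - F t q| <= L * `|p - q|) ->
  (forall t, a <= t <= b -> is_derive t (1 : R) x (x' t)) ->
  (forall t, a <= t <= b -> is_derive t (1 : R) y (y' t)) ->
  (forall t, a <= t <= b -> F t (x t) <= x' t) ->
  (forall t, a <= t <= b -> y' t <= F t (y t)) ->
  y a <= x a -> y b <= x b.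
Proof.
move=> ab lF dx dy Hx Hy ya; rewrite -subr_le0.
apply: (@diff_ineq_le0 R L a b (fun t => y t - x t) (fun t => y' t - x' t)) => //.
- by move=> t tab; have ? := dx t tab; have ? := dy t tab; apply: trigger_derive.
- by rewrite subr_le0.
- move=> t tab dt; have := Hx t tab; have := Hy t tab.
  have := le_trans (ler_norm _) (lF t (y t) (x t)).
  by rewrite (gtr0_norm dt); lra.
Qed.

Lemma ode_sol_le F L x y : (forall t p q, `|F t p - F t q| <= L * `|p - q|) ->
  (forall t, is_derive t (1 : R) x (F t (x t))) ->
  (forall t, is_derive t (1 : R) y (F t (y t))) ->
  forall s t, y s <= x s -> y t <= x t.
Proof.
move=> lF dx dy s t yxs; have [st|/ltW ts] := leP s t.
  exact: (ode_le st lF (fun t _ => dx t) (fun t _ => dy t)).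
(* Backwards in time the comparison is run for the reversed field, which has the same Lipschitz
   constant. *)
have lG r p q : `|(- F (- r) p) - (- F (- r) q)| <= L * `|p - q|.
  by rewrite -opprD normrN lF.
have dN z : (forall t, is_derive t (1 : R) z (F t (z t))) ->
    forall t, is_derive t (1 : R) (fun t => z (- t)) (- F (- t) (z (- t))).
  by move=> dz r; have ? := dz (- r); apply: trigger_derive; rewrite mulrN1.
have := @ode_le (fun t p => - F (- t) p) L (- s) (- t) (fun t => x (- t)) (fun t => y (- t)).
rewrite !opprK; apply=> //; by rewrite lerN2.
Qed.

End OrderOfSolutions.

(** * The Josephson equation and its symmetries *)

Section Josephson.
Context {R : realType}.
Implicit Types (p : R * R) (x y th : R -> R) (a b s t w : R).

Definition vf w p t a : R := (cos a + cos t) / w + (p.1 + p.2 * cos t).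

Lemma vfE w p t a : w != 0 -> w^-1 * (josephson_field w p (a, t)).1 = vf w p t a.
Proof. by move=> w0; rewrite /vf /=; field. Qed.

Lemma tau_solutionP w p th : w != 0 ->
  tau_solution w p th <-> forall t, is_derive t (1 : R) th (vf w p t (th t)).
Proof. by move=> w0; split=> H t; have := H t; rewrite vfE. Qed.

Lemma cos_lipschitz a b : `|cos a - cos b| <= `|a - b| :> R.
Proof.
wlog ab : a b / a <= b => [hw|].
  by have [/hw//|/ltW/hw] := leP a b; rewrite distrC (distrC b).
move: ab; rewrite le_eqVlt => /predU1P[->|ab]; first by rewrite !subrr.
have [c _ E] := is_derive_MVT ab (fun t _ => is_derive_cos t).
by rewrite distrC E normrM (distrC a) ler_piMl// normrN sin_max.
Qed.

Lemma vf_lipschitz w p t a b : 0 < w -> `|vf w p t a - vf w p t b| <= w^-1 * `|a - b|.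
Proof.
move=> w0; rewrite [X in `|X|](_ : _ = w^-1 * (cos a - cos b)); last first.
  by rewrite /vf; field; rewrite gt_eqF.
by rewrite normrM gtr0_norm ?invr_gt0// ler_pM2l ?invr_gt0// cos_lipschitz.
Qed.

Definition vfbound w p : R := 2 / w + (`|p.1| + `|p.2|).

Lemma vf_bounded w p t a : 0 < w -> `|vf w p t a| <= vfbound w p.
Proof.
move=> w0; apply: (le_trans (ler_normD _ _)); apply: lerD.
  rewrite normrM normfV (gtr0_norm w0) ler_pM2r ?invr_gt0//.
  by apply: (le_trans (ler_normD _ _)); have := cos_max a; have := cos_max t; lra.
apply: (le_trans (ler_normD _ _)); rewrite lerD2l normrM ler_piMr//.
exact: cos_max.
Qed.

Lemma sol_exists w p a : 0 < w -> exists th, th 0 = a /\ tau_solution w p th.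
Proof.
move=> w0; have w0' : w != 0 by rewrite gt_eqF.
have [||||th [th0 H]] := @ode_exists R (vf w p) w^-1 (vfbound w p) a.
- by rewrite invr_gt0.
- move=> u cu t; rewrite /vf.
  apply: cvgD; first apply: cvgMr_tmp; first apply: cvgD.
  + exact: continuous_comp (cu t) (@continuous_cos _ _).
  + exact: continuous_cos.
  + by apply: cvgD; [exact: cvg_cst|apply: cvgMl_tmp; exact: continuous_cos].
- by move=> t x; exact: vf_bounded.
- by move=> t x y; exact: vf_lipschitz.
- by exists th; split => //; apply/tau_solutionP.
Qed.

Definition sol w p a : R -> R := xget (cst 0) [set th | th 0 = a /\ tau_solution w p th].

Lemma solP w p a : 0 < w -> sol w p a 0 = a /\ tau_solution w p (sol w p a).
Proof. by move=> w0; have [th H] := sol_exists p a w0; exact: (@xgetI _ (cst 0) [set th | th 0 = a /\ tau_solution w p th] th H). Qed.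

Lemma sol0 w p a : 0 < w -> sol w p a 0 = a. Proof. by move=> /(@solP w p a)[]. Qed.

Lemma sol_sol w p a : 0 < w -> tau_solution w p (sol w p a).
Proof. by move=> /(@solP w p a)[]. Qed.

Lemma tau_solution_le w p x y s t : 0 < w -> tau_solution w p x -> tau_solution w p y ->
  y s <= x s -> y t <= x t.
Proof.
move=> w0; have w0' : w != 0 by rewrite gt_eqF.
move=> /(tau_solutionP _ _ w0') dx /(tau_solutionP _ _ w0') dy.
apply: (@ode_sol_le R (vf w p) w^-1 x y) => // r a b; exact: vf_lipschitz.
Qed.

Lemma tau_solution_lt w p x y s t : 0 < w -> tau_solution w p x -> tau_solution w p y ->
  y s < x s -> y t < x t.
Proof.
move=> w0 sx sy; rewrite !ltNge; apply: contra; exact: (@tau_solution_le w p y x t s).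
Qed.

Lemma tau_solution_eq w p x y s t : 0 < w -> tau_solution w p x -> tau_solution w p y ->
  y s = x s -> y t = x t.
Proof.
move=> w0 sx sy E; apply/le_anti/andP.
by split; apply: (@tau_solution_le w p _ _ s) => //; rewrite E.
Qed.

Lemma cos_shift (m : int) a : cos (a + 2 * pi * m%:~R) = cos a.
Proof.
have P (n : nat) b : cos (b + 2 * pi * n%:R) = cos b.
  have := periodicn (@cosD2pi R) n b; rewrite -[_ *+ n]mulr_natr -[pi *+ 2]mulr_natl; exact.
case: m => n; first exact: P.
by rewrite NegzE -[LHS](P n.+1) mulrNz mulrN subrK.
Qed.

Lemma sol_shift_theta (m : int) w p x : w != 0 -> tau_solution w p x ->
  tau_solution w p (fun t => x t + 2 * pi * m%:~R).
Proof.
move=> w0 /(tau_solutionP _ _ w0) H; apply/tau_solutionP => // t; have h := H t.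
by apply: trigger_derive; rewrite addr0 /vf cos_shift.
Qed.

Lemma sol_shift_tau (m : int) w p x : w != 0 -> tau_solution w p x ->
  tau_solution w p (fun t => x (t + 2 * pi * m%:~R)).
Proof.
move=> w0 /(tau_solutionP _ _ w0) H; apply/tau_solutionP => // t.
have h := H (t + 2 * pi * m%:~R).
by apply: trigger_derive; rewrite addr0 mulr1 /vf cos_shift.
Qed.

Lemma sol_reverse w p x : w != 0 -> tau_solution w p x ->
  tau_solution w p (fun t => - x (- t)).
Proof.
move=> w0 /(tau_solutionP _ _ w0) H; apply/tau_solutionP => // t; have h := H (- t).
by apply: trigger_derive; rewrite mulrN1 opprK /vf !cosN.
Qed.

Lemma sol_swap w l u x : w != 0 -> tau_solution w (l, u) x ->
  tau_solution w (- l, u) (fun t => x (pi - t) - pi).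
Proof.
move=> w0 /(tau_solutionP _ _ w0) H; apply/tau_solutionP => // t; have h := H (pi - t).
apply: trigger_derive; rewrite /vf /= !cosB sinpi cospi; lra.
Qed.

End Josephson.

(** * Rotation number *)

Section Rotation.
Context {R : realType}.
Implicit Types (p : R * R) (x y th h : R -> R) (a b s t w C M : R).

Lemma drift_ge h (rho C : R) : (forall t, 0 <= t -> h t + 2 * pi * rho <= h (t + 2 * pi)) ->
  (forall t, 0 <= t <= 2 * pi -> C <= h t - rho * t) ->
  forall t, 0 <= t -> C <= h t - rho * t.
Proof.
have pi0 := @pi_gt0 R => H0 H1.
suff S (n : nat) t : 0 <= t -> t <= 2 * pi * n%:R -> C <= h t - rho * t.
  move=> t t0; have h3 : 2 <= pi :> R := pi_ge2 R.
  have /andP[_ h5] := truncn_itv t0; apply: (S (Num.trunc t).+1) => //.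
  by apply: (le_trans (ltW h5)); rewrite ler_peMl//; lra.
elim: n t => [|n IH] t t0 tn; first by apply: H1; lra.
have [t2|t2] := leP t (2 * pi); first by apply: H1; lra.
have := H0 (t - 2 * pi) ltac:(lra); have := IH (t - 2 * pi) ltac:(lra).
rewrite subrK; move: tn; rewrite -natr1 => tn; move/(_ ltac:(lra)); lra.
Qed.

Lemma tau_solution_lipschitz w p x t : 0 < w -> tau_solution w p x -> 0 <= t ->
  `|x t - x 0| <= vfbound w p * t.
Proof.
move=> w0; have w0' : w != 0 by rewrite gt_eqF.
move=> /(tau_solutionP _ _ w0') dx; rewrite le_eqVlt => /predU1P[<-|t0].
  by rewrite subrr normr0 mulr0.
have [c _ E] := is_derive_MVT t0 (fun s _ => dx s).
by rewrite E subr0 normrM (gtr0_norm t0) ler_pM2r// vf_bounded.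
Qed.

Lemma vfbound_ge0 w p : 0 < w -> 0 <= vfbound w p.
Proof. by move=> w0; apply: le_trans (vf_bounded p 0 0 w0). Qed.

Lemma period_ge_drift w p x (r : int) : 0 < w -> tau_solution w p x ->
  x 0 + 2 * pi * r%:~R <= x (2 * pi) ->
  exists C, forall t, 0 <= t -> C <= x t - r%:~R * t.
Proof.
have pi0 := @pi_gt0 R => w0 sx xr; have w0' : w != 0 by rewrite gt_eqF.
exists (x 0 - (vfbound w p + `|r%:~R|) * (2 * pi)) => t.
apply: drift_ge => {t} t.
  move=> t0; have s1 := sol_shift_tau 1 w0' sx; have s2 := sol_shift_theta r w0' sx.
  have := @tau_solution_le R w p _ _ 0 t w0 s1 s2.
  by rewrite /= add0r mulr1; apply.
move=> /andP[t0 t1]; have := tau_solution_lipschitz w0 sx t0.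
rewrite ler_norml => /andP[h _].
have h1 : vfbound w p * t <= vfbound w p * (2 * pi) by rewrite ler_wpM2l// vfbound_ge0.
have h2 : r%:~R * t <= `|r%:~R| * (2 * pi).
  by apply: (le_trans (ler_wpM2r t0 (ler_norm _))); rewrite ler_wpM2l.
by rewrite mulrDl; lra.
Qed.

Lemma period_le_drift w p x (r : int) : 0 < w -> tau_solution w p x ->
  x (2 * pi) <= x 0 + 2 * pi * r%:~R ->
  exists C, forall t, 0 <= t -> x t - r%:~R * t <= C.
Proof.
have pi0 := @pi_gt0 R => w0 sx xr; have w0' : w != 0 by rewrite gt_eqF.
exists (x 0 + (vfbound w p + `|r%:~R|) * (2 * pi)) => t t0.
have := @drift_ge (fun t => - x t) (- r%:~R) (- x 0 - (vfbound w p + `|r%:~R|) * (2 * pi)).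
suff h : forall t, 0 <= t <= 2 * pi -> - x 0 - (vfbound w p + `|r%:~R|) * (2 * pi) <= - x t - - r%:~R * t.
  have h' : forall t, 0 <= t -> - x t + 2 * pi * - r%:~R <= - x (t + 2 * pi).
    move=> {}t {}t0; have s1 := sol_shift_tau 1 w0' sx; have s2 := sol_shift_theta r w0' sx.
    have := @tau_solution_le R w p _ _ 0 t w0 s2 s1.
    by rewrite /= add0r mulr1 => /(_ xr); lra.
  by move=> /(_ h' h t t0); lra.
move=> {}t /andP[{}t0 t1]; have := tau_solution_lipschitz w0 sx t0.
rewrite ler_norml => /andP[_ h].
have h1 : vfbound w p * t <= vfbound w p * (2 * pi) by rewrite ler_wpM2l// vfbound_ge0.
have h2 : - r%:~R * t <= `|r%:~R| * (2 * pi).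
  by apply: (le_trans (ler_wpM2r t0 (ler_norm _))); rewrite normrN ler_wpM2l.
by rewrite mulrDl; lra.
Qed.

Lemma int_above (a : R) : exists2 m : int, 0 <= m & a <= 2 * pi * m%:~R.
Proof.
have pi0 := @pi_gt0 R; have := pi_ge2 R => pi2.
exists (Num.trunc `|a|).+1 => //; have /andP[_ h] := truncn_itv (normr_ge0 a).
apply: (le_trans (ler_norm a)); apply: (le_trans (ltW h)).
by rewrite -pmulrn ler_peMl//; lra.
Qed.

(** Shifted by multiples of [2 * pi], the solutions [x] and [y] enclose any other one, so
    [th t - r t] stays bounded. Two unrelated solutions suffice: no fixed point of the return map
    has to be exhibited. *)
Lemma rotation_number_between w p x y (r : int) : 0 < w ->
  tau_solution w p x -> tau_solution w p y ->
  x 0 + 2 * pi * r%:~R <= x (2 * pi) -> y (2 * pi) <= y 0 + 2 * pi * r%:~R ->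
  has_rotation_number w p r%:~R.
Proof.
move=> w0 sx sy /(period_ge_drift w0 sx)[C1 H1] /(period_le_drift w0 sy)[C2 H2].
have w0' : w != 0 by rewrite gt_eqF.
split; first by exists x.
move=> th sth.
have [m1 _ Hm1] := int_above (x 0 - th 0); have [m2 _ Hm2] := int_above (th 0 - y 0).
have G1 t : x t - 2 * pi * m1%:~R <= th t.
  have := @tau_solution_le R w p _ _ 0 t w0 sth (sol_shift_theta (- m1) w0' sx).
  by rewrite /= mulrNz mulrN; apply; lra.
have G2 t : th t <= y t + 2 * pi * m2%:~R.
  have := @tau_solution_le R w p _ _ 0 t w0 (sol_shift_theta m2 w0' sy) sth.
  by apply; lra.
pose C := `|C1 - 2 * pi * m1%:~R| + `|C2 + 2 * pi * m2%:~R| + 1.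
have C0 : 0 < C by rewrite ltr_wpDl// addr_ge0.
have B t : 0 <= t -> `|th t - r%:~R * t| <= C.
  move=> t0; have := H1 t t0; have := H2 t t0; have := G1 t; have := G2 t.
  have := ler_norm (- (C1 - 2 * pi * m1%:~R)); have := ler_norm (C2 + 2 * pi * m2%:~R).
  rewrite normrN ler_norml /C => *.
  have := normr_ge0 (C1 - 2 * pi * m1%:~R); have := normr_ge0 (C2 + 2 * pi * m2%:~R).
  by move=> *; apply/andP; split; lra.
apply/cvgrPdist_lt => e e0.
exists (C / e); split; first exact: num_real.
move=> t; rewrite ltr_pdivrMr// => Ct.
have t0 : 0 < t by rewrite -(pmulr_lgt0 _ e0) (lt_trans C0).
rewrite [X in `|X|](_ : _ = (r%:~R * t - th t) / t); last by field; rewrite gt_eqF.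
rewrite normrM normfV (gtr0_norm t0) ltr_pdivrMr// distrC (mulrC e).
by apply: le_lt_trans Ct; rewrite B// ltW.
Qed.

Lemma rotation_number_uniq w p (a b : R) : has_rotation_number w p a ->
  has_rotation_number w p b -> a = b.
Proof.
move=> [[x sx] H1] [_ H2].
exact: (cvg_unique _ (H1 x sx) (H2 x sx)).
Qed.

Lemma rotation_number_period w p x (r : int) (rho : R) : 0 < w -> tau_solution w p x ->
  x (2 * pi) = x 0 + 2 * pi * r%:~R -> has_rotation_number w p rho -> rho = r%:~R.
Proof.
move=> w0 sx E Hr; apply: (rotation_number_uniq Hr).
by apply: (rotation_number_between w0 sx sx); rewrite E.
Qed.

Lemma sol_lt_l w l l' u x y t : 0 < w -> l < l' -> tau_solution w (l, u) x ->
  tau_solution w (l', u) y -> x 0 <= y 0 -> 0 < t -> x t < y t.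
Proof.
move=> w0 ll; have w0' : w != 0 by rewrite gt_eqF.
move=> /(tau_solutionP _ _ w0') dx /(tau_solutionP _ _ w0') dy xy t0.
have L0 : 0 < w^-1 by rewrite invr_gt0.
have L1 : 0 < w^-1 * t + 1 by rewrite addr_gt0// mulr_gt0.
(* The slope satisfies [c * (w^-1 * t + 1) = l' - l]: up to time [t], the gain in [l] pays both for
   [c] and for the Lipschitz error [w^-1 * (c * s)]. *)
pose c := (l' - l) / (w^-1 * t + 1).
have c0 : 0 < c by rewrite divr_gt0// subr_gt0.
suff h : x t + c * t <= y t by apply: lt_le_trans h; rewrite ltrDl mulr_gt0.
apply: (@ode_le R (vf w (l', u)) w^-1 0 t y (fun t => x t + c * t)
  (fun t => vf w (l', u) t (y t)) (fun t => vf w (l, u) t (x t) + c)).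
- exact: ltW.
- by move=> *; exact: vf_lipschitz.
- move=> s _; have ? := dx s; apply: trigger_derive.
  by rewrite /GRing.scale /=; ring.
- by [].
- move=> s /andP[s0 st].
  have := vf_lipschitz (l', u) s (x s) (x s + c * s) w0.
  rewrite [`|x s - _|](_ : _ = c * s); last first.
    by rewrite opprD addrA subrr sub0r normrN ger0_norm// mulr_ge0 ?(ltW c0).
  rewrite ler_norml => /andP[_ h].
  have h2 : w^-1 * (c * s) <= w^-1 * (c * t) by rewrite !ler_pM2l.
  have h3 : c * (w^-1 * t + 1) = l' - l by rewrite /c divfK// gt_eqF.
  have h4 : vf w (l', u) s (x s) = vf w (l, u) s (x s) + (l' - l) by rewrite /vf /=; ring.
  by move: h3; rewrite mulrDr mulr1 mulrCA; lra.
- by rewrite mulr0 addr0.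
Qed.

Lemma rotation_number_le w l l' u (a b : R) : 0 < w -> l <= l' ->
  has_rotation_number w (l, u) a -> has_rotation_number w (l', u) b -> a <= b.
Proof.
move=> w0; rewrite le_eqVlt => /predU1P[->|ll] Ha Hb.
  by rewrite (rotation_number_uniq Ha Hb).
have [_ Ha'] := Ha; have [_ Hb'] := Hb.
have sx := sol_sol (l, u) 0 w0; have sy := sol_sol (l', u) 0 w0.
apply: (ler_cvg_to (Ha' _ sx) (Hb' _ sy)).
exists 0; split; first exact: num_real.
move=> t t0; rewrite ler_pM2r ?invr_gt0// ltW//.
by apply: (sol_lt_l w0 ll sx sy) => //; rewrite !sol0.
Qed.

End Rotation.

(** * Reduction to a quarter period *)

Section HalfPeriod.
Context {R : realType}.
Implicit Types (p : R * R) (l u a t w : R) (e : bool) (n m : nat) (r : int).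

(* The base points of the two boundary curves, labelled so that [start (odd n)]
   is the one that decides the resonance [u + l = 2 n + 1]. *)
Definition start e : R := pi * (~~ e)%:R.

Definition quarter w p e : R := sol w p (start e) (pi / 2).

(* [t |-> - x (- t)] is [x] up to a multiple of [2 pi], so a full turn is decided
   by the half period. *)
Lemma period_cmp w p e r : 0 < w -> let x := sol w p (start e) in
  (x (2 * pi) < x 0 + 2 * pi * r%:~R) = (x pi < start e + pi * r%:~R) /\
  (x (2 * pi) > x 0 + 2 * pi * r%:~R) = (x pi > start e + pi * r%:~R).
Proof.
move=> w0 x; have w0' : w != 0 by rewrite gt_eqF.
have sx : tau_solution w p x by exact: sol_sol.
have x0 : x 0 = start e by exact: sol0.
have xrev t : - x (- t) + 2 * pi * ((~~ e : nat) : int)%:~R = x t.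
  apply: (@tau_solution_eq R w p _ _ 0 t w0 sx (sol_shift_theta _ w0' (sol_reverse w0' sx))).
  by rewrite /= oppr0 x0 /start -pmulrn; ring.
have sy := sol_shift_theta r w0' (sol_shift_tau (-1) w0' sx).
set y := fun t => _ in sy.
have y2 : y (2 * pi) = x 0 + 2 * pi * r%:~R.
  by rewrite /y mulrN1 subrr.
have y1 : y pi = 2 * start e - x pi + 2 * pi * r%:~R.
  rewrite /y mulrN1 -[in RHS](xrev pi) /start -pmulrn.
  by rewrite (_ : pi - 2 * pi = - pi); ring.
rewrite -y2; split; apply/idP/idP.
- by move=> /(tau_solution_lt pi w0 sy sx); rewrite y1; lra.
- by move=> h; apply: (@tau_solution_lt R w p y x pi) => //; rewrite y1; lra.
- by move=> /(tau_solution_lt pi w0 sx sy); rewrite y1; lra.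
- by move=> h; apply: (@tau_solution_lt R w p x y pi) => //; rewrite y1; lra.
Qed.

(* The substitution [(t, theta, l) |-> (pi - t, theta - pi, - l)] preserves the
   equation, so the half period compares two quarter periods, at [l] and [- l]. *)
Lemma half_cmp w l u e e' (j r : int) : 0 < w ->
  r%:~R - e%:R + e'%:R = 1 + 2 * j%:~R :> R ->
  let x := sol w (l, u) (start e) in let c := pi * (r%:~R - e%:R + e'%:R) in
  (x pi < start e + pi * r%:~R) =
    (quarter w (l, u) e < quarter w (- l, u) e' + c) /\
  (x pi > start e + pi * r%:~R) =
    (quarter w (l, u) e > quarter w (- l, u) e' + c).
Proof.
move=> w0 rE x c; have w0' : w != 0 by rewrite gt_eqF.
have bE (b : bool) : (~~ b)%:R = 1 - b%:R :> R by case: b; rewrite /= ?subrr ?subr0.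
have sx : tau_solution w (l, u) x by exact: sol_sol.
have sy := sol_shift_theta (1 + j) w0' (sol_swap w0' (sol_sol (- l, u) (start e') w0)).
rewrite opprK in sy; set y := fun t => _ in sy.
have y1 : y pi = start e + pi * r%:~R.
  rewrite /y subrr sol0// intrD /start !bE.
  by rewrite (_ : r%:~R = 1 + 2 * j%:~R + e%:R - e'%:R); [ring|rewrite -rE; ring].
have y2 : y (pi / 2) = quarter w (- l, u) e' + c.
  rewrite /y /quarter /c rE intrD (_ : pi - pi / 2 = pi / 2); last by field.
  by ring.
rewrite -y1 -y2 /quarter -/x; split; apply/idP/idP.
- exact: (tau_solution_lt (pi / 2) w0 sy sx).
- exact: (tau_solution_lt pi w0 sy sx).
- exact: (tau_solution_lt (pi / 2) w0 sx sy).
- exact: (tau_solution_lt pi w0 sx sy).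
Qed.

Definition turn w p e : R := sol w p (start e) (2 * pi) - start e.

(* As [w] tends to [0], [below w p n] holds where [u + l < 2 n + 1], and
   [above w p n.+2] where [2 n + 1 < u + l]. *)
Definition below w p n := quarter w p (odd n) < pi * (n%:R - (odd n)%:R + 1).
Definition above w p n := pi * (n%:R - (odd n)%:R) < quarter w p (odd n).

Lemma odd_halfR n : n%:R - (odd n)%:R = 2 * (n./2 : int)%:~R :> R.
Proof.
by rewrite -pmulrn -{1}(odd_double_half n) natrD -muln2 natrM; ring.
Qed.

Lemma period_lt w l u n m r : 0 < w -> r = n%:Z - m%:Z + 1 ->
  below w (l, u) n -> above w (- l, u) m ->
  turn w (l, u) (odd n) < 2 * pi * r%:~R.
Proof.
move=> w0 rE hb ha.
have rR : r%:~R = n%:R - m%:R + 1 :> R by rewrite rE !intrD mulrNz -!pmulrn.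
have E : r%:~R - (odd n)%:R + (odd m)%:R = 1 + 2 * (n./2%:Z - m./2%:Z)%:~R :> R.
  rewrite intrD mulrNz; have := odd_halfR n; have := odd_halfR m; rewrite rR; lra.
rewrite /turn ltrBlDl -{2}(sol0 (l, u) (start _) w0).
have [-> _] := period_cmp (l, u) (odd n) r w0.
have [-> _] := half_cmp l u w0 E.
have -> : r%:~R - (odd n)%:R + (odd m)%:R = (n%:R - (odd n)%:R + 1) - (m%:R - (odd m)%:R) :> R.
  by rewrite rR; ring.
by move: hb ha; rewrite /below /above [X in _ -> _ -> _ < _ + X]mulrBr; lra.
Qed.

Lemma period_gt w l u n m r : 0 < w -> r = n%:Z - m%:Z - 1 ->
  above w (l, u) n -> below w (- l, u) m ->
  2 * pi * r%:~R < turn w (l, u) (odd n).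
Proof.
move=> w0 rE hb ha.
have rR : r%:~R = n%:R - m%:R - 1 :> R by rewrite rE !intrD !mulrNz -!pmulrn.
have E : r%:~R - (odd n)%:R + (odd m)%:R = 1 + 2 * (n./2%:Z - m./2%:Z - 1)%:~R :> R.
  rewrite !intrD !mulrNz; have := odd_halfR n; have := odd_halfR m; rewrite rR.
  by rewrite (_ : 1%:~R = 1 :> R)//; lra.
rewrite /turn ltrBrDl -{1}(sol0 (l, u) (start _) w0).
have [_ ->] := period_cmp (l, u) (odd n) r w0.
have [_ ->] := half_cmp l u w0 E.
have -> : r%:~R - (odd n)%:R + (odd m)%:R = (n%:R - (odd n)%:R) - (m%:R - (odd m)%:R + 1) :> R.
  by rewrite rR; ring.
by move: hb ha; rewrite /below /above [X in _ -> _ -> _ + X < _]mulrBr; lra.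
Qed.

End HalfPeriod.

(** * The turn of the two base points and its dependence on the parameters *)

Section Constrictions.
Context {R : realType}.
Implicit Types (p q : R * R) (l u a t w : R) (e : bool) (n m : nat) (r : int).

Lemma rotation_number_turn w p e e' r : 0 < w ->
  2 * pi * r%:~R <= turn w p e -> turn w p e' <= 2 * pi * r%:~R ->
  has_rotation_number w p r%:~R.
Proof.
move=> w0; rewrite /turn => h1 h2.
apply: (rotation_number_between w0 (sol_sol p (start e) w0) (sol_sol p (start e') w0));
  rewrite sol0//; lra.
Qed.

Lemma poincare_fixes_turn w p e r : 0 < w -> turn w p e = 2 * pi * r%:~R ->
  poincare_fixes w p (start e).
Proof.
move=> w0 E; have w0' : w != 0 by rewrite gt_eqF.
have /(tau_solutionP _ _ w0') sx := sol_sol p (start e) w0.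
exists (fun t => (sol w p (start e) (w * t), w * t)); split.
- move=> t /=; split; last by apply: trigger_derive; rewrite /GRing.scale /=; ring.
  have ? := sx (w * t); apply: trigger_derive.
  by rewrite /vf /GRing.scale /=; field.
- by rewrite mulr0 sol0.
- exists r, 1; rewrite /= mulrC divfK// -/(turn w p e) E; split => //.
  by rewrite subr0 mulr1.
Qed.

(** A fixed point on the circle only yields some integer [m] of full turns. The orbit then has
    rotation number [m], and uniqueness of the rotation number identifies [m] with [r]. *)
Lemma turn_poincare_fixes w p e r : 0 < w -> has_rotation_number w p r%:~R ->
  poincare_fixes w p (start e) -> turn w p e = 2 * pi * r%:~R.
Proof.
move=> w0 Hr [g [Tg g0 [m [_ [Em _]]]]]; have w0' : w != 0 by rewrite gt_eqF.
have g2 t : (g t).2 = w * t.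
  have D s : is_derive s (1 : R) (fun s => (g s).2 - w * s) 0.
    by have [_ ?] := Tg s; apply: trigger_derive; rewrite /GRing.scale /=; ring.
  have := @is_derive_0_is_cst R _ t 0 D; rewrite g0 mulr0 subrr.
  by move/eqP; rewrite subr_eq0 => /eqP.
have sx : tau_solution w p (fun t => (g (t / w)).1).
  apply/tau_solutionP => // t; have [D _] := Tg (t / w).
  have D' : is_derive t (1 : R) (fun s => s / w) w^-1.
    by apply: trigger_derive; rewrite /GRing.scale /=; field.
  have := @is_derive1_comp R (fun s => (g s).1) (fun s => s / w) t _ _ D D'.
  rewrite /josephson_field g2 mulrCA divff// mulr1 /= => h; apply: (is_derive_eq h).
  by rewrite /vf; field.
have Ex : (fun t => (g (t / w)).1) 0 = start e by rewrite /= mul0r g0.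
have E : sol w p (start e) (2 * pi) = (g (2 * pi / w)).1.
  by apply: (@tau_solution_eq R w p _ _ 0 _ w0 sx (sol_sol p (start e) w0)); rewrite sol0// Ex.
have E2 : turn w p e = 2 * pi * m%:~R by rewrite /turn E Em.
rewrite E2; suff -> : r%:~R = m%:~R :> R by [].
by apply: (@rotation_number_period R w p _ m _ w0 sx _ Hr); rewrite /= mul0r g0 -Em; ring.
Qed.

Lemma turn_lt_l w l l' u e : 0 < w -> l < l' -> turn w (l, u) e < turn w (l', u) e.
Proof.
move=> w0 ll; rewrite ltrD2r.
apply: (sol_lt_l w0 ll (sol_sol _ _ w0) (sol_sol _ _ w0)); first by rewrite !sol0.
by rewrite mulr_gt0// pi_gt0.
Qed.

(** The correction grows at rate [2 * D * expR (2 * w^-1 * t)]: one half pays for the Lipschitz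
    constant, the other, at least [D], for the change of the field from [p] to [q]. The bound
    degenerates as [w] tends to 0 and serves only for continuity at fixed [w]. *)
Lemma sol_dist w p q a t : 0 < w -> 0 <= t ->
  sol w q a t <= sol w p a t + (`|p.1 - q.1| + `|p.2 - q.2|) * (w * expR (2 * w^-1 * t)).
Proof.
move=> w0 t0; have w0' : w != 0 by rewrite gt_eqF.
have /(tau_solutionP _ _ w0') dx := sol_sol p a w0.
have /(tau_solutionP _ _ w0') dy := sol_sol q a w0.
set D := _ + `|_|; have D0 : 0 <= D by rewrite addr_ge0.
apply: (@ode_le R (vf w q) w^-1 0 t (fun t => sol w p a t + D * (w * expR (2 * w^-1 * t)))
  (sol w q a) (fun t => vf w p t (sol w p a t) + 2 * D * expR (2 * w^-1 * t))
  (fun t => vf w q t (sol w q a t))) => //.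
- by move=> *; exact: vf_lipschitz.
- move=> s _; have ? := dx s; apply: trigger_derive.
  by rewrite /GRing.scale /=; field.
- move=> s /andP[s0 _]; set z := sol w p a s; set E := expR _.
  have E1 : 1 <= E by rewrite -expR0 ler_expR !mulr_ge0// invr_ge0 ltW.
  have := vf_lipschitz q s (z + D * (w * E)) z w0.
  rewrite [X in _ * `|X|](_ : _ = D * (w * E)); last by rewrite addrAC subrr add0r.
  rewrite (ger0_norm (_ : 0 <= D * (w * E))); last by rewrite !mulr_ge0// ltW// expR_gt0.
  rewrite (mulrCA D) mulKf// => /(le_trans (ler_norm _)) h.
  have h2 : vf w q s z - vf w p s z <= D.
    rewrite /vf [X in X <= _](_ : _ = - (p.1 - q.1) + - ((p.2 - q.2) * cos s)); last by ring.
    apply: lerD; first by rewrite (le_trans (ler_norm _))// normrN.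
    by rewrite (le_trans (ler_norm _))// normrN normrM ler_piMr// cos_max.
  have h3 : D <= D * E by rewrite ler_peMr.
  by lra.
- by rewrite !sol0// lerDl !mulr_ge0 ?expR_ge0// ltW.
Qed.

Lemma near_prod p a (P : set (R * R)) : 0 < a ->
  (forall q, `|p.1 - q.1| < a -> `|p.2 - q.2| < a -> P q) -> nbhs p P.
Proof.
move=> a0 H; exists (ball p.1 a, ball p.2 a); first by split; exact: nbhsx_ballx.
by move=> q [h1 h2]; exact: H.
Qed.

Lemma continuous_turn w e : 0 < w -> continuous (fun p => turn w p e).
Proof.
move=> w0 p; apply/cvgrPdist_lt => eps eps0.
pose K := w * expR (2 * w^-1 * (2 * pi)).
have K0 : 0 < K by rewrite mulr_gt0// expR_gt0.
have d0 : 0 < eps / (2 * K) by rewrite divr_gt0// mulr_gt0.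
apply: (near_prod d0) => q h1 h2.
have h3 : (`|p.1 - q.1| + `|p.2 - q.2|) * K < eps.
  have -> : eps = (eps / (2 * K) + eps / (2 * K)) * K by field; rewrite gt_eqF.
  by rewrite ltr_pM2r//; exact: ltrD.
have t0 : 0 <= 2 * pi :> R by rewrite mulr_ge0// pi_ge0.
have := sol_dist p q (start e) w0 t0; have := sol_dist q p (start e) w0 t0.
rewrite (distrC q.1) (distrC q.2) -/K /turn => h4 h5.
by rewrite ltr_norml; apply/andP; split; lra.
Qed.

End Constrictions.

(** * Hermite barriers *)

Section HermiteAngle.
Context {R : realType}.
Implicit Types (T m t w : R) (n : nat).

(* [(hermite n T).1] is the probabilists' Hermite polynomial [He_n] and
   [(hermite n T).2 = n He_(n-1)] is its derivative. *)
Fixpoint hermite n T : R * R :=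
  if n is n'.+1 then
    let hc := hermite n' T in (T * hc.1 - hc.2, n%:R * hc.1)
  else (1, 0).

Local Notation h n T := (hermite n T).1.
Local Notation c n T := (hermite n T).2.

(** With the Hermite function [y = exp (- T^2 / 4) He_n], the pair [(h, k)] is [exp (T^2 / 4)] times
    [(y, - 2 y')]: the phase vector of the linearised equation, cleared of its exponential. *)
Definition hermiteK n T : R := T * h n T - 2 * c n T.
Local Notation k := hermiteK.

Lemma is_derive_hermite n T :
  is_derive T (1 : R) (fun T => h n T) (c n T) /\
  is_derive T (1 : R) (fun T => c n T) (T * c n T - n%:R * h n T).
Proof.
elim: n => [|n [IH1 IH2]] /=.
  split; first exact: is_derive_cst.
  by rewrite mulr0 mul0r subrr; exact: is_derive_cst.
split; apply: trigger_derive; rewrite /GRing.scale /= -natr1; ring.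
Qed.

(** This is [(n + 1) He_n^2 - n He_(n-1) He_(n+1)]. Multiplied by [2 m] it is the cross product of
    the vectors [(h, m k)] of indices [n + 1] and [n]. *)
Definition turan n T : R := n.+1%:R * h n T ^+ 2 - c n T * h n.+1 T.

Lemma turan_gt0 n T : 0 < turan n T.
Proof.
elim: n => [|n IH]; first by rewrite /turan /= expr1n !mul1r mul0r subr0.
rewrite (_ : turan n.+1 T = h n.+1 T ^+ 2 + n.+1%:R * turan n T).
  by rewrite ltr_wpDl ?sqr_ge0// mulr_gt0.
by rewrite /turan /= -!natr1; ring.
Qed.

(** Dot product over cross product: the cotangent of the angle between two consecutive vectors. *)
Definition angle_step n T m : R :=
  (h n T * h n.+1 T + m ^+ 2 * (k n T * k n.+1 T)) / (2 * m * turan n T).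

(* A continuous determination of the argument of the vector [(h, m k)]: by
   [turan_gt0] the vectors of two consecutive indices are never parallel, so
   the argument decreases by an amount in [(0, pi)] at each step. *)
Fixpoint angle n T m : R :=
  if n is n'.+1 then angle n' T m - pi / 2 + atan (angle_step n' T m)
  else atan (m * T).

Lemma atan_cos_gt0 (x : R) : 0 < cos (atan x).
Proof. by apply: cos_gt0_pihalf; rewrite atan_gtNpi2 atan_ltpi2. Qed.

Lemma atan_sin (x : R) : sin (atan x) = x * cos (atan x).
Proof. by rewrite -{2}(atanK x) /tan divfK// gt_eqF// atan_cos_gt0. Qed.

Lemma angle_parallel n T m : 0 < m ->
  h n T * sin (angle n T m) = m * k n T * cos (angle n T m).
Proof.
move=> m0; elim: n => [|n IH].
  by rewrite /= mul1r atan_sin /k /=; ring.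
set f := angle n T m in IH *; set x := angle_step n T m.
have W0 := turan_gt0 n T.
have xE : x * (2 * m * turan n T) = h n T * h n.+1 T + m ^+ 2 * (k n T * k n.+1 T).
  by rewrite divfK// gt_eqF// !mulr_gt0.
have cr : h n.+1 T * (m * k n T) - m * k n.+1 T * h n T = 2 * m * turan n T.
  by rewrite /turan /k /= -!natr1; ring.
rewrite [angle n.+1 T m](_ : _ = f + atan x - pi / 2); last by rewrite /= -/f -/x; ring.
rewrite sinBpihalf cosBpihalf sinD cosD atan_sin.
have c0 := atan_cos_gt0 x; set y := cos (atan x) in c0 *.
set s := sin f in IH *; set d := cos f in IH *.
have sd : d ^+ 2 + s ^+ 2 = 1 := cos2Dsin2 f.
set a := h n T in IH xE cr *; set b := m * k n T in IH cr *.
set a' := h n.+1 T in xE cr *; set b' := m * k n.+1 T in cr *.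
have {}xE : x * (2 * m * turan n T) = a * a' + b * b' by rewrite xE /a /b /a' /b'; ring.
rewrite -cr in xE.
(* [r] is the signed length of [(a, b)] along [(d, s)]. The nonzero cross product forbids [r = 0],
   and after multiplication by [r] the claim reduces to the definition of [x]. *)
pose r := a * d + b * s.
have aE : a = r * d.
  rewrite -[LHS]mulr1 -sd /r mulrDl (_ : b * s * d = a * s * s); first by ring.
  by rewrite IH; ring.
have bE : b = r * s.
  rewrite -[LHS]mulr1 -sd /r mulrDl (_ : a * d * s = b * d * d); first by ring.
  by rewrite -IH; ring.
have r0 : r != 0.
  apply/eqP => r0; have := mulr_gt0 (mulr_gt0 (ltr0Sn R 1) m0) W0.
  by rewrite -cr aE bE r0 !mul0r !mulr0 subrr ltxx.
apply: (mulfI r0).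
have -> : r * (a' * - (d * y - s * (x * y))) = y * (x * (a' * (r * s)) - a' * (r * d)) by ring.
have -> : r * (b' * (s * y + d * (x * y))) = y * (b' * (r * s) + x * (b' * (r * d))) by ring.
congr (_ * _); rewrite -aE -bE; move: xE; rewrite mulrBr => xE; lra.
Qed.

Lemma hermite_angle_neq0 n T m : 0 < m ->
  h n T * cos (angle n T m) + m * k n T * sin (angle n T m) != 0.
Proof.
move=> m0; apply/eqP => r0; have P := angle_parallel n T m0.
set s := sin _ in r0 P; set d := cos _ in r0 P.
have sd : d ^+ 2 + s ^+ 2 = 1 := cos2Dsin2 _.
have a0 : h n T = 0.
  rewrite -[h n T]mulr1 -sd.
  rewrite (_ : h n T * _ = (h n T * d + m * k n T * s) * d + (h n T * s - m * k n T * d) * s).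
    by rewrite r0 P subrr !mul0r addr0.
  by ring.
have b0 : m * k n T = 0.
  rewrite -[_ * k n T]mulr1 -sd.
  rewrite (_ : m * k n T * _ = (h n T * d + m * k n T * s) * s - (h n T * s - m * k n T * d) * d).
    by rewrite r0 P subrr !mul0r subrr.
  by ring.
have W0 := turan_gt0 n T.
have : 2 * m * turan n T = h n.+1 T * (m * k n T) - m * k n.+1 T * h n T.
  by rewrite /turan /k /= -!natr1; ring.
by rewrite a0 b0 !mulr0 subrr => /eqP; rewrite gt_eqF// !mulr_gt0.
Qed.

(** At [T = 0] parity kills [h] or [c], so consecutive vectors are orthogonal and every step is
    exactly [- pi / 2], for all [m]. This is the value that makes barrier and solution start at the
    same point. *)
Lemma angle0 n m : angle n 0 m = - (n%:R * (pi / 2)).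
Proof.
have hc0 j : h j 0 * c j 0 = 0 :> R.
  elim: j => [|j IH] /=; first by rewrite mulr0.
  by rewrite mul0r sub0r mulNr mulrCA (mulrC (c j 0)) IH mulr0 oppr0.
elim: n => [|n IH]; first by rewrite /= mulr0 atan0 mul0r oppr0.
rewrite /= IH; suff -> : angle_step n 0 m = 0 by rewrite atan0 -natr1; ring.
rewrite /angle_step /k /= [X in X / _](_ : _ = (h n 0 * c n 0) * (4 * m ^+ 2 * n.+1%:R - 1)); last by ring.
by rewrite hc0 !mul0r.
Qed.

Lemma is_derive_div (f g : R -> R) t df dg : g t != 0 ->
  is_derive t (1 : R) f df -> is_derive t (1 : R) g dg ->
  is_derive t (1 : R) (fun t => f t / g t) ((df * g t - f t * dg) / g t ^+ 2).
Proof.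
move=> g0 Df Dg; have := is_deriveM Df (@is_deriveV R g t dg 1 g0 Dg).
by move=> D0; apply: (is_derive_eq D0); rewrite /GRing.scale /=; field.
Qed.

(** Only existence is extracted from the recursive definition. The value of the derivative then
    comes from implicit differentiation of [angle_parallel], where its coefficient is nonzero by
    [hermite_angle_neq0]. *)
Lemma derivable_angle n (T m : R -> R) T' m' t : 0 < m t ->
  is_derive t (1 : R) T T' -> is_derive t (1 : R) m m' ->
  exists d, is_derive t (1 : R) (fun t => angle n (T t) (m t)) d.
Proof.
move=> m0 dT dm; elim: n => [|n [d IH]] /=.
  by eexists; apply: is_derive1_comp.
have [dh dc] := is_derive_hermite n (T t); have [dh1 dc1] := is_derive_hermite n.+1 (T t).
have D1 : is_derive t (1 : R) (fun t => h n (T t)) (c n (T t) * T').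
  exact: (@is_derive1_comp R (fun T => h n T) T t _ _ dh dT).
have D2 : is_derive t (1 : R) (fun t => c n (T t)) ((T t * c n (T t) - n%:R * h n (T t)) * T').
  exact: (@is_derive1_comp R (fun T => c n T) T t _ _ dc dT).
have D3 : is_derive t (1 : R) (fun t => h n.+1 (T t)) (c n.+1 (T t) * T').
  exact: (@is_derive1_comp R (fun T => h n.+1 T) T t _ _ dh1 dT).
have D4 : is_derive t (1 : R) (fun t => c n.+1 (T t)) ((T t * c n.+1 (T t) - n.+1%:R * h n.+1 (T t)) * T').
  exact: (@is_derive1_comp R (fun T => c n.+1 T) T t _ _ dc1 dT).
have W0 : 2 * m t * turan n (T t) != 0 by rewrite gt_eqF// !mulr_gt0// turan_gt0.
have [d' D5] : exists d', is_derive t (1 : R) (fun t => angle_step n (T t) (m t)) d'.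
  rewrite /angle_step.
  have [dn Dn] : exists dn, is_derive t (1 : R) (fun t => h n (T t) * h n.+1 (T t) +
      m t ^+ 2 * (k n (T t) * k n.+1 (T t))) dn.
    by rewrite /k; eexists; apply: trigger_derive.
  have [dd Dd] : exists dd, is_derive t (1 : R) (fun t => 2 * m t * turan n (T t)) dd.
    by rewrite /turan; eexists; apply: trigger_derive.
  by eexists; apply: is_derive_div Dn Dd.
have D6 := @is_derive1_comp R atan (fun t => angle_step n (T t) (m t)) t _ _ (is_derive1_atan _) D5.
by eexists; apply: (is_deriveD (is_deriveB IH (is_derive_cst (pi / 2) t 1)) D6).
Qed.

Lemma is_derive_angle n (T m : R -> R) T' m' t : 0 < m t ->
  is_derive t (1 : R) T T' -> is_derive t (1 : R) m m' ->
  let s := sin (angle n (T t) (m t)) in let d := cos (angle n (T t) (m t)) in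
  is_derive t (1 : R) (fun t => angle n (T t) (m t))
    (m' / m t * (s * d) + m t * T' * (2 * n%:R + 1 - T t ^+ 2 / 2) * d ^+ 2
     + T' / (2 * m t) * s ^+ 2).
Proof.
move=> m0 dT dm s d.
have mn0 : m t != 0 by rewrite gt_eqF.
have [f' df] := derivable_angle n m0 dT dm.
apply: (is_derive_eq df).
have [dh dc] := is_derive_hermite n (T t).
have D1 : is_derive t (1 : R) (fun t => h n (T t)) (c n (T t) * T').
  exact: (@is_derive1_comp R (fun T => h n T) T t _ _ dh dT).
have D2 : is_derive t (1 : R) (fun t => c n (T t)) ((T t * c n (T t) - n%:R * h n (T t)) * T').
  exact: (@is_derive1_comp R (fun T => c n T) T t _ _ dc dT).
have Ds := @is_derive1_comp R sin _ t _ _ (is_derive_sin _) df.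
have Dc := @is_derive1_comp R cos _ t _ _ (is_derive_cos _) df.
rewrite -/s -/d in Ds Dc.
pose J t := h n (T t) * sin (angle n (T t) (m t))
  - m t * (T t * h n (T t) - 2 * c n (T t)) * cos (angle n (T t) (m t)).
have DJ : is_derive t (1 : R) J
    (c n (T t) * T' * s + h n (T t) * (d * f')
     - ((m' * k n (T t) + m t * T' * ((2 * n%:R + 1) * h n (T t) - T t * c n (T t))) * d
        - m t * k n (T t) * (s * f'))).
  have D3 := is_deriveM D1 Ds.
  have D4 := is_deriveB (is_deriveM dT D1) (is_deriveZ 2 D2).
  have D5 := is_deriveB D3 (is_deriveM (is_deriveM dm D4) Dc).
  by apply: (is_derive_eq D5); rewrite !fctE /GRing.scale /= /GRing.scale /= /k -/s -/d; ring.
have D0 : is_derive t (1 : R) J 0.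
  apply: near_eq_is_derive (is_derive_cst 0 t 1).
  have cm : {for t, continuous m} := is_derive_continuous dm.
  have : \forall x \near t, 0 < m x by exact: (cvgr_gt (m t) cm _ m0).
  by apply: filterS => x mx; rewrite /J (angle_parallel n (T x) mx) subrr.
have E := @derive_val _ _ _ _ _ _ _ DJ; rewrite (@derive_val _ _ _ _ _ _ _ D0) in E.
have P := angle_parallel n (T t) m0; have r0 := hermite_angle_neq0 n (T t) m0.
have sd : d ^+ 2 + s ^+ 2 = 1 := cos2Dsin2 _.
rewrite -/s -/d in P r0.
have cE : c n (T t) = (T t * h n (T t) - k n (T t)) / 2 by rewrite /k; field.
set H := h n (T t) in E P r0 cE *; set K := k n (T t) in E P r0 cE *.
set r := H * d + m t * K * s in r0.
have HE : H = r * d.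
  rewrite -[LHS]mulr1 -sd /r mulrDl (_ : m t * K * s * d = H * s * s); first by ring.
  by rewrite P; ring.
have KE : K = r * s / m t.
  apply: (mulIf mn0); rewrite divfK// mulrC -[LHS]mulr1 -sd /r mulrDl.
  rewrite (_ : H * d * s = m t * K * d * d); first by ring.
  by rewrite -P; ring.
apply: (mulfI r0).
transitivity ((m' * K + m t * T' * ((2 * n%:R + 1) * H - T t * c n (T t))) * d
   - c n (T t) * T' * s); first by rewrite /r; lra.
by rewrite cE HE KE; field.
Qed.

(** [0 < k] says [c < T h / 2], so passing to [n.+1] keeps more than half of [T h]; this bounds the
    new [c] by the new [h], and [4 n < T^2] gives back [0 < k]. *)
Lemma hermite_large n T : 0 < T -> 4 * n%:R < T ^+ 2 ->
  [/\ 0 < h n T, 0 <= c n T, T * c n T <= 2 * n%:R * h n T & 0 < k n T].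
Proof.
move=> T0; elim: n => [|n IH] nT; first by rewrite /k /= !mulr0 mul0r mulr1 subr0.
have [] := IH ltac:(by move: nT; rewrite -natr1; lra).
rewrite /k => h0 c0 Tc k0.
have h1 : T * h n T / 2 < h n.+1 T by rewrite /=; lra.
have Th0 : 0 < T * h n T by rewrite mulr_gt0.
have h1' : 0 < h n.+1 T by apply: le_lt_trans h1; rewrite divr_ge0// ltW.
have Tc1 : T * c n.+1 T <= 2 * n.+1%:R * h n.+1 T.
  rewrite [c n.+1 T]/= mulrCA (mulrC 2) -mulrA ler_wpM2l//; lra.
split=> //; first by rewrite /= mulr_ge0// ltW.
have : 4 * n.+1%:R * h n.+1 T < T ^+ 2 * h n.+1 T by rewrite ltr_pM2r.
rewrite -subr_gt0 => P; rewrite -(pmulr_rgt0 _ T0); lra.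
Qed.

(** [angle_parallel] knows the angle only modulo [pi]; this lemma fixes the determination.
    Positivity of [h] and [k] makes each step a turn by less than [pi / 2], and the sign of the sine
    then selects the quadrant. Together with [angle0], the angle climbs from [- n pi / 2] into the
    first quadrant. *)
Lemma angle_quadrant n T m : 0 < T -> 4 * n%:R < T ^+ 2 -> 0 < m ->
  0 < angle n T m < pi / 2.
Proof.
move=> T0 + m0; elim: n => [|n IH] nT.
  by rewrite /= atan_ltpi2 -atan0 lt_atan// mulr_gt0.
have nT' : 4 * n%:R < T ^+ 2 by move: nT; rewrite -natr1; lra.
have /andP[a0 a1] := IH nT'.
have [h0 _ _ k0] := hermite_large T0 nT'; have [h1 _ _ k1] := hermite_large T0 nT.
have x0 : 0 < atan (angle_step n T m).
  rewrite -[X in X < _]atan0 lt_atan// divr_gt0 ?mulr_gt0 ?turan_gt0//.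
  by rewrite addr_gt0 ?mulr_gt0 ?exprn_gt0.
have x1 := atan_ltpi2 (angle_step n T m).
have P := angle_parallel n.+1 T m0; set f := angle n.+1 T m in P *.
have f1 : - (pi / 2) < f by rewrite /f /=; lra.
have f2 : f < pi / 2 by rewrite /f /=; lra.
rewrite f2 andbT; have cf : 0 < cos f by rewrite cos_gt0_pihalf// f1.
have : 0 < sin f by rewrite -(pmulr_rgt0 _ h1) P !mulr_gt0.
move=> sf; rewrite ltNge; apply/negP => f0; move: sf; rewrite ltNge => /negP; apply.
have : sin (- f) >= 0; last by rewrite sinN oppr_ge0.
by apply: sin_ge0_pi; apply/andP; split; have := @pi_gt0 R; lra.
Qed.

Lemma angle_bounds n T m : 0 < T -> 4 * n%:R < T ^+ 2 -> 0 < m ->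
  atan (m * T - 4 * n%:R * m / T) <= angle n T m <= atan (m * T).
Proof.
move=> T0 nT m0; have /andP[a0 a1] := angle_quadrant T0 nT m0.
have [h0 c0 Tc _] := hermite_large T0 nT; have P := angle_parallel n T m0.
have /tanK <- : angle n T m \in `](- (pi / 2)), (pi / 2)[.
  by rewrite in_itv /= a1 andbT; have := @pi_gt0 R; lra.
have cf : 0 < cos (angle n T m).
  by rewrite cos_gt0_pihalf// a1 andbT; have := @pi_gt0 R; lra.
have -> : tan (angle n T m) = m * T - 2 * m * (c n T / h n T).
  rewrite /tan; apply: (mulIf (lt0r_neq0 cf)); rewrite divfK ?gt_eqF//.
  by apply: (mulfI (lt0r_neq0 h0)); rewrite P /k; field; rewrite gt_eqF.
have q0 : 0 <= c n T / h n T by rewrite divr_ge0// ltW.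
have q1 : c n T / h n T <= 2 * n%:R / T.
  by rewrite ler_pdivrMr// mulrAC ler_pdivlMr// mulrC.
apply/andP; split; apply: le_atan.
  rewrite lerD2l lerN2; apply: le_trans (ler_wpM2l _ q1) _; first by rewrite mulr_ge0// ltW.
  by rewrite le_eqVlt; apply/orP; left; apply/eqP; field; rewrite gt_eqF.
by rewrite gerBl mulr_ge0// mulr_ge0// ltW.
Qed.

End HermiteAngle.

(** * Elementary trigonometric and affine bounds *)

Section TrigBounds.
Context {R : realType}.
Implicit Types (a b x t : R).

Lemma sin_mul_sin a b : sin (a - b) * sin (a + b) = sin a ^+ 2 - sin b ^+ 2 :> R.
Proof. by rewrite sinB sinD; have := cos2sin2 a; have := cos2sin2 b; nra. Qed.

Lemma cos_double x : cos (2 * x) = 1 - 2 * sin x ^+ 2 :> R.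
Proof. by rewrite mulr_natl mulr2n cosD -!expr2 cos2sin2; ring. Qed.

Lemma sin_sqr_le a b : - b <= a <= b -> b <= pi / 2 -> sin a ^+ 2 <= sin b ^+ 2 :> R.
Proof.
move=> /andP[h1 h2] h3; rewrite -subr_ge0 -sin_mul_sin.
by apply: mulr_ge0; apply: sin_ge0_pi; apply/andP; split; lra.
Qed.

Lemma sin_ge_sin a x : 0 < a -> a <= x <= pi - a -> sin a <= sin x :> R.
Proof.
move=> a0 /andP[ax xa].
have H y : a <= y -> y <= pi / 2 -> sin a <= sin y.
  move=> ay y2; rewrite leNgt ltr_sin ?in_itv /= -?leNgt //; apply/andP; split; lra.
have [h|/ltW h] := leP x (pi / 2); first exact: H.
by rewrite -[sin x](_ : sin (pi - x) = _); [apply: H; lra|rewrite sinB sinpi cospi; ring].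
Qed.

Lemma sin_le_id x : 0 <= x -> sin x <= x :> R.
Proof.
move=> x0; have D t : is_derive t (1 : R) (fun t => sin t - t) (cos t - 1).
  by apply: trigger_derive; rewrite /GRing.scale /=; ring.
have := derive_le0_le x0 (fun t _ => D t); rewrite sin0 subr0 => h; rewrite -subr_le0.
by apply: h => t _; rewrite subr_le0 cos_le1.
Qed.

Lemma small_angle t : 0 <= t <= 1 ->
  [/\ 0 <= sin (t / 2), 2^-1 <= cos (t / 2), sin (t / 2) <= t * cos (t / 2) & 1 - cos t <= t] .
Proof.
move=> /andP[t0 t1]; have pi2 := pi_ge2 R.
have S0 : 0 <= sin (t / 2) by apply: sin_ge0_pi; apply/andP; split; lra.
have c1 (x : R) : 0 <= x -> 1 - cos x <= x.
  move=> x0; have := cos_lipschitz 0 x; rewrite cos0 sub0r normrN (ger0_norm x0).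
  exact/le_trans/ler_norm.
have C1 : 2^-1 <= cos (t / 2) by have := c1 (t / 2); lra.
have S1 : sin (t / 2) <= t / 2 by apply: sin_le_id; lra.
split => //; last exact: c1.
apply: (le_trans S1); nra.
Qed.

Lemma atan_lipschitz (x y : R) : 0 <= y -> atan x - y <= atan (x - y).
Proof.
move=> y0; have xy : x - y <= x by rewrite gerBl.
have D t : is_derive t (1 : R) (fun t => atan t - t) ((1 + t ^+ 2)^-1 - 1).
  exact: trigger_derive.
have := derive_le0_le xy (fun t _ => D t) => h.
suff : atan x - x <= atan (x - y) - (x - y) by lra.
apply: h => t _; rewrite subr_le0 invf_le1 ?lerDl ?sqr_ge0//.
by rewrite ltr_wpDr ?sqr_ge0.
Qed.

Lemma atan_tan_half t : 0 <= t <= 1 -> atan (sin (t / 2) / cos (t / 2)) = t / 2.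
Proof.
move=> /andP[t0 t1]; have pi2 := pi_ge2 R.
by rewrite -/(tan (t / 2)) tanK// in_itv /=; apply/andP; split; lra.
Qed.

Lemma affine_ge (A B a b c t : R) : a <= t <= b -> c <= A -> c <= A + B * (b - a) ->
  c <= A + B * (t - a).
Proof.
move=> /andP[at_ tb] cA cB; have [B0|/ltW B0] := leP 0 B.
  by apply: (le_trans cA); rewrite lerDl mulr_ge0// subr_ge0.
by apply: (le_trans cB); rewrite lerD2l ler_wnM2l// lerD2r.
Qed.

Lemma affine_le (A B a b c t : R) : a <= t <= b -> A <= c -> A + B * (b - a) <= c ->
  A + B * (t - a) <= c.
Proof.
move=> tab cA cB; have := @affine_ge (- A) (- B) a b (- c) t tab.
by rewrite !mulNr -!opprD !lerN2; apply.
Qed.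

End TrigBounds.

Section Barrier.
Context {R : realType}.
Implicit Types (p : R * R) (t f v w lam : R) (n : nat) (e : bool).

(* The equation for [f = (theta - pi) / 2], which is a Riccati equation in [tan f]. *)
Definition hvf w p t f : R :=
  (sin f ^+ 2 - sin (t / 2) ^+ 2) / w + (p.1 + p.2 * cos t) / 2.

Lemma hvf_vf w p t f : hvf w p t f = vf w p t (pi + 2 * f) / 2.
Proof.
rewrite /hvf /vf cosD cospi sinpi mul0r subr0.
have -> : cos t = 1 - 2 * sin (t / 2) ^+ 2 by rewrite -cos_double; congr cos; field.
by rewrite (cos_double f); move: w^-1 => v; field.
Qed.

Lemma hvf_lipschitz w p t a b : 0 < w -> `|hvf w p t a - hvf w p t b| <= w^-1 * `|a - b|.
Proof.
move=> w0; rewrite !hvf_vf -mulrBl normrM (@ger0_norm _ 2^-1)//.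
have := vf_lipschitz p t (pi + 2 * a) (pi + 2 * b) w0.
rewrite (_ : pi + 2 * a - (pi + 2 * b) = 2 * (a - b)); last by ring.
rewrite normrM (@ger0_norm _ 2)//; lra.
Qed.

Definition half_angle w p e t : R := (sol w p (start e) t - pi) / 2.

Lemma is_derive_half_angle w p e t : 0 < w ->
  is_derive t (1 : R) (half_angle w p e) (hvf w p t (half_angle w p e t)).
Proof.
move=> w0; have w0' : w != 0 by rewrite gt_eqF.
have /(tau_solutionP _ _ w0') /(_ t) ? := sol_sol p (start e) w0.
rewrite /half_angle; apply: trigger_derive.
rewrite hvf_vf (_ : pi + _ = sol w p (start e) t); last by field.
by rewrite /GRing.scale /=; field.
Qed.

(* Near [t = 0] and for [w = v ^+ 2], the equation of [hvf] linearises in the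
   variable [T = 2 sin (t / 2) / v] to the Hermite equation, with polynomial
   solutions exactly when [u + l = 2 n + 1]. The factor [lam], which is [1] in the
   lower barrier, is taken slightly larger in the upper one, where it produces a
   negative term that is of order one when [sin (barrier n lam v t)] is. *)
Definition barrier n lam v t : R :=
  angle n (2 * lam * sin (t / 2) / v) (v / (2 * cos (t / 2) * lam ^+ 3)).

Definition dbarrier n lam v t : R :=
  let s := sin (barrier n lam v t) in let d := cos (barrier n lam v t) in
  sin (t / 2) / (2 * cos (t / 2)) * (s * d)
  + ((2 * n%:R + 1) / (2 * lam ^+ 2) - sin (t / 2) ^+ 2 / v ^+ 2) * d ^+ 2
  + lam ^+ 4 * cos (t / 2) ^+ 2 / v ^+ 2 * s ^+ 2.

Lemma is_derive_barrier n lam v t : 0 < v -> 0 < lam -> 0 < cos (t / 2) ->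
  is_derive t (1 : R) (barrier n lam v) (dbarrier n lam v t).
Proof.
move=> v0 l0 C0; have v0' : v != 0 by rewrite gt_eqF.
have l0' : lam != 0 by rewrite gt_eqF.
have C0' : cos (t / 2) != 0 by rewrite gt_eqF.
have D1 : is_derive t (1 : R) (fun t => 2 * lam * sin (t / 2) / v) (lam * cos (t / 2) / v).
  by apply: trigger_derive; rewrite /GRing.scale /=; field.
have D2 : is_derive t (1 : R) (fun t => v / (2 * cos (t / 2) * lam ^+ 3))
    (v * sin (t / 2) / (4 * cos (t / 2) ^+ 2 * lam ^+ 3)).
  have D3 : is_derive t (1 : R) (fun t => 2 * cos (t / 2) * lam ^+ 3)
      (- sin (t / 2) * lam ^+ 3).
    by apply: trigger_derive; rewrite /GRing.scale /=; field.
  have h0 : 2 * cos (t / 2) * lam ^+ 3 != 0 by rewrite gt_eqF// !mulr_gt0// exprn_gt0.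
  have := @is_derive_div R (cst v) (fun t => 2 * cos (t / 2) * lam ^+ 3) t _ _ h0
    (is_derive_cst v t 1) D3 => D4; apply: (is_derive_eq D4).
  by rewrite /=; field; rewrite l0' C0'.
have m0 : 0 < v / (2 * cos (t / 2) * lam ^+ 3) by rewrite divr_gt0// !mulr_gt0// exprn_gt0.
have := @is_derive_angle R n (fun t => 2 * lam * sin (t / 2) / v)
  (fun t => v / (2 * cos (t / 2) * lam ^+ 3)) _ _ t m0 D1 D2 => D5; apply: (is_derive_eq D5).
by rewrite /dbarrier /barrier; field; rewrite v0' l0' C0'.
Qed.

(** For [lam = 1] the terms in [1 / v^2] agree, since [cos^2 s^2 - sin^2 d^2 = s^2 - sin^2] with
    [sin] and [cos] taken at [t / 2]. Near [t = 0] there remains [l + u - (2 n + 1) d^2]. *)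
Lemma barrier_gap n lam v p t : v != 0 -> lam != 0 -> cos (t / 2) != 0 ->
  let s := sin (barrier n lam v t) in let d := cos (barrier n lam v t) in
  2 * (hvf (v ^+ 2) p t (barrier n lam v t) - dbarrier n lam v t) =
  p.1 + p.2 * cos t - sin (t / 2) / cos (t / 2) * (s * d)
  - (2 * n%:R + 1) / lam ^+ 2 * d ^+ 2
  - 2 * (lam ^+ 4 - 1) * (cos (t / 2) ^+ 2 / v ^+ 2) * s ^+ 2.
Proof.
move=> v0 l0 C0 s d; rewrite /hvf /dbarrier -/s -/d.
have sd : d ^+ 2 = 1 - s ^+ 2 := cos2sin2 _.
have SC : sin (t / 2) ^+ 2 = 1 - cos (t / 2) ^+ 2 := sin2cos2 _.
by rewrite SC sd; field; rewrite v0 l0 C0.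
Qed.

End Barrier.

Section BarrierGap.
Context {R : realType}.
Implicit Types (p : R * R) (t f v w lam : R) (n : nat) (e : bool) (psi : R -> R).

Lemma inv_sqr_ge (x : R) : 1 <= x -> 1 - 2 * (x - 1) <= (x ^+ 2)^-1.
Proof.
move=> x1; rewrite -[leRHS]mul1r ler_pdivlMr ?exprn_gt0 ?(lt_le_trans ltr01)//.
rewrite -subr_ge0 (_ : _ - _ = (x - 1) ^+ 2 * (2 * x + 1)); last by ring.
by rewrite mulr_ge0 ?sqr_ge0//; lra.
Qed.

(** Here [d^2 <= 1] goes the right way, so [lam = 1] is enough. The slack [(|u| + 1) t] absorbs
    [u (1 - cos t)] and the term with the tangent. *)
Lemma lower_gap n p v t (dl : R) : 0 < v -> 0 <= t <= 1 ->
  2 * n%:R + 1 + 2 * dl + (`|p.2| + 1) * t <= p.1 + p.2 ->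
  dbarrier n 1 v t + dl <= hvf (v ^+ 2) p t (barrier n 1 v t).
Proof.
move=> v0 t01 H; have /andP[t0 t1] := t01; have [S0 C1 S1 c1] := small_angle t01.
have C0 : 0 < cos (t / 2) by lra.
have := @barrier_gap R n 1 v p t (lt0r_neq0 v0) (oner_neq0 _) (lt0r_neq0 C0).
rewrite /= expr1n divr1 expr1n subrr mulr0 !mul0r subr0.
set s := sin (barrier _ _ _ _); set d := cos (barrier _ _ _ _).
have sd : d ^+ 2 + s ^+ 2 = 1 := cos2Dsin2 _.
have x1 : sin (t / 2) / cos (t / 2) <= t by rewrite ler_pdivrMr.
have x0 : 0 <= sin (t / 2) / cos (t / 2) by rewrite divr_ge0// ltW.
have x2 : sin (t / 2) / cos (t / 2) * (s * d) <= t.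
  have : s * d <= 1 by nra.
  by nra.
have x3 : (2 * n%:R + 1) * d ^+ 2 <= (2 * n%:R + 1).
  have : 0 <= n%:R :> R by [].
  by have := sqr_ge0 s; nra.
have x4 : p.2 - `|p.2| * t <= p.2 * cos t.
  have := ler_norm (p.2); have := cos_le1 t; have := normr_ge0 p.2; nra.
lra.
Qed.

(** Now [(2 n + 1) d^2] falls short of [2 n + 1] by [(2 n + 1) s^2]. The choice of [lam] pays for
    it: [lam^4 - 1 >= 4 (n + 1) v^2] and [cos (t / 2) >= 1/2] produce [2 (n + 1) s^2], at the price
    of a term of order [v^2] in the hypothesis. *)
Lemma upper_gap n p v t (dl : R) lam : lam = 1 + n.+1%:R * v ^+ 2 -> 0 < v -> 0 <= t <= 1 ->
  p.1 + p.2 + (`|p.2| + 1) * t + 2 * dl + (2 * n%:R + 1) * (2 * n.+1%:R * v ^+ 2) <= 2 * n%:R + 1 ->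
  hvf (v ^+ 2) p t (barrier n lam v t) <= dbarrier n lam v t - dl.
Proof.
move=> lamE v0 t01 H; have /andP[t0 t1] := t01; have [S0 C1 S1 c1] := small_angle t01.
have C0 : 0 < cos (t / 2) by lra.
have w0 : 0 < v ^+ 2 by rewrite exprn_gt0.
have k0 : 0 < n.+1%:R * v ^+ 2 by rewrite mulr_gt0.
have l0 : 0 < lam by rewrite lamE addr_gt0.
have := @barrier_gap R n lam v p t (lt0r_neq0 v0) (lt0r_neq0 l0) (lt0r_neq0 C0).
rewrite /=; set s := sin (barrier _ _ _ _); set d := cos (barrier _ _ _ _).
have sd : d ^+ 2 + s ^+ 2 = 1 := cos2Dsin2 _.
have x1 : sin (t / 2) / cos (t / 2) <= t by rewrite ler_pdivrMr.
have x0 : 0 <= sin (t / 2) / cos (t / 2) by rewrite divr_ge0// ltW.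
have x2 : - t <= sin (t / 2) / cos (t / 2) * (s * d).
  have : -1 <= s * d by nra.
  by nra.
have n0 : 0 <= n%:R :> R by [].
have x3 : (2 * n%:R + 1) * (1 - 2 * (n.+1%:R * v ^+ 2)) * d ^+ 2 <= (2 * n%:R + 1) / lam ^+ 2 * d ^+ 2.
  have n1 : 0 <= 2 * n%:R + 1 :> R by lra.
  rewrite ler_wpM2r ?sqr_ge0// ler_wpM2l//.
  rewrite (_ : n.+1%:R * v ^+ 2 = lam - 1); last by rewrite lamE; ring.
  by apply: inv_sqr_ge; rewrite lamE lerDl ltW.
have x5 : (2 * n%:R + 1) * s ^+ 2 <= 2 * (lam ^+ 4 - 1) * (cos (t / 2) ^+ 2 / v ^+ 2) * s ^+ 2.
  rewrite ler_wpM2r ?sqr_ge0//.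
  have y1 : 4 * (n.+1%:R * v ^+ 2) <= lam ^+ 4 - 1.
    by rewrite lamE; move: (n.+1%:R * v ^+ 2) k0 => k k0; nra.
  have y2 : 2^-1 ^+ 2 / v ^+ 2 <= cos (t / 2) ^+ 2 / v ^+ 2.
    by rewrite ler_pM2r ?invr_gt0// ler_sqr ?nnegrE// ltW.
  have y3 : 2 * (4 * (n.+1%:R * v ^+ 2)) * (2^-1 ^+ 2 / v ^+ 2) = 2 * n.+1%:R.
    by field; rewrite gt_eqF.
  apply: (@le_trans _ _ (2 * n.+1%:R)); first by rewrite -natr1; lra.
  by rewrite -y3; apply: ler_pM; rewrite ?divr_ge0 ?mulr_ge0 ?sqr_ge0 ?(ltW v0)// ler_pM2l.
have x4 : p.2 * cos t <= p.2 + `|p.2| * t.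
  have := ler_norm (- p.2); rewrite normrN; have := cos_le1 t; have := normr_ge0 p.2; nra.
have x6 : 0 <= (2 * n%:R + 1) * (2 * (n.+1%:R * v ^+ 2)) * s ^+ 2.
  by apply: mulr_ge0; [apply: mulr_ge0; [lra|rewrite mulr_ge0// ltW]|exact: sqr_ge0].
have x7 : (2 * n%:R + 1) * (d ^+ 2 + s ^+ 2) = 2 * n%:R + 1 by rewrite sd mulr1.
have x8 : (2 * n%:R + 1) * (2 * n.+1%:R * v ^+ 2) * (d ^+ 2 + s ^+ 2) = (2 * n%:R + 1) * (2 * n.+1%:R * v ^+ 2).
  by rewrite sd mulr1.
lra.
Qed.

End BarrierGap.

Section BarrierBounds.
Context {R : realType}.
Implicit Types (p : R * R) (t f v w lam : R) (n : nat) (e : bool) (psi : R -> R).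
(** The hypothesis on the sine puts [T] in the range of [angle_bounds], where the angle is
    [atan (m T)] up to a small error; for [lam = 1] the product [m T] is the tangent of [t / 2]. The
    barrier has thus joined the slow curve [f = t / 2] from below. *)
Lemma barrier_bounds n (ka v t : R) : 0 < v -> 0 <= ka -> 0 < t <= 1 ->
  n%:R * v ^+ 2 < sin (t / 2) ^+ 2 ->
  let b := barrier n (1 + ka * v ^+ 2) v t in
  [/\ 0 < b < pi / 2, t / 2 - v ^+ 2 * (2 * ka + 2 * n%:R / sin (t / 2)) <= b & b <= t / 2].
Proof.
move=> v0 ka0 /andP[t0 t1] nS b; have t01 : 0 <= t <= 1 by rewrite ltW.
have [S0' C1 S1 _] := small_angle t01.
have pi2 := pi_ge2 R.
have S0 : 0 < sin (t / 2) by apply: sin_gt0_pi; apply/andP; split; lra.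
set S := sin (t / 2) in nS S0 S0' S1 *; set C := cos (t / 2) in C1 S1.
have C0 : 0 < C by lra.
have w0 : 0 < v ^+ 2 by rewrite exprn_gt0.
have k0 : 0 <= ka * v ^+ 2 by rewrite mulr_ge0// ltW.
set lam := 1 + ka * v ^+ 2 in b *.
have l1 : 1 <= lam by rewrite /lam lerDl.
have l0 : 0 < lam by rewrite (lt_le_trans ltr01).
have T0 : 0 < 2 * lam * S / v by rewrite divr_gt0// !mulr_gt0.
have m0 : 0 < v / (2 * C * lam ^+ 3) by rewrite divr_gt0// !mulr_gt0// exprn_gt0.
have nT : 4 * n%:R < (2 * lam * S / v) ^+ 2.
  rewrite expr_div_n ltr_pdivlMr// -mulrA !exprMn.
  have : S ^+ 2 <= lam ^+ 2 * S ^+ 2 by rewrite ler_peMl ?sqr_ge0// exprn_ege1.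
  by move: nS; lra.
have q := angle_quadrant T0 nT m0; have /andP[b1 b2] := angle_bounds T0 nT m0.
have mT : v / (2 * C * lam ^+ 3) * (2 * lam * S / v) = S / C / lam ^+ 2.
  by field; rewrite !gt_eqF.
have mT2 : 4 * n%:R * (v / (2 * C * lam ^+ 3)) / (2 * lam * S / v) = n%:R * v ^+ 2 / (C * S * lam ^+ 4).
  by field; rewrite !gt_eqF.
rewrite mT mT2 in b1; rewrite mT in b2.
have SC1 : S / C <= 1 by rewrite ler_pdivrMr// mul1r (le_trans S1)// ler_piMl// ltW.
have SC0 : 0 <= S / C by rewrite divr_ge0// ltW.
have l2 : 1 - 2 * (ka * v ^+ 2) <= (lam ^+ 2)^-1.
  by rewrite (_ : ka * v ^+ 2 = lam - 1); [exact: inv_sqr_ge|rewrite /lam; ring].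
have tE := atan_tan_half t01; rewrite -/S -/C in tE.
split=> //.
- apply: le_trans b1; rewrite -tE.
  set z := v ^+ 2 * _.
  have z0 : 0 <= z by rewrite /z; apply: mulr_ge0; [exact: ltW|apply: addr_ge0; [exact: mulr_ge0|apply: divr_ge0 => //; exact: mulr_ge0]].
  apply: (le_trans (atan_lipschitz _ z0)); apply: le_atan.
  have h1 : S / C - 2 * (ka * v ^+ 2) <= S / C / lam ^+ 2.
    by apply: le_trans (ler_wpM2l SC0 l2); nra.
  have h2 : n%:R * v ^+ 2 / (C * S * lam ^+ 4) <= v ^+ 2 * (2 * n%:R / S).
    rewrite ler_pdivrMr ?mulr_gt0 ?exprn_gt0//.
    rewrite (_ : _ * (C * S * lam ^+ 4) = (n%:R * v ^+ 2) * (2 * C * lam ^+ 4)); last first.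
      by field; rewrite gt_eqF.
    rewrite ler_peMr//; first by apply: mulr_ge0 => //; exact: ltW.
    have l4 : 1 <= lam ^+ 4 by rewrite exprn_ege1.
    by nra.
  by rewrite /z mulrDr; lra.
- apply: (le_trans b2); rewrite -tE; apply: le_atan.
  by rewrite ler_pdivrMr ?exprn_gt0// ler_peMr// exprn_ege1.
Qed.

End BarrierBounds.

(** * Leaving the repelling slow curve *)

Section RiseAndFall.
Context {R : realType}.
Implicit Types (p : R * R) (t f v w lam : R) (n : nat) (e : bool) (psi : R -> R).
Lemma pi_lt4 : pi < 4 :> R. Proof. by have := pihalf_lt2 R; lra. Qed.

(* The slow curves are [f = t / 2] and [f = - t / 2]: between them the
   solution falls, and above [f = t / 2] it rises; both fast enough, for small [w],
   to follow a line to the prescribed value at [pi / 2]. *)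
Lemma rise w p psi (t1 et a K : R) : 0 < w -> 0 < t1 <= 2^-1 -> 0 < et <= pi / 8 ->
  0 < a -> a <= et -> a <= t1 -> `|p.1| + `|p.2| <= K -> w * (5 + K) <= sin a ^+ 2 ->
  (forall t, is_derive t (1 : R) psi (hvf w p t (psi t))) ->
  t1 / 2 + et <= psi t1 -> 5 * pi / 8 <= psi (pi / 2).
Proof.
have pi2 := pi_ge2 R; have pi4 := pi_lt4.
move=> w0 /andP[t10 t11] /andP[e0 e1] a0 ae at1 pK wK D H.
have L0 : 0 < pi / 2 - t1 by lra.
(* Slope of the chord ending at height [5 pi / 8]: past [pi / 2], which is the threshold of [above],
   yet low enough to keep [y + t / 2] below [7 pi / 8], so that both sines stay away from 0. In the
   same way [fall] ends below 0, the threshold of [below]. *)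
pose B := (5 * pi / 8 - (t1 / 2 + et)) / (pi / 2 - t1).
have BE : B * (pi / 2 - t1) = 5 * pi / 8 - (t1 / 2 + et) by rewrite divfK// gt_eqF.
have BP : (B + 2^-1) * (pi / 2 - t1) = 7 * pi / 8 - t1 - et by rewrite mulrDl BE; field.
have BM : (B - 2^-1) * (pi / 2 - t1) = 3 * pi / 8 - et by rewrite mulrBl BE; field.
have B5 : B <= 5 by rewrite ler_pdivrMr//; lra.
have -> : 5 * pi / 8 = t1 / 2 + et + B * (pi / 2 - t1) by rewrite BE; ring.
apply: (@ode_le R (hvf w p) w^-1 t1 (pi / 2) psi (fun t => t1 / 2 + et + B * (t - t1))
  (fun t => hvf w p t (psi t)) (fun _ => B)) => //.
- by lra.
- by move=> *; exact: hvf_lipschitz.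
- by move=> t _; apply: trigger_derive; rewrite /GRing.scale /=; ring.
- move=> t tab; set y := t1 / 2 + et + B * (t - t1).
  have y1 : et <= y - t / 2.
    rewrite (_ : y - t / 2 = et + (B - 2^-1) * (t - t1)); last by rewrite /y; field.
    by apply: (affine_ge tab) => //; rewrite BM; clear -e1 pi2; lra.
  have y2 : y - t / 2 <= 3 * pi / 8.
    rewrite (_ : y - t / 2 = et + (B - 2^-1) * (t - t1)); last by rewrite /y; field.
    by apply: (affine_le tab); rewrite ?BM; clear -e1 pi2; lra.
  have y3 : t1 <= y + t / 2.
    rewrite (_ : y + t / 2 = t1 + et + (B + 2^-1) * (t - t1)); last by rewrite /y; field.
    by apply: (affine_ge tab); rewrite ?BP; clear -e0 e1 t10 t11 pi2; lra.
  have y4 : y + t / 2 <= 7 * pi / 8.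
    rewrite (_ : y + t / 2 = t1 + et + (B + 2^-1) * (t - t1)); last by rewrite /y; field.
    by apply: (affine_le tab); rewrite ?BP; clear -t11 e1 pi2; lra.
  have api : a <= pi / 8 by exact: le_trans e1.
  have s0 : 0 < sin a by apply: sin_gt0_pi; clear -a0 api pi2; lra.
  have s1 : sin a <= sin (y - t / 2).
    by apply: sin_ge_sin => //; rewrite (le_trans ae y1); clear -y2 api pi2; lra.
  have s2 : sin a <= sin (y + t / 2).
    by apply: sin_ge_sin => //; rewrite (le_trans at1 y3); clear -y4 api; lra.
  have s3 : 5 + K <= (sin y ^+ 2 - sin (t / 2) ^+ 2) / w.
    rewrite ler_pdivlMr// mulrC -sin_mul_sin (le_trans wK)// expr2.
    by apply: ler_pM => //; exact: ltW.
  have p1 := normr_ge0 p.1; have p2 := normr_ge0 p.2.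
  rewrite /hvf; have : - K <= p.1 + p.2 * cos t; last by clear -s3 B5 pK p1 p2; lra.
  have := ler_norm (- p.1); have := ler_norm (- (p.2 * cos t)).
  by rewrite !normrN normrM; have := cos_max t; clear -p2 pK; nra.
- by rewrite subrr mulr0 addr0.
Qed.

Lemma fall w p psi (t1 et a K : R) : 0 < w -> 0 < t1 <= 2^-1 -> 0 < et -> et <= t1 / 2 ->
  0 < a -> a <= et -> a <= pi / 8 -> `|p.1| + `|p.2| <= K -> w * (5 + K) <= sin a ^+ 2 ->
  (forall t, is_derive t (1 : R) psi (hvf w p t (psi t))) ->
  psi t1 <= t1 / 2 - et -> psi (pi / 2) <= - (pi / 8).
Proof.
have pi2 := pi_ge2 R; have pi4 := pi_lt4.
move=> w0 /andP[t10 t11] e0 e1 a0 ae api pK wK D H.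
have L0 : 0 < pi / 2 - t1 by lra.
pose B := (- (pi / 8) - (t1 / 2 - et)) / (pi / 2 - t1).
have BE : B * (pi / 2 - t1) = - (pi / 8) - (t1 / 2 - et) by rewrite divfK// gt_eqF.
have BP : (B + 2^-1) * (pi / 2 - t1) = pi / 8 - t1 + et by rewrite mulrDl BE; field.
have BM : (2^-1 - B) * (pi / 2 - t1) = 3 * pi / 8 - et by rewrite mulrBl BE; field.
have B5 : - 2 <= B by rewrite ler_pdivlMr//; lra.
have -> : - (pi / 8) = t1 / 2 - et + B * (pi / 2 - t1) by rewrite BE; ring.
apply: (@ode_le R (hvf w p) w^-1 t1 (pi / 2) (fun t => t1 / 2 - et + B * (t - t1)) psi
  (fun _ => B) (fun t => hvf w p t (psi t))) => //.
- by lra.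
- by move=> *; exact: hvf_lipschitz.
- by move=> t _; apply: trigger_derive; rewrite /GRing.scale /=; ring.
- move=> t tab; set y := t1 / 2 - et + B * (t - t1).
  have yE : t / 2 - y = et + (2^-1 - B) * (t - t1) by rewrite /y; field.
  have yE' : y + t / 2 = t1 - et + (B + 2^-1) * (t - t1) by rewrite /y; field.
  have y1 : et <= t / 2 - y.
    by rewrite yE; apply: (affine_ge tab) => //; rewrite BM; clear -e1 t11 pi2; lra.
  have y2 : t / 2 - y <= 3 * pi / 8.
    by rewrite yE; apply: (affine_le tab); rewrite ?BM; clear -e1 e0 t11 pi2; lra.
  have y3 : a <= y + t / 2.
    by rewrite yE'; apply: (affine_ge tab); rewrite ?BP; clear -ae e1 api e0; lra.
  have y4 : y + t / 2 <= pi / 2.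
    by rewrite yE'; apply: (affine_le tab); rewrite ?BP; clear -t10 t11 e0 e1 pi2; lra.
  have s0 : 0 < sin a by apply: sin_gt0_pi; clear -a0 api pi2; lra.
  have s1 : sin a <= sin (t / 2 - y).
    by apply: sin_ge_sin => //; rewrite (le_trans ae y1); clear -y2 api pi2; lra.
  have s2 : sin a <= sin (y + t / 2).
    by apply: sin_ge_sin => //; rewrite y3; clear -y4 api pi2; lra.
  have s3 : 5 + K <= - ((sin y ^+ 2 - sin (t / 2) ^+ 2) / w).
    rewrite -mulNr ler_pdivlMr// mulrC opprB -sin_mul_sin (le_trans wK)// expr2.
    by rewrite (addrC _ (t / 2)) in s2 *; apply: ler_pM => //; exact: ltW.
  have p1 := normr_ge0 p.1; have p2 := normr_ge0 p.2.
  rewrite /hvf; have : p.1 + p.2 * cos t <= K; last by clear -s3 B5 pK p1 p2; lra.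
  have := ler_norm p.1; have := ler_norm (p.2 * cos t).
  by rewrite normrM; have := cos_max t; clear -p2 pK; nra.
- by rewrite subrr mulr0 addr0.
Qed.

End RiseAndFall.

(** * Limits of the quarter-period angles *)

Section QuarterPeriod.
Context {R : realType}.
Implicit Types (p : R * R) (t f v w : R) (n : nat) (e : bool).

Lemma sin_sqr_shift f n : sin (f - pi * n%:R) ^+ 2 = sin f ^+ 2 :> R.
Proof.
have := cos_double (f - pi * n%:R); have := cos_double f.
rewrite (_ : 2 * (f - pi * n%:R) = 2 * f + 2 * pi * (- n%:Z)%:~R).
  by rewrite cos_shift; lra.
by rewrite mulrNz -pmulrn; ring.
Qed.

(** The shift by a multiple of [pi] leaves the equation unchanged and brings the initial value to
    [- n pi / 2], that of the barrier. *)
Definition shifted_half_angle n w p t : R := half_angle w p (odd n) t - pi * (n./2)%:R.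

Lemma is_derive_shifted n w p t : 0 < w ->
  is_derive t (1 : R) (shifted_half_angle n w p) (hvf w p t (shifted_half_angle n w p t)).
Proof.
move=> w0; have D := @is_derive_half_angle R w p (odd n) t w0.
rewrite /shifted_half_angle; apply: trigger_derive.
by rewrite subr0 /hvf sin_sqr_shift.
Qed.

Lemma shifted_half_angle0 n w p : 0 < w ->
  shifted_half_angle n w p 0 = - (n%:R * (pi / 2)).
Proof.
move=> w0; rewrite /shifted_half_angle /half_angle sol0// /start.
have := @odd_halfR R n; rewrite -pmulrn => E.
rewrite (_ : n%:R = (odd n)%:R + 2 * n./2%:R); last by rewrite -E; ring.
by case: (odd n) => /=; field.
Qed.

Lemma shifted_half_angle_quarter n w p :
  quarter w p (odd n) = pi + 2 * shifted_half_angle n w p (pi / 2) + pi * (n%:R - (odd n)%:R).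
Proof. by rewrite odd_halfR -pmulrn /shifted_half_angle /half_angle /quarter; field. Qed.

Lemma barrier0 n lam v : barrier n lam v 0 = - (n%:R * (pi / 2)) :> R.
Proof. by rewrite /barrier !(mul0r, sin0, mulr0) angle0. Qed.

Lemma sin_quarter_gt0 t : 0 < t <= 2^-1 -> 0 < sin (t / 4).
Proof.
by have := pi_ge2 R => pi2 /andP[t0 t1]; apply: sin_gt0_pi; apply/andP; split; lra.
Qed.

Lemma barrier_cond n v (t1 t : R) : 0 < t1 <= 2^-1 -> n%:R * v ^+ 2 < sin (t1 / 4) ^+ 2 ->
  t1 / 2 <= t <= t1 -> [/\ 0 < t <= 1, n%:R * v ^+ 2 < sin (t / 2) ^+ 2 &
    2 * n%:R / sin (t / 2) <= 2 * n%:R / sin (t1 / 4)].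
Proof.
move=> t1b nS /andP[ta tb]; have s0 := sin_quarter_gt0 t1b; have /andP[t10 t11] := t1b.
have pi2 := pi_ge2 R.
have sle : sin (t1 / 4) <= sin (t / 2) by apply: sin_ge_sin; [lra|apply/andP; split; lra].
split; first by apply/andP; split; lra.
  by apply: (lt_le_trans nS); rewrite ler_sqr// nnegrE ltW// (lt_le_trans s0).
by rewrite ler_wpM2l// lef_pV2// posrE (lt_le_trans s0).
Qed.

(** The barrier ends slightly below the slow curve, so being above it is not enough for [rise]. On
    [[t1 / 2, t1]] the gap [dl] is spent to gain [dl t1 / 2], while the barrier is at most
    [dl t1 / 4] under the curve. This lift waits until [t1 / 2] because it needs a positive barrier:
    raising the angle then raises its squared sine. *)
Lemma above_of_bounds n p v (t1 dl a K : R) : 0 < v -> 0 < t1 <= 2^-1 -> 0 < dl <= 2^-1 ->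
  2 * n%:R + 1 + 2 * dl + (`|p.2| + 1) * t1 <= p.1 + p.2 ->
  n%:R * v ^+ 2 < sin (t1 / 4) ^+ 2 ->
  v ^+ 2 * (2 * n%:R / sin (t1 / 4)) <= dl * t1 / 4 ->
  0 < a -> a <= dl * t1 / 4 -> a <= t1 -> `|p.1| + `|p.2| <= K ->
  v ^+ 2 * (5 + K) <= sin a ^+ 2 -> above (v ^+ 2) p n.+2.
Proof.
have pi2 := pi_ge2 R; have pi4 := @pi_lt4 R.
move=> v0 t1b /andP[d0 d1] H nS vS a0 ad at1 pK vK; have /andP[t10 t11] := t1b.
have w0 : 0 < v ^+ 2 by rewrite exprn_gt0.
pose psi := shifted_half_angle n (v ^+ 2) p.
have Dpsi t : is_derive t (1 : R) psi (hvf (v ^+ 2) p t (psi t)) := is_derive_shifted n p t w0.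
have Db t : 0 <= t <= t1 -> is_derive t (1 : R) (barrier n 1 v) (dbarrier n 1 v t).
  move=> t01; have [] := @small_angle R t ltac:(clear -t01 t11; lra) => _ C1 _ _.
  by apply: is_derive_barrier => //; clear -C1; lra.
have gap t : 0 <= t <= t1 -> dbarrier n 1 v t + dl <= hvf (v ^+ 2) p t (barrier n 1 v t).
  move=> t01; have /andP[_ tb] := t01.
  apply: lower_gap => //; first by clear -t01 t11; lra.
  have : (`|p.2| + 1) * t <= (`|p.2| + 1) * t1 by rewrite ler_wpM2l// addr_ge0.
  by clear -H; lra.
have lip t x y : `|hvf (v ^+ 2) p t x - hvf (v ^+ 2) p t y| <= (v ^+ 2)^-1 * `|x - y|.
  exact: hvf_lipschitz.
have ph1 : barrier n 1 v (t1 / 2) <= psi (t1 / 2).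
  apply: (@ode_le R (hvf (v ^+ 2) p) _ 0 _ psi (barrier n 1 v) _ _ _ lip
    (fun t _ => Dpsi t) (fun t H => Db t _)) => //; first by clear -t10; lra.
  - by move=> t tb; clear -tb t10; lra.
  - by move=> t tb; have := gap t ltac:(clear -tb t10; lra); clear -d0; lra.
  - by rewrite barrier0 /psi shifted_half_angle0.
have bb t : t1 / 2 <= t <= t1 -> 0 < barrier n 1 v t <= t / 2 /\
    t / 2 - dl * t1 / 4 <= barrier n 1 v t.
  move=> tb; have [h1 h2 h3] := barrier_cond t1b nS tb.
  have := @barrier_bounds R n 0 v t v0 (lexx 0) h1 h2.
  rewrite mul0r addr0 => -[/andP[b1 _] b2 b3]; rewrite b1 b3; split => //.
  apply: le_trans b2; rewrite lerD2l lerN2 mulr0 add0r.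
  by apply: le_trans vS; rewrite ler_pM2l.
have ph2 : barrier n 1 v t1 + dl * (t1 - t1 / 2) <= psi t1.
  apply: (@ode_le R (hvf (v ^+ 2) p) _ (t1 / 2) _ psi
    (fun t => barrier n 1 v t + dl * (t - t1 / 2)) (fun t => hvf (v ^+ 2) p t (psi t))
    (fun t => dbarrier n 1 v t + dl) _ lip) => //; first by clear -t10; lra.
  - move=> t tb; have ? := Db t ltac:(clear -tb t10; lra).
    by apply: trigger_derive; rewrite /GRing.scale /=; ring.
  - move=> t tb; apply: (le_trans (gap t ltac:(clear -tb t10; lra))).
    have [/andP[b1 b2] _] := bb t tb; move: tb => /andP[ta tb].
    have x0 : 0 <= dl * (t - t1 / 2) by apply: mulr_ge0; [exact: ltW|clear -ta; lra].
    have x1 : dl * (t - t1 / 2) <= 2^-1 * t1.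
      by apply: ler_pM => //; [exact: ltW|clear -ta; lra|clear -tb t10; lra].
    rewrite /hvf lerD2r ler_pM2r ?invr_gt0// lerD2r.
    by apply: sin_sqr_le; clear -b1 b2 x0 x1 ta tb t11 pi2; lra.
  - by rewrite subrr mulr0 addr0.
have e0 : 0 < dl * t1 / 4 by rewrite divr_gt0// mulr_gt0.
have e1 : dl * t1 <= 2^-1 * 2^-1 by apply: ler_pM => //; exact: ltW.
have [_ b2] := bb t1 ltac:(clear -t10; lra).
have := @rise R (v ^+ 2) p psi t1 (dl * t1 / 4) a K w0 t1b _ a0 ad at1 pK vK Dpsi.
move=> /(_ ltac:(clear -e0 e1 pi2; lra) ltac:(clear -ph2 b2; lra)); rewrite /above /psi -natr1 -natr1 /= negbK.
by rewrite shifted_half_angle_quarter; clear -pi2; lra.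
Qed.

(** The barrier already lies under the slow curve, so the whole gain [dl t1 / 2] is available to
    [fall]. The lower bound on the barrier keeps the lowered curve above its opposite, where the
    squared sine has not increased. *)
Lemma below_of_bounds n p v (t1 dl a K : R) : 0 < v -> 0 < t1 <= 2^-1 -> 0 < dl <= 2^-1 ->
  p.1 + p.2 + (`|p.2| + 1) * t1 + 2 * dl + (2 * n%:R + 1) * (2 * n.+1%:R * v ^+ 2)
    <= 2 * n%:R + 1 ->
  n%:R * v ^+ 2 < sin (t1 / 4) ^+ 2 ->
  v ^+ 2 * (2 * n.+1%:R + 2 * n%:R / sin (t1 / 4)) <= dl * t1 / 4 ->
  0 < a -> a <= dl * t1 / 4 -> a <= pi / 8 -> `|p.1| + `|p.2| <= K ->
  v ^+ 2 * (5 + K) <= sin a ^+ 2 -> below (v ^+ 2) p n.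
Proof.
have pi2 := pi_ge2 R; have pi4 := @pi_lt4 R.
move=> v0 t1b /andP[d0 d1] H nS vS a0 ad api pK vK; have /andP[t10 t11] := t1b.
have w0 : 0 < v ^+ 2 by rewrite exprn_gt0.
pose lam : R := 1 + n.+1%:R * v ^+ 2.
have l0 : 0 < lam by rewrite ltr_wpDr// mulr_ge0// ltW.
pose psi := shifted_half_angle n (v ^+ 2) p.
have Dpsi t : is_derive t (1 : R) psi (hvf (v ^+ 2) p t (psi t)) := is_derive_shifted n p t w0.
have Db t : 0 <= t <= t1 -> is_derive t (1 : R) (barrier n lam v) (dbarrier n lam v t).
  move=> t01; have [] := @small_angle R t ltac:(clear -t01 t11; lra) => _ C1 _ _.
  by apply: is_derive_barrier => //; clear -C1; lra.
have gap t : 0 <= t <= t1 -> hvf (v ^+ 2) p t (barrier n lam v t) <= dbarrier n lam v t - dl.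
  move=> t01; have /andP[_ tb] := t01.
  apply: upper_gap => //; first by clear -t01 t11; lra.
  have : (`|p.2| + 1) * t <= (`|p.2| + 1) * t1 by rewrite ler_wpM2l// addr_ge0.
  by clear -H; lra.
have lip t x y : `|hvf (v ^+ 2) p t x - hvf (v ^+ 2) p t y| <= (v ^+ 2)^-1 * `|x - y|.
  exact: hvf_lipschitz.
have ph1 : psi (t1 / 2) <= barrier n lam v (t1 / 2).
  apply: (@ode_le R (hvf (v ^+ 2) p) _ 0 _ (barrier n lam v) psi _ _ _ lip
    (fun t H => Db t _) (fun t _ => Dpsi t)) => //; first by clear -t10; lra.
  - by move=> t tb; clear -tb t10; lra.
  - by move=> t tb; have := gap t ltac:(clear -tb t10; lra); clear -d0; lra.
  - by rewrite barrier0 /psi shifted_half_angle0.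
have bb t : t1 / 2 <= t <= t1 -> 0 < barrier n lam v t <= t / 2 /\
    t / 2 - dl * t1 / 4 <= barrier n lam v t.
  move=> tb; have [h1 h2 h3] := barrier_cond t1b nS tb.
  have := @barrier_bounds R n n.+1%:R v t v0 (ler0n _ _) h1 h2.
  move=> [/andP[b1 _] b2 b3]; rewrite b1 b3; split => //.
  apply: le_trans b2; rewrite lerD2l lerN2.
  by apply: le_trans vS; rewrite ler_pM2l// lerD2l.
have ph2 : psi t1 <= barrier n lam v t1 - dl * (t1 - t1 / 2).
  apply: (@ode_le R (hvf (v ^+ 2) p) _ (t1 / 2) _
    (fun t => barrier n lam v t - dl * (t - t1 / 2)) psi
    (fun t => dbarrier n lam v t - dl) (fun t => hvf (v ^+ 2) p t (psi t)) _ lip) => //;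
    first by clear -t10; lra.
  - move=> t tb; have ? := Db t ltac:(clear -tb t10; lra).
    by apply: trigger_derive; rewrite /GRing.scale /=; ring.
  - move=> t tb; apply: le_trans (gap t ltac:(clear -tb t10; lra)).
    have [/andP[b1 b2] b3] := bb t tb; move: tb => /andP[ta tb].
    have x0 : 0 <= dl * (t - t1 / 2) by apply: mulr_ge0; [exact: ltW|clear -ta; lra].
    have x1 : dl * t <= t by rewrite ler_piMl//; [clear -ta t10|clear -d1]; lra.
    rewrite /hvf lerD2r ler_pM2r ?invr_gt0// lerD2r.
    by apply: sin_sqr_le; clear -b1 b2 b3 x0 x1 ta tb t10 t11 d0 pi2; lra.
  - by rewrite subrr mulr0 subr0.
have e0 : 0 < dl * t1 / 2 by rewrite divr_gt0// mulr_gt0.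
have e1 : dl * t1 <= t1 by rewrite ler_piMl//; [exact: ltW|clear -d1; lra].
have [/andP[_ b2] _] := bb t1 ltac:(clear -t10; lra).
have := @fall R (v ^+ 2) p psi t1 (dl * t1 / 2) a K w0 t1b e0 _ a0 _ api pK vK Dpsi.
move=> /(_ ltac:(clear -e1; lra) ltac:(clear -ad e0; lra) ltac:(clear -ph2 b2; lra)); rewrite /below /psi.
by rewrite shifted_half_angle_quarter; clear -pi2; lra.
Qed.

End QuarterPeriod.

Section NearQuarter.
Context {R : realType}.
Implicit Types (p : R * R) (t v w : R) (n : nat).

Lemma near_params (p0 : R * R) (rho W : R) (P : R -> R * R -> Prop) : 0 < rho -> 0 < W ->
  (forall p w, `|p0.1 - p.1| < rho -> `|p0.2 - p.2| < rho -> 0 < w -> w < W -> P w p) ->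
  \forall p \near p0 & w \near 0^'+, P w p.
Proof.
move=> r0 W0 H.
exists ([set p | `|p0.1 - p.1| < rho /\ `|p0.2 - p.2| < rho], [set w | 0 < w < W]).
  split; first by apply: (near_prod r0).
  near=> w; apply/andP; split; near: w; [exact: nbhs_right_gt|exact: nbhs_right_lt].
by move=> [p w] [[h1 h2] /andP[h3 h4]]; exact: H.
Unshelve. all: by end_near. Qed.

Lemma norm_le_add1 (x y : R) : `|x - y| <= 1 -> `|y| <= `|x| + 1.
Proof. by have := ler_normB x (x - y); rewrite subKr; lra. Qed.

Lemma mul_lt1_of_lt_inv (A B C D w : R) : 0 <= A -> 0 <= B -> 0 <= C -> 0 <= D ->
  0 < w -> w < (A + B + C + D + 1)^-1 -> [/\ w * A < 1, w * B < 1, w * C < 1 & w * D < 1].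
Proof.
move=> A0 B0 C0 D0 w0; rewrite -[_^-1]mul1r ltr_pdivlMr; last by lra.
have H x : 0 <= x -> x <= A + B + C + D -> w * (A + B + C + D + 1) < 1 -> w * x < 1.
  by move=> x0 xs; apply: le_lt_trans; rewrite ler_pM2l//; lra.
by move=> h; split; apply: H => //; lra.
Qed.

(** The distance [g] to resonance is shared out: [g / 4] for the slack proportional to [t1], [g / 8]
    for [2 * dl]; the rest covers a move of each parameter by [g / 8] and, in [near_below], the term
    of order [w]. *)
Lemma barrier_scales (g K : R) : 0 < g -> 0 < K -> exists t1 dl : R,
  [/\ 0 < t1 <= 2^-1, K * t1 <= g / 4, 0 < dl <= 2^-1, 2 * dl <= g / 8 &
    0 < dl * t1 / 4 <= 8^-1 /\ dl * t1 / 4 <= t1].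
Proof.
move=> g0 K0; exists (Num.min 2^-1 (g / (4 * K))), (Num.min 2^-1 (g / 16)).
set t1 := Num.min _ _; set dl := Num.min _ _.
have t10 : 0 < t1 by rewrite lt_min invr_gt0 ltr0n divr_gt0// mulr_gt0.
have t11 : t1 <= 2^-1 by rewrite ge_min lexx.
have d0 : 0 < dl by rewrite lt_min invr_gt0 ltr0n divr_gt0.
have d1 : dl <= 2^-1 by rewrite ge_min lexx.
have d2 : dl <= g / 16 by rewrite ge_min lexx orbT.
have dt0 : 0 < dl * t1 by rewrite mulr_gt0.
have dt1 : dl * t1 <= t1 by rewrite ler_piMl//; lra.
split; rewrite ?t10 ?d0 ?t11 ?d1//; [|lra|split; lra].
rewrite (_ : g / 4 = K * (g / (4 * K))); last by field; rewrite gt_eqF.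
by rewrite ler_pM2l// ge_min lexx orbT.
Qed.

Lemma near_above n p0 : 2 * n%:R + 1 < p0.1 + p0.2 ->
  \forall p \near p0 & w \near 0^'+, above w p n.+2.
Proof.
rewrite -subr_gt0; set g := _ - _ => g0.
pose K := `|p0.1| + `|p0.2| + 2.
have K0 : 0 < K by rewrite ltr_wpDl// addr_ge0.
have [t1 [dl [t1b t12 db d2 [/andP[a0 a8] a1]]]] := barrier_scales g0 K0.
set a := dl * t1 / 4 in a0 a8 a1.
have /andP[t10 _] := t1b.
have sa : 0 < sin a by apply: sin_gt0_pi; have := pi_ge2 R; clear -a0 a8; lra.
have s0 := sin_quarter_gt0 t1b.
have A10 : 0 <= n%:R / sin (t1 / 4) ^+ 2 by rewrite divr_ge0// sqr_ge0.
have A20 : 0 <= 2 * n%:R / sin (t1 / 4) / a.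
  by apply: divr_ge0 (ltW a0); apply: divr_ge0 (ltW s0); exact: mulr_ge0.
have A30 : 0 <= (5 + K) / sin a ^+ 2 by rewrite divr_ge0 ?sqr_ge0// addr_ge0// ltW.
have g8 : 0 < g / 8 by rewrite divr_gt0.
apply: (@near_params p0 (Num.min 1 (g / 8))
  (n%:R / sin (t1 / 4) ^+ 2 + 2 * n%:R / sin (t1 / 4) / a + (5 + K) / sin a ^+ 2 + 0 + 1)^-1).
- by rewrite lt_min ltr01.
- by rewrite invr_gt0 ltr_wpDl// !addr_ge0.
move=> p w; rewrite !lt_min => /andP[/ltW p1 /ltr_normlP[h1 h2]] /andP[/ltW p2 /ltr_normlP[h3 h4]].
move=> w0 /(mul_lt1_of_lt_inv A10 A20 A30 (lexx 0) w0)[w1 w2 w3 _].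
have {}p1 := norm_le_add1 p1; have {}p2 := norm_le_add1 p2.
have v0 : 0 < Num.sqrt w by rewrite sqrtr_gt0.
have vE : Num.sqrt w ^+ 2 = w by rewrite sqr_sqrtr// ltW.
have pK : `|p.1| + `|p.2| <= K by rewrite /K; clear -p1 p2; lra.
have pt : (`|p.2| + 1) * t1 <= K * t1.
  by rewrite ler_pM2r// /K; have := normr_ge0 p0.1; clear -p2; lra.
rewrite -vE; apply: (@above_of_bounds R n p (Num.sqrt w) t1 dl a K) => //; rewrite ?vE.
- by rewrite /g in g0 t12 d2 h2 h4; clear -pt g0 t12 d2 h2 h4; lra.
- by move: w1; rewrite mulrA ltr_pdivrMr ?exprn_gt0// mul1r mulrC.
- by move: w2; rewrite mulrA ltr_pdivrMr// mul1r => /ltW.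
- by move: w3; rewrite mulrA ltr_pdivrMr ?exprn_gt0// mul1r => /ltW.
Qed.

Lemma near_below n p0 : p0.1 + p0.2 < 2 * n%:R + 1 ->
  \forall p \near p0 & w \near 0^'+, below w p n.
Proof.
rewrite -subr_gt0; set g := _ - _ => g0.
pose K := `|p0.1| + `|p0.2| + 2.
have K0 : 0 < K by rewrite ltr_wpDl// addr_ge0.
have [t1 [dl [t1b t12 db d2 [/andP[a0 a8] _]]]] := barrier_scales g0 K0.
set a := dl * t1 / 4 in a0 a8.
have /andP[t10 _] := t1b; have pi2 := pi_ge2 R.
have sa : 0 < sin a by apply: sin_gt0_pi; clear -a0 a8 pi2; lra.
have s0 := sin_quarter_gt0 t1b.
have A10 : 0 <= n%:R / sin (t1 / 4) ^+ 2 by rewrite divr_ge0// sqr_ge0.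
have A20 : 0 <= (2 * n.+1%:R + 2 * n%:R / sin (t1 / 4)) / a.
  apply: divr_ge0 (ltW a0); apply: addr_ge0; first exact: mulr_ge0.
  by apply: divr_ge0 (ltW s0); exact: mulr_ge0.
have A30 : 0 <= (5 + K) / sin a ^+ 2 by rewrite divr_ge0 ?sqr_ge0// addr_ge0// ltW.
have g8 : 0 < g / 8 by rewrite divr_gt0.
have A40 : 0 <= (2 * n%:R + 1) * (2 * n.+1%:R) / (g / 8).
  by apply: divr_ge0 (ltW g8); apply: mulr_ge0; [apply: addr_ge0|exact: mulr_ge0].
apply: (@near_params p0 (Num.min 1 (g / 8))
  (n%:R / sin (t1 / 4) ^+ 2 + (2 * n.+1%:R + 2 * n%:R / sin (t1 / 4)) / a
   + (5 + K) / sin a ^+ 2 + (2 * n%:R + 1) * (2 * n.+1%:R) / (g / 8) + 1)^-1).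
- by rewrite lt_min ltr01.
- by rewrite invr_gt0 ltr_wpDl// !addr_ge0.
move=> p w; rewrite !lt_min => /andP[/ltW p1 /ltr_normlP[h1 h2]] /andP[/ltW p2 /ltr_normlP[h3 h4]].
move=> w0 /(mul_lt1_of_lt_inv A10 A20 A30 A40 w0)[w1 w2 w3 w4].
have {}p1 := norm_le_add1 p1; have {}p2 := norm_le_add1 p2.
have v0 : 0 < Num.sqrt w by rewrite sqrtr_gt0.
have vE : Num.sqrt w ^+ 2 = w by rewrite sqr_sqrtr// ltW.
have pK : `|p.1| + `|p.2| <= K by rewrite /K; clear -p1 p2; lra.
have pt : (`|p.2| + 1) * t1 <= K * t1.
  by rewrite ler_pM2r// /K; have := normr_ge0 p0.1; clear -p2; lra.
rewrite -vE; apply: (@below_of_bounds R n p (Num.sqrt w) t1 dl a K) => //; rewrite ?vE.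
- move: w4; rewrite (mulrA w) ltr_pdivrMr// mul1r.
  rewrite (_ : (2 * n%:R + 1) * (2 * n.+1%:R * w) = w * ((2 * n%:R + 1) * (2 * n.+1%:R))); last by ring.
  by rewrite /g in g0 t12 d2 h1 h3 *; clear -pt g0 t12 d2 h1 h3; lra.
- by move: w1; rewrite mulrA ltr_pdivrMr ?exprn_gt0// mul1r mulrC.
- by move: w2; rewrite mulrA ltr_pdivrMr// mul1r => /ltW.
- by clear -a8 pi2; lra.
- by move: w3; rewrite mulrA ltr_pdivrMr ?exprn_gt0// mul1r => /ltW.
Qed.

(** For [n <= 1] the threshold is 0 and no resonance opposes: [cos (t / 2) + cos t >= 1/2] on the
    quarter period, so the line [theta = t / 2] is a sub-solution for any parameters once [w] is
    small. This is why the zone of index 0 has no lower end. *)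
Lemma near_above01 n p0 : (n <= 1)%N -> \forall p \near p0 & w \near 0^'+, above w p n.
Proof.
have pi2 := pi_ge2 R => n1; pose K := `|p0.1| + `|p0.2| + 3.
have K0 : 0 < K by rewrite ltr_wpDl// addr_ge0.
apply: (@near_params p0 1 (2 * K)^-1) => //; first by rewrite invr_gt0 mulr_gt0.
move=> p w /ltW/norm_le_add1 p1 /ltW/norm_le_add1 p2 w0 wK.
have w0' : w != 0 by rewrite gt_eqF.
have {wK} wK : `|p.1| + `|p.2| + 2^-1 <= 2^-1 / w.
  rewrite ler_pdivlMr//; move: wK; rewrite -[_^-1]mul1r ltr_pdivlMr ?mulr_gt0// => wK.
  apply: (@le_trans _ _ (K * w)); last by clear -wK; lra.
  by rewrite ler_pM2r// /K; clear -p1 p2; lra.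
have nE : n%:R - (odd n)%:R = 0 :> R by case: n n1 => [|[|]]//= _; rewrite subrr.
rewrite /above nE mulr0 /quarter.
have /(tau_solutionP _ _ w0') dx := sol_sol p (start (odd n)) w0.
apply: (@lt_le_trans _ _ (pi / 2 / 2)); first by clear -pi2; lra.
apply: (@ode_le R (vf w p) w^-1 0 (pi / 2) (sol w p (start (odd n))) (fun t => t / 2)
  (fun t => vf w p t (sol w p (start (odd n)) t)) (fun _ => 2^-1)) => //.
- by clear -pi2; lra.
- by move=> *; exact: vf_lipschitz.
- by move=> t _; apply: trigger_derive; rewrite /GRing.scale /=; field.
- move=> t /andP[t0 t1]; rewrite /vf.
  have c0 : 0 <= cos t by apply: cos_ge0_pihalf; clear -pi2 t0 t1; lra.
  have c1 : 2^-1 <= cos (t / 2).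
    have c2 : 0 <= cos (t / 2) by apply: cos_ge0_pihalf; clear -pi2 t0 t1; lra.
    have := cos_double (t / 2); rewrite (_ : 2 * (t / 2) = t); last by field.
    by have := cos2Dsin2 (t / 2); clear -c0 c2; nra.
  have c3 : 2^-1 / w <= (cos (t / 2) + cos t) / w.
    by rewrite ler_pM2r ?invr_gt0//; clear -c0 c1; lra.
  have : - `|p.1| <= p.1 by rewrite lerNl -normrN ler_norm.
  have : - `|p.2| <= p.2 * cos t.
    by rewrite lerNl (le_trans (ler_norm _))// normrN normrM ler_piMr// cos_max.
  by clear -wK c3; lra.
- by rewrite mul0r sol0// /start mulr_ge0// ltW// pi_gt0.
Qed.

End NearQuarter.

(** * Phase-lock areas near a point *)

Section Zones.
Context {R : realType}.
Implicit Types (p q : R * R) (x y t w : R) (n m k : nat) (r : int).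

Definition zone n x : Prop := (n = 0%N \/ 2 * n%:R - 1 < x) /\ x < 2 * n%:R + 1.

Lemma Zint_zone n x : Zint (n : int) x <-> zone n x.
Proof.
rewrite /Zint /zone; case: n => [|n] /=.
  rewrite mulr0 add0r; split => [h|[_ h]]; last by move: h; rewrite add0r.
  by split; [left|rewrite add0r].
split; first by move=> /andP[h1 h2]; split => //; right.
by move=> [[//|h1] h2]; apply/andP.
Qed.

Lemma limit_domainP r p : limit_domain r p <->
  exists n k, [/\ r = n%:Z - k%:Z, zone n (p.2 + p.1) & zone k (p.2 - p.1)].
Proof.
split.
  move=> [k [k0 kr0] [Zs Zd]]; exists (absz (k + r)), (absz k); split; first by lia.
    by apply/Zint_zone; rewrite gez0_abs.
  by apply/Zint_zone; rewrite gez0_abs.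
move=> [n [k [-> Zs Zd]]]; exists k%:Z; first by split; lia.
split; last exact/Zint_zone.
by rewrite (_ : k%:Z + (n%:Z - k%:Z) = n%:Z); [exact/Zint_zone|lia].
Qed.

Lemma zone_inj n m x : zone n x -> zone m x -> n = m.
Proof.
move=> [h1 h2] [h3 h4].
have H a b : 2 * a%:R - 1 < x -> x < 2 * b%:R + 1 -> (a <= b)%N.
  move=> ha hb; rewrite -ltnS -(ltr_nat R) -natr1; lra.
case: h1 h3 => [n0|h1] [m0|h3]; first by lia.
- by have := H _ _ h3 h2; lia.
- by have := H _ _ h1 h4; lia.
- by have := H _ _ h3 h2; have := H _ _ h1 h4; lia.
Qed.

Lemma zone_between n x y t : zone n x -> zone n y -> x <= t <= y -> zone n t.
Proof.
move=> [h1 _] [_ h2] /andP[xt ty]; split; last exact: le_lt_trans h2.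
by case: h1 => [|h1]; [left|right; exact: lt_le_trans xt].
Qed.

Lemma zone_open n x : zone n x -> exists2 e, 0 < e & forall y, `|x - y| < e -> zone n y.
Proof.
move=> [h1 h2]; have h2' : 0 < 2 * n%:R + 1 - x by rewrite subr_gt0.
case: h1 => [n0|h1].
  exists (2 * n%:R + 1 - x) => // y /ltr_normlP[h3 h4]; split; [by left|lra].
have h1' : 0 < x - (2 * n%:R - 1) by rewrite subr_gt0.
exists (Num.min (2 * n%:R + 1 - x) (x - (2 * n%:R - 1))); first by rewrite lt_min h1' h2'.
by move=> y; rewrite lt_min => /andP[/ltr_normlP[? ?] /ltr_normlP[? ?]]; split; [right|]; lra.
Qed.

Lemma zone_bracket x : exists a b e, [/\ 0 < e, (a <= b <= a.+1)%N,
  forall t, 0 < t < e -> zone a (x - t) /\ zone b (x + t) &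
  b = a.+1 -> x = 2 * a%:R + 1].
Proof.
have B n : zone n x -> exists a b e, [/\ 0 < e, (a <= b <= a.+1)%N,
  forall t, 0 < t < e -> zone a (x - t) /\ zone b (x + t) &
  b = a.+1 -> x = 2 * a%:R + 1].
  move=> /zone_open[e e0 He]; exists n, n, e; split => //; [lia| |lia].
  move=> t /andP[t0 te]; split; apply: He.
    by rewrite opprB addrC subrK gtr0_norm.
  by rewrite opprD addrA subrr sub0r normrN gtr0_norm.
have [x1|x1] := ltP x 1; first by apply: (B 0%N); split; [left|rewrite mulr0 add0r].
have x2 : 0 <= (x + 1) / 2 by lra.
have /andP[h1 h2] := truncn_itv x2.
set n := Num.trunc _ in h1 h2.
have {}h2 : (x + 1) / 2 < n%:R + 1 by rewrite natr1.
have [x3|x3] := ltP (2 * n%:R - 1) x; first by apply: (B n); split; [right|lra].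
have xE : x = 2 * n%:R - 1 by lra.
case: n h1 h2 x3 xE => [|n] h1 h2 x3 xE; first by move: x1; rewrite xE mulr0; lra.
have nE : n.+1%:R = n%:R + 1 :> R by rewrite natr1.
exists n, n.+1, 1; split => //; first lia.
  move=> t /andP[t0 t1]; split; split; rewrite ?nE; [|lra|right; lra|lra].
  by case: (n) xE nE => [|m] ? ?; [left|right; lra].
by move=> _; lra.
Qed.

End Zones.

Section NearRotation.
Context {R : realType}.
Implicit Types (p q : R * R) (x y t w : R) (n m k : nat) (r : int).

Lemma near_prodP p (P : set (R * R)) : nbhs p P ->
  exists2 e, 0 < e & forall q, `|p.1 - q.1| < e -> `|p.2 - q.2| < e -> P q.
Proof.
move=> [[X Y] /= [/nbhs_ballP[e1 /= e10 H1] /nbhs_ballP[e2 /= e20 H2]] XY].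
exists (Num.min e1 e2); first by rewrite lt_min e10.
move=> q; rewrite !lt_min => /andP[h1 _] /andP[_ h2].
by apply: XY; split; [exact: H1|exact: H2].
Qed.

Lemma near_params_map (f : R * R -> R * R) p0 (P : R -> R * R -> Prop) :
  (forall p, `|(f p0).1 - (f p).1| <= `|p0.1 - p.1| /\ `|(f p0).2 - (f p).2| <= `|p0.2 - p.2|) ->
  (\forall p \near f p0 & w \near 0^'+, P w p) ->
  \forall p \near p0 & w \near 0^'+, P w (f p).
Proof.
move=> Hf [[A B] /= [nA nB] AB].
exists (f @^-1` A, B); last by move=> [p w] [/= Ap Bw]; exact: (AB (f p, w)).
split=> //=; have [e e0 He] := near_prodP nA.
apply: (@near_prod R p0 e) => // q h1 h2; have [g1 g2] := Hf q.
by apply: He; [exact: le_lt_trans h1|exact: le_lt_trans h2].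
Qed.

Lemma near_above_zone n p0 : (n <= 1)%N \/ 2 * n%:R - 3 < p0.1 + p0.2 ->
  \forall p \near p0 & w \near 0^'+, above w p n.
Proof.
have [n1 _|] := leqP n 1; first exact: near_above01.
case: n => [|[|n]]// _ [//|h]; apply: near_above.
by move: h; rewrite -natr1 -natr1; lra.
Qed.

Definition reflect_l p : R * R := (- p.1, p.2).

Lemma near_reflect p0 (P : R -> R * R -> Prop) :
  (\forall p \near reflect_l p0 & w \near 0^'+, P w p) ->
  \forall p \near p0 & w \near 0^'+, P w (reflect_l p).
Proof.
apply: near_params_map => p; rewrite lexx; split => //=.
by rewrite -opprD normrN.
Qed.

Lemma near_pos p0 : \forall p \near p0 & w \near 0^'+, (0 : R) < w.
Proof. exact: (@near_params R p0 1 1 (fun w _ => 0 < w)). Qed.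

Lemma near_turn_lt n m r p0 : r = n%:Z - m%:Z + 1 -> p0.2 + p0.1 < 2 * n%:R + 1 ->
  (m <= 1)%N \/ 2 * m%:R - 3 < p0.2 - p0.1 ->
  \forall p \near p0 & w \near 0^'+, turn w p (odd n) < 2 * pi * r%:~R.
Proof.
move=> rE hs hd.
have H1 : \forall p \near p0 & w \near 0^'+, below w p n.
  by apply: near_below; rewrite (addrC p0.1).
have H2 : \forall p \near p0 & w \near 0^'+, above w (reflect_l p) m.
  apply: (near_reflect (P := fun w p => above w p m)); apply: near_above_zone.
  by case: hd => [->|hd]; [left|right; rewrite /= (addrC (- p0.1))].
apply: filterS3 (near_pos p0) H1 H2 => -[[l u] w] /= w0 h1 h2.
exact: (period_lt w0 rE h1 h2).
Qed.

Lemma near_turn_gt n m r p0 : r = n%:Z - m%:Z - 1 ->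
  (n <= 1)%N \/ 2 * n%:R - 3 < p0.2 + p0.1 -> p0.2 - p0.1 < 2 * m%:R + 1 ->
  \forall p \near p0 & w \near 0^'+, 2 * pi * r%:~R < turn w p (odd n).
Proof.
move=> rE hs hd.
have H1 : \forall p \near p0 & w \near 0^'+, above w p n.
  by apply: near_above_zone; rewrite (addrC p0.1).
have H2 : \forall p \near p0 & w \near 0^'+, below w (reflect_l p) m.
  apply: (near_reflect (P := fun w p => below w p m)); apply: near_below.
  by rewrite /= (addrC (- p0.1)).
apply: filterS3 (near_pos p0) H1 H2 => -[[l u] w] /= w0 h1 h2.
exact: (period_gt w0 rE h1 h2).
Qed.

Lemma near_rotation r p0 : limit_domain r p0 ->
  \forall p \near p0 & w \near 0^'+, rotation_level r%:~R w p.
Proof.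
move=> /limit_domainP[n [k [rE [s1 s2] [d1 d2]]]].
(* The pairs [(n, k.+1)] and [(n.+1, k)] both encode [r = n - k], and they concern the two different
   base points. *)
have H1 : \forall p \near p0 & w \near 0^'+, turn w p (odd n) < 2 * pi * r%:~R.
  apply: (@near_turn_lt n k.+1) => //; first by lia.
  by case: d1 => [->|d1]; [left|right; rewrite -natr1; lra].
have H2 : \forall p \near p0 & w \near 0^'+, 2 * pi * r%:~R < turn w p (odd n.+1).
  apply: (@near_turn_gt n.+1 k) => //; first by lia.
  by case: s1 => [->|s1]; [left|right; rewrite -natr1; lra].
apply: filterS3 (near_pos p0) H1 H2 => -[p w] /= w0 /ltW h1 /ltW h2.
exact: (rotation_number_turn w0 h2 h1).
Qed.

Lemma open_limit_domain r : open (limit_domain r : set (R * R)).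
Proof.
rewrite openE => p /limit_domainP[n [k [rE /zone_open[e1 e10 H1] /zone_open[e2 e20 H2]]]].
apply: (@near_prod R p (Num.min e1 e2 / 2)); first by rewrite divr_gt0// lt_min e10.
have m1 : Num.min e1 e2 <= e1 by rewrite ge_min lexx.
have m2 : Num.min e1 e2 <= e2 by rewrite ge_min lexx orbT.
move=> q /ltr_normlP[h1 h2] /ltr_normlP[h3 h4]; apply/limit_domainP; exists n, k.
by split => //; [apply: H1|apply: H2]; rewrite ltr_norml; apply/andP; split; lra.
Qed.

Lemma limit_domain_inj r r' p : limit_domain r p -> limit_domain r' p -> r = r'.
Proof.
move=> /limit_domainP[n [k [-> h1 h2]]] /limit_domainP[n' [k' [-> h3 h4]]].
by rewrite (zone_inj h1 h3) (zone_inj h2 h4).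
Qed.

Lemma limit_domain_closure r r' p : limit_domain r p -> closure (limit_domain r') p -> r = r'.
Proof.
move=> h1 h2; have := h2 _ (open_nbhs_nbhs (conj (@open_limit_domain r) h1)).
by move=> [q [h3 h4]]; rewrite (limit_domain_inj h3 h4).
Qed.

(** A step along an axis changes both [u + l] and [u - l], so it leaves every grid line through
    [p0]: the four neighbours lie in open cells even if [p0] is a corner. *)
Lemma limit_domain_around p0 : exists (e : R) (n n' k k' : nat),
  [/\ 0 < e, (n <= n' <= n.+1)%N, (k <= k' <= k.+1)%N &
    forall t, 0 < t < e -> [/\ limit_domain (n'%:Z - k%:Z) (p0.1 + t, p0.2),
      limit_domain (n%:Z - k'%:Z) (p0.1 - t, p0.2),
      limit_domain (n'%:Z - k'%:Z) (p0.1, p0.2 + t),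
      limit_domain (n%:Z - k%:Z) (p0.1, p0.2 - t) &
      n' = n -> k' = k -> limit_domain (n%:Z - k%:Z) p0]].
Proof.
have [n [n' [e1 [e10 nn H1 _]]]] := zone_bracket (p0.2 + p0.1).
have [k [k' [e2 [e20 kk H2 _]]]] := zone_bracket (p0.2 - p0.1).
exists (Num.min e1 e2), n, n', k, k'; split => //; first by rewrite lt_min e10.
move=> t; rewrite lt_min => /and3P[t0 t1 t2].
have [h1 h2] := H1 t ltac:(by rewrite t0); have [h3 h4] := H2 t ltac:(by rewrite t0).
split; last move=> nn' kk'; apply/limit_domainP.
- exists n', k; split=> //=; first by rewrite addrA.
  by rewrite opprD addrA.
- exists n, k'; split=> //=; first by rewrite addrA.
  by rewrite opprB addrA addrAC.
- by exists n', k'; split => //=; rewrite addrAC.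
- by exists n, k; split => //=; rewrite addrAC.
- rewrite nn' in h2; rewrite kk' in h4.
  exists n, k; split => //.
    by apply: (zone_between h1 h2); apply/andP; split; lra.
  by apply: (zone_between h3 h4); apply/andP; split; lra.
Qed.

Lemma near_not_rotation r p0 : ~ closure (limit_domain r) p0 ->
  \forall p \near p0 & w \near 0^'+, ~ rotation_level r%:~R w p.
Proof.
move=> ncl; have [e [n [n' [k [k' [e0 nn kk H]]]]]] := limit_domain_around p0.
have [d d0 Hd] : exists2 d, 0 < d & forall q, `|p0.1 - q.1| < d -> `|p0.2 - q.2| < d -> ~ limit_domain r q.
  have [|d d0 Hd] := @near_prodP p0 (~` closure (limit_domain r)).
    by apply: open_nbhs_nbhs; split => //; apply: closed_openC; exact: closed_closure.
  by exists d => // q h1 h2 h3; apply: (Hd q h1 h2); exact: subset_closure.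
pose t := Num.min e d / 2.
have t0 : 0 < Num.min e d by rewrite lt_min e0.
have m1 : Num.min e d <= e by rewrite ge_min lexx.
have m2 : Num.min e d <= d by rewrite ge_min lexx orbT.
have [hR hL hT hB _] := H t ltac:(rewrite /t; lra).
have td : `|t| < d by rewrite gtr0_norm /t; lra.
have nR : n'%:Z - k%:Z != r.
  by apply/eqP => E; move: hR; rewrite E; apply: Hd => /=; rewrite ?subrr ?normr0// opprD addrA subrr sub0r normrN.
have nL : n%:Z - k'%:Z != r.
  by apply/eqP => E; move: hL; rewrite E; apply: Hd => /=; rewrite ?subrr ?normr0// opprB addrC subrK.
have nT : n'%:Z - k'%:Z != r.
  by apply/eqP => E; move: hT; rewrite E; apply: Hd => /=; rewrite ?subrr ?normr0// opprD addrA subrr sub0r normrN.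
have nB : n%:Z - k%:Z != r.
  by apply/eqP => E; move: hB; rewrite E; apply: Hd => /=; rewrite ?subrr ?normr0// opprB addrC subrK.
(* The extreme indices [n' - k] and [n - k'] differ by at most 2. An [r] strictly between them would
   equal [n' - k' = n - k], which the upper and lower neighbours exclude. *)
have [hr|hr] : (n'%:Z - k%:Z < r) \/ (r < n%:Z - k'%:Z) by lia.
  have := near_rotation hR => /(@near_params_map (fun p => (p.1 + t, p.2)) p0) => /(_ _) N.
  have {N} : \forall p \near p0 & w \near 0^'+, rotation_level (n'%:Z - k%:Z)%:~R w (p.1 + t, p.2).
    by apply: N => p /=; rewrite lexx opprD addrACA subrr addr0.
  apply: filterS2 (near_pos p0) => -[[l u] w] /= w0 h1 h2.
  have := rotation_number_le w0 _ h2 h1 => /(_ ltac:(rewrite lerDl /t; lra)).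
  by rewrite ler_int; lia.
have := near_rotation hL => /(@near_params_map (fun p => (p.1 - t, p.2)) p0) => /(_ _) N.
have {N} : \forall p \near p0 & w \near 0^'+, rotation_level (n%:Z - k'%:Z)%:~R w (p.1 - t, p.2).
  by apply: N => p /=; rewrite lexx opprD addrACA subrr addr0.
apply: filterS2 (near_pos p0) => -[[l u] w] /= w0 h1 h2.
have := rotation_number_le w0 _ h1 h2 => /(_ ltac:(rewrite gerBl /t; lra)).
by rewrite ler_int; lia.
Qed.

End NearRotation.

(** * Constrictions *)

Section ConstrictionLimits.
Context {R : realType}.
Implicit Types (p q : R * R) (l u x y t w : R) (n m k : nat) (r : int) (e : bool).

Lemma startE e : start e = if e then 0 else pi :> R.
Proof. by case: e; rewrite /start ?mulr0 ?mulr1. Qed.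

Lemma constriction_turn w r p e : 0 < w -> constriction r%:~R w p ->
  turn w p e = 2 * pi * r%:~R.
Proof.
move=> w0 [[[Hr _] H0] [_ Hpi] _]; apply: turn_poincare_fixes => //.
by case: e; rewrite startE.
Qed.

Lemma zone_or x : exists n, zone n x \/ x = 2 * n%:R + 1.
Proof.
have [a [b [e [e0 ab H xE]]]] := zone_bracket x.
have [ba|ba] : b = a \/ b = a.+1 by lia.
  have [h1 h2] := H (e / 2) ltac:(lra).
  exists a; left; rewrite -{}ba in h1 h2 *; apply: (zone_between h1 h2).
  by apply/andP; split; lra.
by exists a; right; exact: xE.
Qed.

(* The monotone criteria [near_turn_lt] and [near_turn_gt] exclude a constriction
   near [p] unless both [u + l] and [u - l] are resonant at [p]. *)
Lemma resonant_of_no_turn r p :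
  (forall n m, r = n%:Z - m%:Z + 1 -> p.2 + p.1 < 2 * n%:R + 1 ->
     (m <= 1)%N \/ 2 * m%:R - 3 < p.2 - p.1 -> False) ->
  (forall n m, r = n%:Z - m%:Z - 1 -> (n <= 1)%N \/ 2 * n%:R - 3 < p.2 + p.1 ->
     p.2 - p.1 < 2 * m%:R + 1 -> False) ->
  exists n k, [/\ r = n%:Z - k%:Z, p.2 + p.1 = 2 * n%:R + 1 & p.2 - p.1 = 2 * k%:R + 1].
Proof.
move=> N P; have [n Hs] := zone_or (p.2 + p.1); have [k Hd] := zone_or (p.2 - p.1).
have lt_nat (a b : nat) : (a <= b)%N -> 2 * a%:R + 1 <= 2 * b%:R + 1 :> R.
  by move=> ab; rewrite lerD2r ler_pM2l// ler_nat.
have lowd : (k.+1 <= 1)%N \/ 2 * k.+1%:R - 3 < p.2 - p.1.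
  by rewrite -natr1; case: Hd => [[[->|h] _]|->]; [left|right; lra|right; lra].
have lows : (n.+1 <= 1)%N \/ 2 * n.+1%:R - 3 < p.2 + p.1.
  by rewrite -natr1; case: Hs => [[[->|h] _]|->]; [left|right; lra|right; lra].
have ub N1 : p.2 + p.1 < 2 * N1%:R + 1 -> r < N1%:Z - k%:Z.
  move=> h; rewrite ltNge; apply/negP => hr; apply: (N (absz (r + k%:Z)) k.+1) => //.
    by lia.
  by apply: (lt_le_trans h); apply: lt_nat; lia.
have lb K1 : p.2 - p.1 < 2 * K1%:R + 1 -> n%:Z - K1%:Z < r.
  move=> h; rewrite ltNge; apply/negP => hr; apply: (P n.+1 (absz (n%:Z - r))) => //.
    by lia.
  by apply: (lt_le_trans h); apply: lt_nat; lia.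
case: Hs => [[_ hs]|sE]; case: Hd => [[_ hd]|dE].
- by have := ub n hs; have := lb k hd; lia.
- by have := ub n hs; have := lb k.+1; rewrite dE -natr1 => /(_ ltac:(lra)); lia.
- by have := lb k hd; have := ub n.+1; rewrite sE -natr1 => /(_ ltac:(lra)); lia.
- exists n, k; split => //.
  have := lb k.+1; rewrite dE -natr1 => /(_ ltac:(lra)).
  by have := ub n.+1; rewrite sE -natr1 => /(_ ltac:(lra)); lia.
Qed.

Lemma constriction_seq_limit_resonant r p : constriction_seq_limit r%:~R p ->
  exists n k, [/\ r = n%:Z - k%:Z, p.2 + p.1 = 2 * n%:R + 1 & p.2 - p.1 = 2 * k%:R + 1].
Proof.
move=> [w [c [w0 wl Hc cl]]].
have N (P : R -> R * R -> Prop) : (\forall p \near p & w \near 0^'+, P w p) ->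
    exists j, P (w j) (c j).
  move=> [[A B] /= [nA nB] AB].
  have hA : \forall j \near \oo, A (c j) by exact: cl.
  have hB : \forall j \near \oo, B (w j).
    have : \forall j \near \oo, 0 < w j -> B (w j) := wl _ nB.
    by apply: filterS => j; apply.
  have [j [Aj Bj]] := @filter_ex _ _ _ _ (filterI hA hB).
  by exists j; exact: (AB (c j, w j)).
apply: resonant_of_no_turn => n m rE h1 h2.
  have [j] := N _ (near_turn_lt rE h1 h2).
  by rewrite (constriction_turn _ (w0 j) (Hc j)) ltxx.
have [j] := N _ (near_turn_gt rE h1 h2).
by rewrite (constriction_turn _ (w0 j) (Hc j)) ltxx.
Qed.

End ConstrictionLimits.

(** * Common zeros of two functions increasing in one variable *)

Section ConstrictionExistence.
Context {R : realType}.
Implicit Types (p q : R * R) (l u x y t w : R) (n m k : nat) (r : int) (e : bool).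

Lemma near_compact (K : set (R * R)) (P : R -> R * R -> Prop) : compact K ->
  (forall p, K p -> \forall q \near p & w \near 0^'+, P w q) ->
  \forall w \near 0^'+, forall p, K p -> P w p.
Proof.
move=> /compact_near_coveringP cK H.
exact: (cK R (0^'+) (fun w p => P w p) _ H).
Qed.

Lemma continuous_pair (T : topologicalType) (f g : T -> R) (z : T) :
  {for z, continuous f} -> {for z, continuous g} ->
  {for z, continuous (fun z => (f z, g z))}.
Proof. by move=> cf cg; exact: (cvg_pair cf cg). Qed.

Lemma implicit_zero (A : R * R -> R) l1 l2 : l1 < l2 -> continuous A ->
  (forall l l' u, l < l' -> A (l, u) < A (l', u)) ->
  (forall u, A (l1, u) < 0 < A (l2, u)) ->
  exists f : R -> R, continuous f /\ forall u, l1 < f u < l2 /\ A (f u, u) = 0.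
Proof.
move=> l12 cA iA HA.
have [u|f Hf] := @choice R R (fun u l => l1 < l < l2 /\ A (l, u) = 0).
  have cAu : {within `[l1, l2], continuous (fun l => A (l, u))}.
    apply: continuous_subspaceT => l.
    apply: (@continuous_comp _ _ _ (fun l => (l, u)) A); last exact: cA.
    by apply: continuous_pair => //; exact: cst_continuous.
  have /andP[A1 A2] := HA u.
  have [|c] := IVT (ltW l12) cAu (v := 0).
    by rewrite ge_min le_max (ltW A1) (ltW A2) orbT.
  rewrite in_itv /= => /andP[c1 c2] Ac; exists c; split => //.
  rewrite !lt_neqAle c1 c2 !andbT; apply/andP; split; apply/eqP => E.
    by move: A1; rewrite E Ac ltxx.
  by move: A2; rewrite -E Ac ltxx.
exists f; split => // u.
apply/cvgrPdist_lt => e e0.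
have [/andP[f1 f2] Af] := Hf u.
have lo : A (f u - e, u) < 0 by rewrite -Af iA// gtrBl.
have hi : 0 < A (f u + e, u) by rewrite -Af iA// ltrDl.
have cAl l : {for u, continuous (fun u => A (l, u))}.
  apply: (@continuous_comp _ _ _ (fun u => (l, u)) A); last exact: cA.
  by apply: continuous_pair => //; exact: cst_continuous.
have n1 : \forall v \near u, A (f u - e, v) < 0.
  exact: (cvgr_lt (A (f u - e, u)) (cAl (f u - e)) _ lo).
have n2 : \forall v \near u, 0 < A (f u + e, v).
  exact: (cvgr_gt (A (f u + e, u)) (cAl (f u + e)) _ hi).
apply: filterS2 n1 n2 => v h1 h2; have [_ Av] := Hf v.
rewrite ltr_norml; apply/andP; split.
  rewrite ltNge; apply/negP => h; move: h2; rewrite ltNge -Av => /negP; apply.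
  have [->//|h'] := eqVneq (f u + e) (f v).
  by apply/ltW/iA; rewrite lt_neqAle h' /=; lra.
rewrite ltNge; apply/negP => h; move: h1; rewrite ltNge -Av => /negP; apply.
have [<-//|h'] := eqVneq (f v) (f u - e).
by apply/ltW/iA; rewrite lt_neqAle h' /=; lra.
Qed.

(** The sign of [B] at the ends of the zero curve of [A] is read off at [l0]: [A (l0, u1) < 0] puts
    the curve to the right of [l0], where [B] is larger still, and the opposite holds at [u2]. *)
Lemma common_zero (A B : R * R -> R) l0 l1 l2 u1 u2 : l1 < l2 -> u1 <= u2 ->
  continuous A -> continuous B ->
  (forall l l' u, l < l' -> A (l, u) < A (l', u)) ->
  (forall l l' u, l < l' -> B (l, u) < B (l', u)) ->
  (forall u, u1 <= u <= u2 -> A (l1, u) < 0 < A (l2, u)) ->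
  A (l0, u1) < 0 < B (l0, u1) -> B (l0, u2) < 0 < A (l0, u2) ->
  exists l u, [/\ l1 < l < l2, u1 <= u <= u2, A (l, u) = 0 & B (l, u) = 0].
Proof.
move=> l12 u12 cA cB iA iB HA /andP[A1 B1] /andP[B2 A2].
(* Clamping [u] to [[u1, u2]] extends the sign conditions to all [u], as [implicit_zero]
   requires. *)
pose ka u := Num.max u1 (Num.min u u2).
have kab u : u1 <= ka u <= u2 by rewrite le_max lexx /= ge_max u12 ge_min lexx orbT.
have ck : continuous ka.
  move=> u; apply: (@continuous_max _ _ (cst u1) (id \min cst u2)); first exact: cst_continuous.
  by apply: continuous_min; [|exact: cst_continuous].
have cAk : continuous (fun p => A (p.1, ka p.2)).
  move=> p; apply: (@continuous_comp _ _ _ (fun p => (p.1, ka p.2)) A); last exact: cA.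
  apply: (@continuous_pair _ fst (ka \o snd)); first exact: cvg_fst.
  by apply: continuous_comp; [exact: cvg_snd|exact: ck].
have [f [cf Hf]] := @implicit_zero (fun p => A (p.1, ka p.2)) l1 l2 l12 cAk
  (fun l l' u => @iA l l' (ka u)) (fun u => HA _ (kab u)).
have cg : {within `[u1, u2], continuous (fun u => B (f u, ka u))}.
  apply: continuous_subspaceT => u.
  apply: (@continuous_comp _ _ _ (fun u => (f u, ka u)) B); last exact: cB.
  by apply: continuous_pair; [exact: cf|exact: ck].
have k1 : ka u1 = u1 by rewrite /ka min_l// max_l.
have k2 : ka u2 = u2 by rewrite /ka min_l// max_r.
have g1 : 0 < B (f u1, ka u1).
  have [_ /=] := Hf u1; rewrite k1 => Af; apply: (lt_trans B1); apply: iB.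
  rewrite ltNge; apply/negP; rewrite le_eqVlt => /predU1P[h|h].
    by move: A1; rewrite -h Af ltxx.
  by have := iA _ _ u1 h; rewrite Af; lra.
have g2 : B (f u2, ka u2) < 0.
  have [_ /=] := Hf u2; rewrite k2 => Af; apply: lt_trans B2; apply: iB.
  rewrite ltNge; apply/negP; rewrite le_eqVlt => /predU1P[h|h].
    by move: A2; rewrite h Af ltxx.
  by have := iA _ _ u2 h; rewrite Af; lra.
have [|u] := IVT u12 cg (v := 0).
  by rewrite ge_min le_max (ltW g1) (ltW g2) orbT.
rewrite in_itv /= => ub Bu; have [fb Af] := Hf u.
have ku : ka u = u by have /andP[h1 h2] := ub; rewrite /ka min_l// max_r.
by exists (f u), u; move: Af Bu; rewrite /= ku.
Qed.

End ConstrictionExistence.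

Section ConstrictionsNearVertices.
Context {R : realType}.
Implicit Types (p q : R * R) (l u x y t w : R) (n m k : nat) (r : int) (e : bool).

(** The top corner of the cell of indices [n] and [k]: [u + l = 2 n + 1] and [u - l = 2 k + 1]. *)
Definition vertex n k : R * R := (n%:R - k%:R, n%:R + k%:R + 1).

Lemma near_interior_rotation_level r p : limit_domain r p ->
  \forall w \near 0^'+, (rotation_level r%:~R w : set (R * R))° !=set0.
Proof.
move=> /near_rotation [[A B] /= [nA nB] AB].
apply: filterS nB => w Bw; exists p.
by apply: filterS nA => q Aq; exact: (AB (q, w)).
Qed.

Lemma constriction_of_turn w r p : 0 < w -> 0 < p.2 ->
  (rotation_level r%:~R w : set (R * R))° !=set0 ->
  (forall e, turn w p e = 2 * pi * r%:~R) -> constriction r%:~R w p.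
Proof.
move=> w0 p0 ne H; have rot : has_rotation_number w p r%:~R.
  by apply: (@rotation_number_turn R w p true true) => //; rewrite H.
have F e := @poincare_fixes_turn R w p e r w0 (H e).
split; [| |by rewrite gt_eqF// addr_gt0// mulr_gt0].
- by split; [split|have := F true; rewrite startE].
- by split; [split|have := F false; rewrite startE].
Qed.

Lemma constrictions_near_vertex n k (d : R) : 0 < d ->
  \forall w \near 0^'+, exists2 c, constriction (n%:Z - k%:Z)%:~R w c &
    `|(vertex n k).1 - c.1| < d /\ `|(vertex n k).2 - c.2| < d.
Proof.
move=> d0; set r := n%:Z - k%:Z.
(* The rectangle has half-width [2 h] and half-height [h], so [u + l] stays off [2 n + 1] on both
   vertical sides. The bound [1/4] keeps it within the adjacent cells and keeps [u] positive, whence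
   a nonzero amplitude. *)
pose h := Num.min (d / 4) 4^-1.
have h0 : 0 < h by rewrite lt_min invr_gt0 ltr0n divr_gt0.
have h1 : h <= d / 4 by rewrite ge_min lexx.
have h2 : h <= 4^-1 by rewrite ge_min lexx orbT.
pose l0 := n%:R - k%:R : R; pose u0 := n%:R + k%:R + 1 : R.
have n0 : 0 <= n%:R :> R by []. have k0 : 0 <= k%:R :> R by [].
pose seg l := [set p : R * R | p.1 = l /\ u0 - h <= p.2 <= u0 + h].
have cseg l : compact (seg l).
  rewrite (_ : seg l = [set l] `*` `[u0 - h, u0 + h]%classic).
    by apply: compact_setX; [exact: compact_set1|exact: segment_compact].
  by apply/seteqP; split => p /=; rewrite in_itv.
have N1 : \forall w \near 0^'+, forall p, seg (l0 - 2 * h) p -> turn w p (odd n) < 2 * pi * r%:~R.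
  apply: near_compact => // p [p1 /andP[]]; rewrite /u0 => p2 p3.
  apply: (@near_turn_lt _ n k.+1); first by rewrite /r; lia.
    by rewrite p1 /l0; lra.
  by right; rewrite p1 -natr1 /l0; lra.
have N2 : \forall w \near 0^'+, forall p, seg (l0 + 2 * h) p -> 2 * pi * r%:~R < turn w p (odd n).
  apply: near_compact => // p [p1 /andP[]]; rewrite /u0 => p2 p3.
  (* The index [n.+2] has the parity of [n]: the two criteria, on either side of the resonance,
     concern the same base point. *)
  rewrite -[odd n]negbK; apply: (@near_turn_gt _ n.+2 k.+1); first by rewrite /r; lia.
    by right; rewrite p1 -natr1 -natr1 /l0; lra.
  by rewrite p1 -natr1 /l0; lra.
have at_pt p (P : R -> R * R -> Prop) : (\forall q \near p & w \near 0^'+, P w q) ->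
    \forall w \near 0^'+, P w p.
  by move=> [[A B] /= [nA nB] AB]; apply: filterS nB => w Bw; apply: (AB (p, w)); split => //; exact: nbhs_singleton.
have N3 : \forall w \near 0^'+, turn w (l0, u0 - h) (odd n) < 2 * pi * r%:~R.
  apply: (@at_pt (l0, u0 - h) (fun w p => turn w p (odd n) < 2 * pi * r%:~R)); apply: (@near_turn_lt _ n k.+1); rewrite /= /l0 /u0; first by rewrite /r; lia.
    by lra.
  by right; rewrite -natr1; lra.
have N4 : \forall w \near 0^'+, 2 * pi * r%:~R < turn w (l0, u0 - h) (odd n.+1).
  apply: (@at_pt (l0, u0 - h) (fun w p => 2 * pi * r%:~R < turn w p (odd n.+1))); apply: (@near_turn_gt _ n.+1 k); rewrite /= /l0 /u0; first by rewrite /r; lia.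
    by right; rewrite -natr1; lra.
  by lra.
have N5 : \forall w \near 0^'+, turn w (l0, u0 + h) (odd n.+1) < 2 * pi * r%:~R.
  apply: (@at_pt (l0, u0 + h) (fun w p => turn w p (odd n.+1) < 2 * pi * r%:~R)); apply: (@near_turn_lt _ n.+1 k.+2); rewrite /= /l0 /u0; first by rewrite /r; lia.
    by rewrite -natr1; lra.
  by right; rewrite -natr1 -natr1; lra.
have N6 : \forall w \near 0^'+, 2 * pi * r%:~R < turn w (l0, u0 + h) (odd n).
  apply: (@at_pt (l0, u0 + h) (fun w p => 2 * pi * r%:~R < turn w p (odd n))); rewrite -[odd n]negbK.
  apply: (@near_turn_gt _ n.+2 k.+1); rewrite /= /l0 /u0; first by rewrite /r; lia.
    by right; rewrite -natr1 -natr1; lra.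
  by rewrite -natr1; lra.
have N7 : \forall w \near 0^'+, (rotation_level r%:~R w : set (R * R))° !=set0.
  apply: (@near_interior_rotation_level r (l0, u0 - 2^-1)); apply/limit_domainP; exists n, k.
  by rewrite /l0 /u0; split => //; split => /=; rewrite -/n; try right; lra.
near=> w.
have w0 : 0 < w by near: w; exact: nbhs_right_gt.
have M1 : forall p, seg (l0 - 2 * h) p -> turn w p (odd n) < 2 * pi * r%:~R by near: w.
have M2 : forall p, seg (l0 + 2 * h) p -> 2 * pi * r%:~R < turn w p (odd n) by near: w.
have M3 : turn w (l0, u0 - h) (odd n) < 2 * pi * r%:~R by near: w.
have M4 : 2 * pi * r%:~R < turn w (l0, u0 - h) (odd n.+1) by near: w.
have M5 : turn w (l0, u0 + h) (odd n.+1) < 2 * pi * r%:~R by near: w.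
have M6 : 2 * pi * r%:~R < turn w (l0, u0 + h) (odd n) by near: w.
have M7 : (rotation_level r%:~R w : set (R * R))° !=set0 by near: w.
pose A e p := turn w p e - 2 * pi * r%:~R.
have cA e : continuous (A e).
  by move=> p; apply: cvgB; [exact: continuous_turn|exact: cvg_cst].
have iA e l l' u : l < l' -> A e (l, u) < A e (l', u).
  by move=> ll; rewrite ltrD2r; exact: turn_lt_l.
have [|||l [u [/andP[l1 l2] /andP[u1 u2] Al Bl]]] :=
  @common_zero R (A (odd n)) (A (odd n.+1)) l0 (l0 - 2 * h) (l0 + 2 * h) (u0 - h) (u0 + h)
   ltac:(clear -h0; lra) ltac:(clear -h0; lra) (cA _) (cA _) (iA _) (iA _).
- move=> u ub; rewrite /A subr_lt0 subr_gt0.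
  by rewrite (M1 (l0 - 2 * h, u)) ?(M2 (l0 + 2 * h, u)).
- by rewrite /A subr_lt0 subr_gt0 M3 M4.
- by rewrite /A subr_lt0 subr_gt0 M5 M6.
exists (l, u); last first.
  by rewrite /= !ltr_norml -/l0 -/u0; clear -h0 h1 l1 l2 u1 u2; split; lra.
apply: constriction_of_turn => //=; first by rewrite /u0 in u1; clear -u1 h2 n0 k0; lra.
have E e : A e (l, u) = 0.
  by case: (eqVneq e (odd n)) => [->//|ne]; rewrite (_ : e = odd n.+1)//=; case: (e) (odd n) ne => -[].
by move=> e; apply/eqP; rewrite -subr_eq0; apply/eqP/E.
Unshelve. all: by end_near. Qed.

End ConstrictionsNearVertices.

Section Vertices.
Context {R : realType}.
Implicit Types (p q : R * R) (x y t w : R) (n m k : nat) (r : int).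

Lemma scale_pairE (a : R) p : a *: p = (a * p.1, a * p.2).
Proof. by []. Qed.

Lemma vertexE n k p : p.2 + p.1 = 2 * n%:R + 1 -> p.2 - p.1 = 2 * k%:R + 1 ->
  p = vertex n k.
Proof. by case: p => l u /= h1 h2; congr pair; lra. Qed.

(* Choosing [c w] at almost minimal distance from the vertex makes a single
   function [c] work for all precisions. *)
Lemma constriction_limit_vertex n k :
  constriction_limit (n%:Z - k%:Z)%:~R (vertex n k : R * R).
Proof.
set r := n%:Z - k%:Z; set p := vertex n k.
pose dist (c : R * R) := Num.max `|p.1 - c.1| `|p.2 - c.2|.
pose S w := dist @` (constriction r%:~R w).
have lbS w : has_lbound (S w).
  by exists 0 => _ [c _ <-]; rewrite le_max normr_ge0.
pose c w := xget p [set c | constriction r%:~R w c /\ dist c < inf (S w) + w].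
have ex w : 0 < w -> (exists c, constriction r%:~R w c) ->
    constriction r%:~R w (c w) /\ dist (c w) < inf (S w) + w.
  move=> w0 [c0 Hc0]; have [|_ [c1 Hc1 <-] lt1] := @inf_adherent R (S w) w w0.
    by split => //; exists (dist c0), c0.
  exact: (@xgetI _ p [set c | constriction r%:~R w c /\ dist c < inf (S w) + w] c1).
have near_c e : 0 < e -> \forall w \near 0^'+,
    constriction r%:~R w (c w) /\ `|p.1 - (c w).1| < e /\ `|p.2 - (c w).2| < e.
  move=> e0; have e2 : 0 < e / 2 by rewrite divr_gt0.
  have N := @constrictions_near_vertex R n k (e / 2) e2.
  near=> w.
  have w0 : 0 < w by near: w; exact: nbhs_right_gt.
  have w1 : w < e / 2 by near: w; exact: nbhs_right_lt.
  have [c0 Hc0 [h1 h2]] : exists2 c, constriction r%:~R w c &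
    `|(vertex n k).1 - c.1| < e / 2 /\ `|(vertex n k).2 - c.2| < e / 2 by near: w.
  have [Hc Hd] := ex w w0 (ex_intro _ c0 Hc0).
  have le0 : inf (S w) <= dist c0 by apply: ge_inf => //; exists c0.
  have lt0 : dist c0 < e / 2 by rewrite gt_max h1 h2.
  have : dist (c w) < e by lra.
  by rewrite gt_max => /andP[? ?].
exists c; split; first by apply: filterS (near_c 1 ltr01) => w [].
move=> P /near_prodP[e e0 He]; suff : \forall w \near 0^'+, P (c w) by [].
by apply: filterS (near_c e e0) => w [_ [h1 h2]]; exact: He.
Unshelve. all: by end_near. Qed.

Lemma constriction_limit_seq (rho : R) p :
  constriction_limit rho p -> constriction_seq_limit rho p.
Proof.
move=> [c [/nbhs_ballP[e /= e0 He] cp]].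
(* The denominator starts at 2 so that [w j < e] holds strictly, also for [j = 0]. *)
pose w (j : nat) := e / j.+2%:R.
have wpos j : 0 < w j by rewrite divr_gt0.
have wl : w j @[j --> \oo] --> (0 : R).
  apply/cvgrPdist_lt => d d0.
  have /andP[_ h] := truncn_itv (ltW (divr_gt0 e0 d0)).
  exists (Num.trunc (e / d)) => // j /= hj.
  rewrite sub0r normrN gtr0_norm// ltr_pdivrMr// mulrC -ltr_pdivrMr//.
  by apply: (lt_le_trans h); rewrite ler_nat ltnS (leq_trans hj).
exists w, (c \o w); split => //.
  move=> j; apply: He => //; rewrite /ball /= sub0r normrN gtr0_norm//.
  by rewrite ltr_pdivrMr// ltr_pMr// ltr1n.
move=> P nP; have := cp P nP => -[d /= d0 Hd].
have /cvgrPdist_lt/(_ d d0) := wl.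
apply: filterS => j h; apply: Hd => //.
Qed.

Definition czone n x : Prop := (n = 0%N \/ 2 * n%:R - 1 <= x) /\ x <= 2 * n%:R + 1.

Lemma closure_LambdaP n k p : closure (Lambda k%:Z (n%:Z - k%:Z)) p <->
  czone n (p.2 + p.1) /\ czone k (p.2 - p.1).
Proof.
have LP q : Lambda k%:Z (n%:Z - k%:Z) q <-> zone n (q.2 + q.1) /\ zone k (q.2 - q.1).
  rewrite /Lambda /= (_ : k%:Z + (n%:Z - k%:Z) = n%:Z); last by lia.
  by split => -[/Zint_zone h1 /Zint_zone h2].
split.
  move=> cl.
  have near_pt e : 0 < e -> exists q, [/\ zone n (q.2 + q.1), zone k (q.2 - q.1),
      `|p.1 - q.1| < e & `|p.2 - q.2| < e].
    move=> e0; have := cl [set q | `|p.1 - q.1| < e /\ `|p.2 - q.2| < e].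
    have N : nbhs p [set q | `|p.1 - q.1| < e /\ `|p.2 - q.2| < e].
      by apply: (near_prod e0).
    by move=> /(_ N)[q [/LP[h1 h2] [h3 h4]]]; exists q.
  have Z (m : nat) (f : R * R -> R) : (forall q, `|f p - f q| <= `|p.1 - q.1| + `|p.2 - q.2|) ->
      (forall e, 0 < e -> exists q, [/\ zone m (f q), `|p.1 - q.1| < e & `|p.2 - q.2| < e]) ->
      czone m (f p).
    move=> Hf near_m.
    have up : f p <= 2 * m%:R + 1.
      rewrite leNgt; apply/negP => h.
      have [q [[_ h2] h3 h4]] := near_m ((f p - (2 * m%:R + 1)) / 2) ltac:(lra).
      by have := le_trans (ler_norm _) (Hf q); lra.
    split => //; case: m near_m {up} => [|m] near_m; [by left|right].
    rewrite leNgt; apply/negP => h.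
    have [q [[[//|h1] _] h3 h4]] := near_m ((2 * m.+1%:R - 1 - f p) / 2) ltac:(lra).
    by have := le_trans (ler_norm _) (Hf q); have := ler_norm (f q - f p);
      rewrite distrC => h5; have := le_trans h5 (Hf q); lra.
  split.
    apply: (Z n (fun q => q.2 + q.1)) => [q|e /near_pt[q [h1 _ h3 h4]]]; last by exists q.
    by rewrite opprD addrACA addrC (le_trans (ler_normD _ _)).
  apply: (Z k (fun q => q.2 - q.1)) => [q|e /near_pt[q [_ h1 h3 h4]]]; last by exists q.
  rewrite (_ : _ - _ = (p.2 - q.2) - (p.1 - q.1)); last by ring.
  by rewrite addrC (le_trans (ler_normD _ _))// normrN.
move=> [[h1 h2] [h3 h4]] B /near_prodP[e e0 He].
(* At this point [u + l = 2 n] and [u - l = 2 k], inside the open cell; pulling [p] towards it by a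
   small fraction enters the cell. *)
pose c : R * R := (n%:R - k%:R, n%:R + k%:R).
pose K := `|c.1 - p.1| + `|c.2 - p.2| + 1.
have K0 : 0 < K by rewrite ltr_wpDl// addr_ge0.
pose t := Num.min 2^-1 (e / (2 * K)).
have t0 : 0 < t by rewrite lt_min invr_gt0 ltr0n divr_gt0// mulr_gt0.
have t1 : t <= 2^-1 by rewrite ge_min lexx.
have tK : t * K < e.
  apply: (@le_lt_trans _ _ (e / 2)); last by lra.
  have -> : e / 2 = e / (2 * K) * K by field; rewrite gt_eqF.
  by rewrite ler_pM2r// ge_min lexx orbT.
exists (p.1 + t * (c.1 - p.1), p.2 + t * (c.2 - p.2)); split.
  apply/LP; split => /=.
    rewrite (_ : _ + _ = (1 - t) * (p.2 + p.1) + t * (2 * n%:R)); last by rewrite /c /=; ring.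
    by split; [case: h1 => [->|h1]; [left|right; nra]|nra].
  rewrite (_ : _ - _ = (1 - t) * (p.2 - p.1) + t * (2 * k%:R)); last by rewrite /c /=; ring.
  by split; [case: h3 => [->|h3]; [left|right; nra]|nra].
have small a : `|a| <= K -> `|t * a| < e.
  by move=> aK; rewrite normrM (gtr0_norm t0); apply: le_lt_trans tK; rewrite ler_pM2l.
have := normr_ge0 (c.1 - p.1); have := normr_ge0 (c.2 - p.2) => g1 g2.
by apply: He => /=; rewrite opprD addrA subrr sub0r normrN; apply: small; rewrite /K; lra.
Qed.

End Vertices.

(** * Vertices, Hausdorff limits and shapes *)

Section PolygonVertices.
Context {R : realType}.
Implicit Types (p q : R * R) (x y t w : R) (n m k : nat) (r : int).

(** If [u + l] is not at an end of its interval, the closed cell contains a segment centred at [p]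
    along which [u - l] is constant, and [p] is not extreme; likewise with the two exchanged. *)
Lemma polygon_vertexP n k p : polygon_vertex (Lambda k%:Z (n%:Z - k%:Z)) p ->
  (p.2 + p.1 = 2 * n%:R + 1 \/ n <> 0%N /\ p.2 + p.1 = 2 * n%:R - 1) /\
  (p.2 - p.1 = 2 * k%:R + 1 \/ k <> 0%N /\ p.2 - p.1 = 2 * k%:R - 1).
Proof.
move=> [/closure_LambdaP[Zs Zd] ext].
have edge m x : czone m x -> (x = 2 * m%:R + 1 \/ m <> 0%N /\ x = 2 * m%:R - 1) \/
    exists2 e, 0 < e & forall y, `|y| <= e -> czone m (x + y).
  move=> [h1 h2].
  have [->|xu] := eqVneq x (2 * m%:R + 1); first by left; left.
  have {}h2 : x < 2 * m%:R + 1 by rewrite lt_neqAle xu.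
  have [m0|m0] := eqVneq m 0%N.
    right; exists (2 * m%:R + 1 - x); first by rewrite subr_gt0.
    move=> y; rewrite ler_norml => /andP[_ ?]; split; [by left|lra].
  case: h1 => [/eqP|h1]; first by rewrite (negPf m0).
  have [->|xl] := eqVneq x (2 * m%:R - 1); first by left; right; split => //; exact/eqP.
  have {}h1 : 2 * m%:R - 1 < x by rewrite lt_neqAle eq_sym xl.
  right; exists (Num.min (2 * m%:R + 1 - x) (x - (2 * m%:R - 1))).
    by rewrite lt_min !subr_gt0 h1 h2.
  move=> y; rewrite le_min !ler_norml => /andP[/andP[? ?] /andP[? ?]].
  by split; [right|]; lra.
have half (v : R * R) : p = 2^-1 *: (p + v) + (1 - 2^-1) *: (p - v).
  rewrite !scale_pairE; case: p v {ext Zs Zd edge} => a b [a' b'].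
  by congr pair => /=; field.
have i2 : 0 < (2^-1 : R) < 1 by apply/andP; split; lra.
split.
  have [//|[e e0 He]] := edge _ _ Zs.
  have [||/(congr1 snd) /=] := ext (p + (e / 2, e / 2)) (p - (e / 2, e / 2)) 2^-1 _ _ i2 (half _).
  - apply/closure_LambdaP => /=; split.
      rewrite (_ : _ + _ = p.2 + p.1 + e); last by field.
      by apply: He; rewrite gtr0_norm.
    by rewrite (_ : _ - _ = p.2 - p.1)//; ring.
  - apply/closure_LambdaP => /=; split.
      rewrite (_ : _ + _ = p.2 + p.1 + - e); last by field.
      by apply: He; rewrite normrN gtr0_norm.
    by rewrite (_ : _ - _ = p.2 - p.1)//; ring.
  - by move=> E _; exfalso; lra.
have [//|[e e0 He]] := edge _ _ Zd.
have [||/(congr1 snd) /=] := ext (p + (- (e / 2), e / 2)) (p - (- (e / 2), e / 2)) 2^-1 _ _ i2 (half _).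
- apply/closure_LambdaP => /=; split.
    by rewrite (_ : _ + _ = p.2 + p.1)//; ring.
  rewrite (_ : _ - _ = p.2 - p.1 + e); last by field.
  by apply: He; rewrite gtr0_norm.
- apply/closure_LambdaP => /=; split.
    by rewrite (_ : _ + _ = p.2 + p.1)//; ring.
  rewrite (_ : _ - _ = p.2 - p.1 + - e); last by field.
  by apply: He; rewrite normrN gtr0_norm.
- by move=> E _; exfalso; lra.
Qed.

(** Both [u + l] and [u - l] attain their maximum on the closed cell there, so they are constant on
    any segment through this point. *)
Lemma polygon_vertex_vertex n k : polygon_vertex (Lambda k%:Z (n%:Z - k%:Z)) (vertex n k : R * R).
Proof.
split.
  apply/closure_LambdaP; rewrite /vertex /=; split; split; try right; lra.
move=> x y t /closure_LambdaP[[_ x1] [_ x2]] /closure_LambdaP[[_ y1] [_ y2]] /andP[t0 t1] E.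
have E1 : n%:R - k%:R = t * x.1 + (1 - t) * y.1 by have := congr1 fst E.
have E2 : n%:R + k%:R + 1 = t * x.2 + (1 - t) * y.2 by have := congr1 snd E.
have u0 : 0 < 1 - t by lra.
have H a b c : a <= c -> b <= c -> t * a + (1 - t) * b = c -> a = c /\ b = c.
  by move=> ac bc Eab; split; apply/eqP; rewrite eq_le ?ac ?bc /= leNgt; apply/negP => h; nra.
have [s1 s2] := H _ _ _ x1 y1 ltac:(lra).
have [s3 s4] := H _ _ _ x2 y2 ltac:(lra).
by split; apply: vertexE.
Qed.

Lemma limit_domain_vertexP r p : limit_domain_vertex r p /\ p.1 = r%:~R <->
  exists n k, r = n%:Z - k%:Z /\ p = vertex n k.
Proof.
split.
  move=> [[kz [k0 kr0]] + p1].
  have [k kE] : exists k : nat, kz = k%:Z by exists (absz kz); lia.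
  have [n rE] : exists n : nat, r = n%:Z - k%:Z by exists (absz (kz + r)); lia.
  rewrite {}rE kE in p1 *; move=> /polygon_vertexP[Hs Hd].
  move: p1; rewrite intrD mulrNz -!pmulrn => p1.
  (* The bottom corner of a cell is the top corner of the cell with both indices lowered by 1, which
     has the same [r]. The lateral corners lie on [l = r + 1] and [l = r - 1]. *)
  case: Hs => [sE|[n0 sE]]; case: Hd => [dE|[k1 dE]]; last first.
  - case: n n0 p1 sE => // n _ p1 sE; case: k k1 kE p1 dE sE => // k _ kE p1 dE sE.
    exists n, k; split; first by lia.
    by apply: vertexE; rewrite ?sE ?dE -natr1; ring.
  - by exfalso; clear k0 kr0 kE; lra.
  - by exfalso; clear k0 kr0 kE; lra.
  - by exists n, k; split => //; exact: vertexE.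
move=> [n [k [-> ->]]]; split; last by rewrite /vertex /= intrD mulrNz -!pmulrn.
by exists k%:Z; split; [lia|lia|exact: polygon_vertex_vertex].
Qed.

End PolygonVertices.

(** * Hausdorff convergence on bounded domains *)

Section RegionConvergence.
Context {R : realType}.
Implicit Types (p q : R * R) (D : set (R * R)) (x y t w e : R) (n m k : nat) (r : int).

Lemma near_phase_lock r p0 : limit_domain r p0 ->
  \forall p \near p0 & w \near 0^'+, phase_lock_area r%:~R w p.
Proof.
move=> h; have [[A B] /= [nA nB] AB] := near_rotation h; have N := near_interior_rotation_level h.
exists (A, B `&` [set w | (rotation_level r%:~R w : set (R * R))° !=set0]).
  by split => //=; exact: filterI.
by move=> [p w] [/= Ap [Bw ne]]; split => //; exact: (AB (p, w)).
Qed.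

Lemma near_not_phase_lock r p0 : ~ closure (limit_domain r) p0 ->
  \forall p \near p0 & w \near 0^'+, ~ phase_lock_area r%:~R w p.
Proof. by move=> /near_not_rotation; apply: filterS => -[p w] /= H [/H]. Qed.

(** If both horizontal neighbours had index [r], then [n' - k = n - k'] would force [n' = n] and
    [k' = k], and [p0] would lie in an open cell of the domain. Taking the closure therefore fills
    no slit. *)
Lemma limit_domain_gap r p0 : ~ limit_domain r p0 -> closure (~` closure (limit_domain r)) p0.
Proof.
move=> nL B /near_prodP[d d0 Hd].
have [e [n [n' [k [k' [e0 nn kk H]]]]]] := limit_domain_around p0.
pose t := Num.min e d / 2.
have m0 : 0 < Num.min e d by rewrite lt_min e0.
have m1 : Num.min e d <= e by rewrite ge_min lexx.
have m2 : Num.min e d <= d by rewrite ge_min lexx orbT.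
have t0 : 0 < t by rewrite divr_gt0.
have td : t < d by rewrite /t; lra.
have te : 0 < t < e by rewrite t0 /t; lra.
have [hR hL _ _ hC] := H t te.
have inB a b : `|a| < d -> `|b| < d -> B (p0.1 + a, p0.2 + b).
  by move=> ad bd; apply: Hd; rewrite /= opprD addrA subrr sub0r normrN.
have tn : `|t| < d by rewrite gtr0_norm.
have out s q : limit_domain s q -> s != r -> (~` closure (limit_domain r)) q.
  by move=> hs /eqP sr cl; apply: sr; exact: limit_domain_closure cl.
have [E|ne] := eqVneq (n'%:Z - k%:Z) r; last first.
  exists (p0.1 + t, p0.2); split; first exact: out hR ne.
  by have := inB t 0 tn; rewrite normr0 addr0; apply.
have [E'|ne] := eqVneq (n%:Z - k'%:Z) r; last first.
  exists (p0.1 - t, p0.2); split; first exact: out hL ne.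
  by have := inB (- t) 0; rewrite normrN normr0 addr0; apply.
exfalso; apply: nL; rewrite -E'; have kk' : k' = k by move: E E' nn kk; clear; lia.
by rewrite kk'; apply: hC => //; move: E E' nn kk; clear; lia.
Qed.

Lemma prod_ballP p q e : ball p e q <-> `|p.1 - q.1| < e /\ `|p.2 - q.2| < e.
Proof. by []. Qed.

Lemma compact_closure_bounded D : bounded_set D -> compact (closure D).
Proof.
move=> [M [_ HM]].
pose K := M + 1; have {}HM : forall p, D p -> `|p| <= K by apply: HM; rewrite ltrDl.
pose box : set (R * R) := `[- K, K]%classic `*` `[- K, K]%classic.
have cbox : compact box by apply: compact_setX; exact: segment_compact.
apply: (subclosed_compact _ cbox); first exact: closed_closure.
have clbox : closed box by apply: compact_closed => //; exact: norm_hausdorff.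
move=> p cl; apply: clbox; apply: closureS cl => q /HM.
by rewrite prod_normE ge_max !ler_norml => /andP[h1 h2]; split; rewrite /= in_itv.
Qed.

Lemma near_const p0 (P : R * R -> Prop) : (\forall p \near p0, P p) ->
  \forall p \near p0 & w \near (0 : R)^'+, P p.
Proof.
move=> nP; exists (P, setT); first by split => //=; exact: filterT.
by move=> [p w] [].
Qed.

Lemma near_ball_half p0 q e : 0 < e -> ball p0 (e / 2) q ->
  \forall p \near p0, ball p e q.
Proof.
move=> e0 [h1 h2]; have e2 : 0 < e / 2 by rewrite divr_gt0.
apply: (near_prod e2) => p g1 g2; apply/prod_ballP.
have := ler_distD p0.1 p.1 q.1; have := ler_distD p0.2 p.2 q.2.
have {}h1 : `|p0.1 - q.1| < e / 2 by exact: h1.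
have {}h2 : `|p0.2 - q.2| < e / 2 by exact: h2.
by rewrite (distrC p.1 p0.1) (distrC p.2 p0.2); split; lra.
Qed.

Lemma near_ball_center p0 q e : ball p0 e q -> nbhs q (ball p0 e).
Proof.
move=> /prod_ballP[b1 b2].
apply: (@near_prod R q (Num.min (e - `|p0.1 - q.1|) (e - `|p0.2 - q.2|))).
  by rewrite lt_min !subr_gt0 b1 b2.
move=> x; rewrite !lt_min => /andP[g1 _] /andP[_ g2].
apply/prod_ballP.
by have := ler_distD q.1 p0.1 x.1; have := ler_distD q.2 p0.2 x.2; split; lra.
Qed.

(* A point of the first set in [closure D] can be tested one limit point at a
   time, because [closure D] is compact. *)
Lemma hausdorff_cvg_near D (M : R -> set (R * R)) (N : set (R * R)) :
  bounded_set D ->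
  (forall e p0, 0 < e -> closure D p0 -> \forall p \near p0 & w \near 0^'+,
     M w p -> exists2 q, (N `&` closure D) q & ball p e q) ->
  (forall e q0, 0 < e -> closure D q0 -> \forall q \near q0 & w \near 0^'+,
     N q -> exists2 p, (M w `&` closure D) p & ball q e p) ->
  hausdorff_cvg (fun w => M w `&` closure D) (N `&` closure D).
Proof.
move=> /compact_closure_bounded cD H1 H2 e e0.
have N1 := near_compact cD (fun p0 cl => H1 e p0 e0 cl).
have N2 := near_compact cD (fun q0 cl => H2 e q0 e0 cl).
by apply: filterS2 N1 N2 => w h1 h2; split => p [hp clp]; [exact: h1|exact: h2].
Qed.

Lemma region_cvg_phase_lock r :
  region_cvg (phase_lock_area (r%:~R : R)) (closure (limit_domain r)).
Proof.
move=> D [oD _ _ bD]; set N := closure (limit_domain r).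
have cN : closed N by exact: closed_closure.
have sub : D `<=` closure D by exact: subset_closure.
have half e : 0 < e -> 0 < e / 2 by move=> e0; rewrite divr_gt0.
split => nt; apply: hausdorff_cvg_near => // e p0 e0 cl.
- have [Np|nNp] := pselect (N p0).
    have : \forall p \near p0, ball p e p0.
      by apply: near_ball_half => //; apply: ballxx; exact: half.
    move=> /near_const; apply: filterS => -[p w] /= b _.
    by exists p0.
  by have := near_not_phase_lock nNp; apply: filterS => -[p w] /= h /h.
- have [Np|nNp] := pselect (N p0); last first.
    have : \forall p \near p0, ~ N p.
      by apply: open_nbhs_nbhs; split => //; exact: closed_openC.
    by move=> /near_const; apply: filterS => -[p w] /= h /h.
  (* [nontangent] gives a point of [D] near [p0] and interior to the limit set. The open limit
     domain comes arbitrarily close to it, which yields a single [q2] in the phase-lock area for all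
     small [w]. *)
  have [q1 [[Dq1 Nq1] b1]] := nt p0 (conj cl (subset_closure Np)) (ball p0 (e / 2)) (nbhsx_ballx p0 _ (half _ e0)).
  have nbq1 : nbhs q1 (D `&` ball p0 (e / 2)).
    apply: filterI; first exact: open_nbhs_nbhs.
    exact: near_ball_center b1.
  have clq1 : closure (limit_domain r) q1 := interior_subset Nq1.
  have [q2 [Lq2 [Dq2 b2]]] := clq1 _ nbq1.
  have : \forall w \near 0^'+, phase_lock_area r%:~R w q2.
    have [[A B] /= [nA nB] AB] := near_phase_lock Lq2.
    by apply: filterS nB => w Bw; apply: (AB (q2, w)); split => //; exact: nbhs_singleton.
  have := near_ball_half e0 b2 => nb nw.
  exists ((fun q => ball q e q2), (fun w => phase_lock_area r%:~R w q2)) => // -[q w] [/= hb hw] _.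
  by exists q2 => //; split => //; exact: sub.
- have [Np|nNp] := pselect (N p0); last first.
    have : \forall p \near p0, ball p e p0.
      by apply: near_ball_half => //; apply: ballxx; exact: half.
    by move=> /near_const; apply: filterS => -[p w] /= b _; exists p0.
  have [Lp|nLp] := pselect (limit_domain r p0).
    by have := near_phase_lock Lp; apply: filterS => -[p w] /= h /(_ h).
  (* Here [p0] is a boundary point of the limit domain. It is adherent to the complement of [N] by
     [limit_domain_gap], so [nontangent] for that complement applies. *)
  have [q [[Dq /interior_subset Nq] b]] := nt p0 (conj cl (limit_domain_gap nLp)) (ball p0 (e / 2)) (nbhsx_ballx p0 _ (half _ e0)).
  have := near_ball_half e0 b => /near_const; apply: filterS => -[p w] /= hb _.
  by exists q => //; split => //; exact: sub.
- have [Np|nNp] := pselect (closure (~` N) p0); last first.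
    have : \forall p \near p0, ~ (~` N) p.
      have := open_nbhs_nbhs (conj (closed_openC (@closed_closure _ (~` N))) nNp).
      by apply: filterS => p h1 h2; apply: h1; exact: subset_closure.
    by move=> /near_const; apply: filterS => -[p w] /= h /h.
  have [q [[Dq /interior_subset Nq] b]] := nt p0 (conj cl Np) (ball p0 (e / 2)) (nbhsx_ballx p0 _ (half _ e0)).
  have : \forall w \near 0^'+, ~ phase_lock_area r%:~R w q.
    have [[A B] /= [nA nB] AB] := near_not_phase_lock Nq.
    by apply: filterS nB => w Bw; apply: (AB (q, w)); split => //; exact: nbhs_singleton.
  have := near_ball_half e0 b => nb nw.
  exists ((fun p => ball p e q), (fun w => ~ phase_lock_area r%:~R w q)) => // -[p w] [/= hb hw] _.
  by exists q => //; split => //; exact: sub.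
Qed.

End RegionConvergence.

(** * Shapes of the cells *)

Section Shapes.
Context {R : realType}.
Implicit Types (p q : R * R) (k r : int).

Lemma Zint0 : Zint 0 = [set x : R | x < 1].
Proof. by rewrite /Zint eqxx. Qed.

Lemma Zint_pos k (x : R) : 1 <= k -> Zint k x <-> -1 < x - 2 * k%:~R < 1.
Proof.
move=> k1; rewrite /Zint gt_eqF; last exact: lt_le_trans k1.
by split => /andP[h1 h2]; apply/andP; split; lra.
Qed.

Lemma Lambda_square k r : 1 <= k -> 1 <= k + r -> is_square (Lambda k r : set (R * R)).
Proof.
(* In this frame the coordinates are [u + l - 2 (k + r)] and [u - l - 2 k]. For the half-strips and
   the sector, a zone of index 0 contributes instead 1 minus its form, which is positive. *)
move=> k1 n1; exists (r%:~R, (2 * k + r)%:~R), (2^-1, 2^-1), (- 2^-1, 2^-1).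
split; first by split => /=; [apply/eqP => -[]|apply/eqP => -[]|]; lra.
  by rewrite /= sqrrN.
apply/seteqP; split => p.
  move=> [/(Zint_pos _ n1) h1 /(Zint_pos _ k1) h2].
  exists (p.2 + p.1 - 2 * (k + r)%:~R), (p.2 - p.1 - 2 * k%:~R); split => //.
  case: p h1 h2 => a b /= _ _; rewrite !scale_pairE /= !intrD !intrM.
  by congr pair => /=; field.
move=> [a [b [ha hb ->]]]; rewrite !scale_pairE /=.
split; apply/Zint_pos => //=; rewrite !intrD !intrM.
  by rewrite (_ : _ - _ = a) //; field.
by rewrite (_ : _ - _ = b) //; field.
Qed.

Lemma Lambda_half_strip k r : 0 <= k -> 0 <= k + r -> (k == 0) (+) (k + r == 0) ->
  is_half_strip (Lambda k r : set (R * R)).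
Proof.
have [->|kn] := eqVneq k 0 => /=.
  rewrite add0r => _ r0 rn; have r1 : 1 <= r by lia.
  exists ((2 * r%:~R - 1) / 2, (2 * r%:~R + 1) / 2), (2^-1, 2^-1), (2^-1, - 2^-1).
  split; first by split => /=; [apply/eqP => -[]|apply/eqP => -[]|]; lra.
  apply/seteqP; split => p.
    move=> []; rewrite add0r Zint0 => /(Zint_pos _ r1) h1 /= h2.
    exists (p.2 + p.1 - 2 * r%:~R), (1 - (p.2 - p.1)); split => //; first by rewrite subr_gt0.
    case: p h1 h2 => a b /= _ _; rewrite !scale_pairE /=.
    by congr pair => /=; field.
  move=> [a [b [ha hb ->]]]; rewrite !scale_pairE /=.
  split => /=; last by rewrite Zint0 /=; lra.
  by rewrite add0r; apply/Zint_pos => //=; rewrite (_ : _ - _ = a) //; field.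
move=> k0 n0 /eqP n00; have k1 : 1 <= k by lia.
have -> : r = - k by lia.
exists ((1 - 2 * k%:~R) / 2, (1 + 2 * k%:~R) / 2), (- 2^-1, 2^-1), (- 2^-1, - 2^-1).
split; first by split => /=; [apply/eqP => -[]|apply/eqP => -[]|]; lra.
apply/seteqP; split => p.
  move=> []; rewrite subrr Zint0 => /= h1 /(Zint_pos _ k1) h2.
  exists (p.2 - p.1 - 2 * k%:~R), (1 - (p.2 + p.1)); split => //; first by rewrite subr_gt0.
  case: p h1 h2 => a b /= _ _; rewrite !scale_pairE /=.
  by congr pair => /=; field.
move=> [a [b [ha hb ->]]]; rewrite !scale_pairE /=.
split => /=; first by rewrite subrr Zint0 /=; lra.
by apply/Zint_pos => //=; rewrite (_ : _ - _ = a) //; field.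
Qed.

Lemma Lambda00 : (Lambda 0 0 : set (R * R)) = [set p | p.2 + p.1 < 1 /\ p.2 - p.1 < 1].
Proof. by rewrite /Lambda addr0 Zint0. Qed.

Lemma Lambda_sector : is_sector (0, 1) (Lambda 0 0 : set (R * R)).
Proof.
exists (- 2^-1, - 2^-1), (2^-1, - 2^-1); split; first by apply/eqP => /=; lra.
rewrite Lambda00; apply/seteqP; split => p.
  move=> [h1 h2]; exists (1 - (p.2 + p.1)), (1 - (p.2 - p.1)).
  split; rewrite ?subr_gt0 //; case: p {h1 h2} => a b /=; rewrite !scale_pairE /=.
  by congr pair => /=; field.
by move=> [a [b [ha hb ->]]]; rewrite !scale_pairE /=; split; lra.
Qed.

End Shapes.

Theorem theorem1p2 (R : realType) :
  (forall r : int,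
     region_cvg (phase_lock_area (r%:~R : R)) (closure (limit_domain r))
     /\ (forall k : int, 0 <= k -> 0 <= k + r ->
           [/\ 1 <= k -> 1 <= k + r -> is_square (Lambda k r : set (R * R)),
               (k == 0) (+) (k + r == 0) ->
                 is_half_strip (Lambda k r : set (R * R))
             & k = 0 -> r = 0 ->
                 (Lambda k r : set (R * R))
                   = [set p | p.2 + p.1 < 1 /\ p.2 - p.1 < 1]
                 /\ is_sector (0, 1) (Lambda k r : set (R * R))]))
  /\
  (forall r : int,
     (forall p : R * R,
        limit_domain_vertex r p /\ p.1 = r%:~R <-> constriction_limit r%:~R p)
     /\ (forall p : R * R,
           constriction_seq_limit r%:~R p ->
           limit_domain_vertex r p /\ p.1 = r%:~R)).
Proof.
have seq_vertex r (p : R * R) : constriction_seq_limit r%:~R p ->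
    limit_domain_vertex r p /\ p.1 = r%:~R.
  move=> /constriction_seq_limit_resonant[n [k [rE hs hd]]].
  by apply/limit_domain_vertexP; exists n, k; split => //; exact: vertexE.
split=> r.
  split; first exact: region_cvg_phase_lock.
  move=> k k0 n0; split; first exact: Lambda_square.
    exact: Lambda_half_strip.
  by move=> -> ->; split; [exact: Lambda00|exact: Lambda_sector].
split=> p; last exact: seq_vertex.
split.
  by move=> /limit_domain_vertexP[n [k [-> ->]]]; exact: constriction_limit_vertex.
by move=> /constriction_limit_seq; exact: seq_vertex.
Qed.
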